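(* Let $R_0=K^{(1)}\times\dots\times K^{(p)}$ where $K^{(1)},\dots,K^{(p)}$ are skew fields, let $(R_\lambda)_{\lambda\in\Lambda}$ be a family of faithful $R_0$-rings, and let $R$ be the coproduct of the $R_\lambda$ in the category of $R_0$-rings. Suppose that Condition (P) holds, i.e. for every $\mu\in\Lambda\cup\{0\}$, every $R_\mu$-module $M_\mu$ and all pseudo-free $R_\mu$-modules $M'_\mu$ and $M''_\mu$, $$M_\mu\oplus M'_\mu\cong M''_\mu\ \Longrightarrow\ M_\mu\text{ is pseudo-free}.$$ Then the general linear groupoid $\mathbf{G}(R)$ (with respect to $\mathcal I=\{e^{(1)},\dots,e^{(p)}\}$) is generated by the subgroupoids $\mathbf{G}(R,\mu)$, $\mu\in\Lambda\cup\{0\}$.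
   Context: All rings are associative and unital, homomorphisms and modules are unital, and module means right module. Given a ring $R_0$, an $R_0$-ring is a ring $R$ given with a homomorphism $R_0\to R$; it is faithful if this homomorphism is injective. The $R_0$-rings form a category whose maps are the ring homomorphisms commuting with the given maps from $R_0$. Each canonical map $R_\mu\to R$ ($\mu\in\Lambda\cup\{0\}$, $0\notin\Lambda$) into the coproduct is injective (a known result of Bergman), so $R_\mu$ is identified with its image in $R$. For $1\le j\le p$, $e^{(j)}\in R_0$ denotes the element with $1$ in the $j$-th place and $0$ elsewhere. $\mathcal I=\{e^{(1)},\dots,e^{(p)}\}$ is a complete set of orthogonal idempotents ($e^{(i)}e^{(j)}=\delta_{ij}e^{(i)}$, $\sum_j e^{(j)}=1$) in $R_0$, in each $R_\lambda$ and in $R$. Put $\mathcal S=\bigcup_{n\ge1}\mathcal I^n$. Let $T$ be any of the rings $R$, $R_\mu$. Pseudo-free modules: a finite subset $\mathcal B$ of a $T$-module $M$ is a pseudo-basis for $M$ if for each $1\le j\le p$ there is a subset $\mathcal B_j\subseteq Me^{(j)}$ such that $\mathcal B$ is the disjoint union of the $\mathcal B_j$ and every $x\in M$ can be uniquely written as $x=\sum_{b\in\mathcal B}b\,r_b$ with $r_b\in e^{(j)}T$ whenever $b\in\mathcal B_j$. $M$ is pseudo-free if it has a pseudo-basis. Matrices: for $\sigma\in\mathcal I^m$, $\tau\in\mathcal I^n$, $\mathbb M_{\sigma\times\tau}(T)$ is the set of all $m\times n$ matrices $A$ with $A_{ij}\in\sigma_iT\tau_j$ for all $i,j$. $I_\sigma=\operatorname{diag}(\sigma_1,\dots,\sigma_m)$.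 $\operatorname{GL}_{\sigma\times\tau}(T)$ is the set of those $A\in\mathbb M_{\sigma\times\tau}(T)$ for which there is $B\in\mathbb M_{\tau\times\sigma}(T)$ with $AB=I_\sigma$, $BA=I_\tau$; $\operatorname{GL}_\sigma(T)=\operatorname{GL}_{\sigma\times\sigma}(T)$. The general linear groupoid $\mathbf G(R)$ has object set $\mathcal S$, $\operatorname{Hom}(\sigma,\tau)=\operatorname{GL}_{\tau\times\sigma}(R)$, composition being matrix multiplication, and identity of $\sigma$ being $I_\sigma$. The subgroupoid generated by a set $S$ of morphisms has as objects all sources and targets of elements of $S$ and as morphisms all finite compositions of morphisms from $S\cup S^{-1}$. For $\mu\in\Lambda\cup\{0\}$ and $\sigma\in\mathcal S$, a $\mu$-based transvection is a matrix $I_\sigma+ABC\in\operatorname{GL}_\sigma(R)$ with $A\in\mathbb M_{\sigma\times\tau}(R_\mu)$, $B\in\mathbb M_{\tau\times\tau}(R)$, $C\in\mathbb M_{\tau\times\sigma}(R_\mu)$, where $\tau=(e^{(1)},\dots,e^{(p)})$, and $CA=0$. $\operatorname{T}_\sigma(R,\mu)$ is the subgroup of $\operatorname{GL}_\sigma(R)$ generated by all $\mu$-based transvections. $\mathbf G(R,\mu)$ is the subgroupoid of $\mathbf G(R)$ generated by the sets $\operatorname{GL}_{\sigma\times\tau}(R_\mu)$ and the groups $\operatorname{T}_\sigma(R,\mu)$, where $\sigma,\tau\in\mathcal S$. *)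

(* Defs.v *)
From HB Require Import structures.
From mathcomp Require Import all_boot all_order all_algebra.

Set Implicit Arguments.
Unset Strict Implicit.
Unset Printing Implicit Defensive.

Import GRing.Theory.
Local Open Scope ring_scope.

Definition prod_ring (p : nat) (K : 'I_p -> pzRingType) : Type :=
  {dffun forall j : 'I_p, K j}.

Section ProdRing.
Variables (p : nat) (K : 'I_p -> pzRingType).
Implicit Types x y z : prod_ring K.

HB.instance Definition _ := Choice.on (prod_ring K).

Definition prod_zero : prod_ring K := [ffun j => 0 : K j].
Definition prod_opp x : prod_ring K := [ffun j => - x j : K j].
Definition prod_add x y : prod_ring K := [ffun j => x j + y j : K j].
Definition prod_one : prod_ring K := [ffun j => 1 : K j].
Definition prod_mul x y : prod_ring K := [ffun j => x j * y j : K j].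

Fact prod_addA : associative prod_add.
Proof. by move=> x y z; apply/ffunP=> j; rewrite !ffunE addrA. Qed.
Fact prod_addC : commutative prod_add.
Proof. by move=> x y; apply/ffunP=> j; rewrite !ffunE addrC. Qed.
Fact prod_add0 : left_id prod_zero prod_add.
Proof. by move=> x; apply/ffunP=> j; rewrite !ffunE add0r. Qed.
Fact prod_addN : left_inverse prod_zero prod_opp prod_add.
Proof. by move=> x; apply/ffunP=> j; rewrite !ffunE addNr. Qed.

HB.instance Definition _ := GRing.isZmodule.Build (prod_ring K)
  prod_addA prod_addC prod_add0 prod_addN.

Fact prod_mulA : associative prod_mul.
Proof. by move=> x y z; apply/ffunP=> j; rewrite !ffunE mulrA. Qed.
Fact prod_mul1 : left_id prod_one prod_mul.
Proof. by move=> x; apply/ffunP=> j; rewrite !ffunE mul1r. Qed.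
Fact prod_mulr1 : right_id prod_one prod_mul.
Proof. by move=> x; apply/ffunP=> j; rewrite !ffunE mulr1. Qed.
Fact prod_mulDl : left_distributive prod_mul +%R.
Proof. by move=> x y z; apply/ffunP=> j; rewrite !ffunE mulrDl. Qed.
Fact prod_mulDr : right_distributive prod_mul +%R.
Proof. by move=> x y z; apply/ffunP=> j; rewrite !ffunE mulrDr. Qed.

HB.instance Definition _ := GRing.Zmodule_isPzRing.Build (prod_ring K)
  prod_mulA prod_mul1 prod_mulr1 prod_mulDl prod_mulDr.

Definition prod_idem (j : 'I_p) : prod_ring K :=
  [ffun i => (i == j)%:R : K i].

Fact prod_idemM i j : prod_idem i * prod_idem j = (prod_idem j) *+ (i == j).
Proof.
have [<-|nij] := eqVneq i j; rewrite ?mulr0n ?mulr1n.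
  apply/ffunP=> k; rewrite !ffunE.
  by case: (k == i); rewrite ?mulr1 ?mulr0.
apply/ffunP=> k; rewrite !ffunE; have [->|] := eqVneq k i; last by rewrite mul0r.
by rewrite (negbTE nij) mulr0.
Qed.

End ProdRing.

Section RingUnder.
Variable R0 : pzRingType.

(* The R0-rings. *)
Record ringUnder := RingUnder {
  under_ring :> pzRingType;
  under_map : {rmorphism R0 -> under_ring}
}.

Definition baseUnder : ringUnder := @RingUnder R0 idfun.

Definition faithful (S : ringUnder) : Prop := injective (under_map S).

Definition is_underMor (S T : ringUnder) (f : {rmorphism S -> T}) : Prop :=
  forall x : R0, f (under_map S x) = under_map T x.

Definition is_coproduct (L : Type) (F : L -> ringUnder) (R : ringUnder)
    (iota : forall l : L, {rmorphism F l -> R}) : Prop :=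
  (forall l, is_underMor (iota l)) /\
  forall (T : ringUnder) (g : forall l : L, {rmorphism F l -> T}),
    (forall l, is_underMor (g l)) ->
    exists h : {rmorphism R -> T},
      [/\ is_underMor h,
          forall l, h \o iota l =1 g l
        & forall h' : {rmorphism R -> T},
            is_underMor h' -> (forall l, h' \o iota l =1 g l) -> h' =1 h].

(* The index set of the R_mu is option L, with None in the role of 0. *)
Definition ext_family (L : Type) (F : L -> ringUnder) (mu : option L) :
    ringUnder :=
  if mu is Some l then F l else baseUnder.

Definition ext_map (L : Type) (F : L -> ringUnder) (R : ringUnder)
    (iota : forall l : L, {rmorphism F l -> R}) (mu : option L) :
    {rmorphism ext_family F mu -> R} :=
  match mu return {rmorphism ext_family F mu -> R} with
  | Some l => iota l
  | None => under_map R
  end.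

End RingUnder.

(* Right T-modules are the left modules over the converse ring T^c. *)
Definition ract (T : pzRingType) (M : lmodType T^c) (x : M) (r : T) : M :=
  (r : T^c) *: x.

Section Idempotents.
Variables (p : nat) (K : 'I_p -> pzRingType).
Local Notation R0 := (prod_ring K).

Definition idem (T : ringUnder R0) (j : 'I_p) : T :=
  under_map T (prod_idem K j).

Fact idemM T i j : idem T i * idem T j = (idem T j) *+ (i == j).
Proof. by rewrite -rmorphM prod_idemM rmorphMn. Qed.

Section PseudoFree.
Variables (T : ringUnder R0) (M : lmodType T^c).

Definition pseudo_basis (B : seq M) : Prop :=
  uniq B /\
  exists Bj : 'I_p -> {pred M},
    [/\ forall j b, b \in Bj j -> exists x : M, b = ract x (idem T j),
        forall b, b \in B <-> exists j, b \in Bj j,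
        forall i j b, b \in Bj i -> b \in Bj j -> i = j
      & let admissible (r : M -> T) := forall j b, b \in Bj j ->
          exists s : T, r b = idem T j * s in
        forall x : M,
        exists r : M -> T,
          [/\ admissible r,
              x = \sum_(b <- B) ract b (r b)
            & forall r' : M -> T, admissible r' ->
                x = \sum_(b <- B) ract b (r' b) -> {in B, r' =1 r}]].

Definition pseudo_free : Prop := exists B : seq M, pseudo_basis B.

End PseudoFree.

Definition conditionP (L : Type) (F : L -> ringUnder R0) : Prop :=
  forall (mu : option L) (M M' M'' : lmodType (ext_family F mu)^c),
    pseudo_free M' -> pseudo_free M'' ->
    (exists f : {linear (M * M')%type -> M''}, bijective f) ->
    pseudo_free M.

(* A word in the idempotents e^(1), ..., e^(p) is given by its tuple of
   indices; as long as the K j are nontrivial, j |-> e^(j) is injective. *)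
Section Matrices.
Variable T : ringUnder R0.

Definition in_Mx m n (s : m.-tuple 'I_p) (t : n.-tuple 'I_p)
    (A : 'M[T]_(m, n)) : Prop :=
  forall i j, exists r : T,
    A i j = idem T (tnth s i) * r * idem T (tnth t j).

Definition idmx m (s : m.-tuple 'I_p) : 'M[T]_m :=
  diag_mx (\row_i idem T (tnth s i)).

Definition inverse_Mx m n (s : m.-tuple 'I_p) (t : n.-tuple 'I_p)
    (A : 'M[T]_(m, n)) (B : 'M[T]_(n, m)) : Prop :=
  [/\ in_Mx t s B, A *m B = idmx s & B *m A = idmx t].

Definition in_GL m n (s : m.-tuple 'I_p) (t : n.-tuple 'I_p)
    (A : 'M[T]_(m, n)) : Prop :=
  in_Mx s t A /\ exists B, inverse_Mx s t A B.

Section MatrixFacts.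
Variables (m n q : nat) (s : m.-tuple 'I_p) (t : n.-tuple 'I_p).
Variable u : q.-tuple 'I_p.

Fact mul_idmx A : in_Mx s t A -> idmx s *m A = A.
Proof.
move=> MA; apply/matrixP=> i j; have [r Aij] := MA i j.
by rewrite mul_diag_mx !mxE Aij !mulrA idemM eqxx.
Qed.

Fact mulmx_idmx A : in_Mx s t A -> A *m idmx t = A.
Proof.
move=> MA; apply/matrixP=> i j; have [r Aij] := MA i j.
by rewrite mul_mx_diag !mxE Aij -!mulrA idemM eqxx.
Qed.

Fact in_Mx_idmx : in_Mx s s (idmx s).
Proof.
move=> i j; exists (i == j)%:R; rewrite !mxE mulr_natr mulrnAl idemM.
by have [->|] := eqVneq i j; rewrite ?eqxx // !mulr0n.
Qed.

Fact in_Mx_mul A B : in_Mx s t A -> in_Mx t u B -> in_Mx s u (A *m B).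
Proof.
move=> MA MB i k.
exists ((A *m B) i k); rewrite !mxE mulr_sumr mulr_suml.
apply: eq_bigr => j _; have [r ->] := MA i j; have [r' ->] := MB j k.
by rewrite !mulrA idemM eqxx mulr1n -!mulrA idemM eqxx mulr1n.
Qed.

Fact in_GL_inv A B : in_Mx s t A -> inverse_Mx s t A B -> in_GL t s B.
Proof. by move=> MA [MB AB BA]; split=> //; exists A. Qed.

End MatrixFacts.

Fact in_GL_idmx m (s : m.-tuple 'I_p) : in_GL s s (idmx s).
Proof.
have Ms := in_Mx_idmx s; have MM := mul_idmx Ms.
by split=> //; exists (idmx s).
Qed.

Fact in_GL_mul m n q (s : m.-tuple 'I_p) (t : n.-tuple 'I_p)
    (u : q.-tuple 'I_p) A B :
  in_GL s t A -> in_GL t u B -> in_GL s u (A *m B).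
Proof.
move=> [MA [A' [MA' AA' A'A]]] [MB [B' [MB' BB' B'B]]].
split; first exact: in_Mx_mul MB.
exists (B' *m A'); split; first exact: in_Mx_mul MA'.
- by rewrite mulmxA -(mulmxA A) BB' (mulmx_idmx MA).
- by rewrite mulmxA -(mulmxA B') A'A (mulmx_idmx MB').
Qed.

End Matrices.

(* The object set of the general linear groupoid: nonempty words. *)
Record word := Word {
  wpred : nat;
  wval :> wpred.+1.-tuple 'I_p
}.

Definition wsize (s : word) : nat := (wpred s).+1.

Section Groupoid.
Variable R : ringUnder R0.

(* A family of sets of morphisms of the general linear groupoid, indexed by
   source s and target t; since Hom(s, t) = GL_(t x s)(R), a morphism has
   wsize t rows and wsize s columns. *)
Definition morset : Type :=
  forall s t : word, 'M[R]_(wsize t, wsize s) -> Prop.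

Definition GLgroupoid : morset := fun s t A => in_GL t s A.

Definition gen_obj (S : morset) (s : word) : Prop :=
  exists t : word, (exists A, S s t A) \/ (exists A, S t s A).

Inductive gen_mor (S : morset) : morset :=
| GenId s : gen_obj S s -> gen_mor S (idmx R s)
| GenMul s t u A B : @S t u A -> @gen_mor S s t B -> gen_mor S (A *m B)
| GenInv s t u A A' B : @S u t A -> inverse_Mx t u A A' ->
    @gen_mor S s t B -> gen_mor S (A' *m B).

Definition generates (S : morset) : Prop :=
  (forall s : word, gen_obj S s) /\
  (forall (s t : word) A, @gen_mor S s t A <-> @GLgroupoid s t A).

(* The subring R_mu of R enters as the canonical map j : R_mu -> R. *)
Section Transvections.
Variables (Rmu : ringUnder R0) (j : {rmorphism Rmu -> R}).

Definition transvection (s : word) (D : 'M[R]_(wsize s)) : Prop :=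
  in_GL s s D /\
  exists (A : 'M[Rmu]_(wsize s, p)) (B : 'M[R]_p) (C : 'M[Rmu]_(p, wsize s)),
    [/\ in_Mx s (ord_tuple p) A, in_Mx (ord_tuple p) (ord_tuple p) B,
        in_Mx (ord_tuple p) s C, C *m A = 0
      & D = idmx R s + map_mx j A *m B *m map_mx j C].

Inductive transvection_group (s : word) : 'M[R]_(wsize s) -> Prop :=
| TransId : transvection_group (idmx R s)
| TransMul A B : transvection A -> transvection_group B ->
    transvection_group (A *m B)
| TransInv A A' B : transvection A -> inverse_Mx s s A A' ->
    transvection_group B -> transvection_group (A' *m B).

Inductive based_gens : morset :=
| BasedGL (s t : word) (A : 'M[Rmu]_(wsize t, wsize s)) :
    in_GL t s A -> @based_gens s t (map_mx j A)
| BasedT (s : word) (A : 'M[R]_(wsize s)) :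
    transvection_group A -> @based_gens s s A.

Definition based_groupoid : morset := gen_mor based_gens.

End Transvections.
End Groupoid.
End Idempotents.

(* Main.v *)
From HB Require Import structures.
Require Import Defs.
From mathcomp Require Import all_boot all_order all_algebra.
From mathcomp Require Import boolp.
From mathcomp Require classical_sets.

(** Let N be the right R-module of columns of type t. A matrix in GL over R with
    rows of type t is a basis of N, in the sense of pseudo-bases, so the theorem
    says that any two bases of N are linked by two moves: replace a basis by one
    with the same span over some R_mu, which multiplies the matrix by one over
    R_mu, or apply a based transvection. These moves generate the relation bequiv.

    Bases are compared through trees. A tree is a family of R_mu-submodules V_mu
    of N such that V_0 lies in all V_l. It is collapsed along a label l, with a
    pivot x in V_0, by passing to complements of x R_mu in V_mu for all mu other
    than l, while V_l is kept. A tree is collapsible if finitely many collapses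
    lead to a tree with V_0 = 0 for which N is the direct sum of the V_l R, each
    V_l being pseudo-free; the union of bases of the V_l is then a basis of N.

    This basis does not depend on the collapses, up to the moves
    (collapsible_equiv). By induction on the number of collapses, it is enough to
    compare two collapses of one tree V. If their common parts U_0 and U'_0 are
    different, both collapse further to the intersection. If U_0 = U'_0 and the
    labels are equal, the complements U_mu and U'_mu differ by functionals on V_mu
    that vanish on V_0; these come from a functional D on N, and the
    transvection 1 - x D, a product of based ones, carries one tree to the other
    (collapse_same_label). If the labels are different, the pivot has to be moved
    from one component to another (collapsible_move). This is where Condition (P)
    enters: a complement of x R_l in a pseudo-free R_l-module has to be
    pseudo-free again.

    It remains to find, for two bases b and b', a tree that collapses to both.
    Choose a basis of every R_l over the base that contains the idempotents. The
    products of basis elements from alternating factors are a basis of R over the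
    base, and the products that do not end in R_l are a basis of R over R_l. The
    first fact is proved by making the functions on words a module over each R_l,
    hence over the coproduct (wordRing, wval_ext). Applied to b, the normal form
    shows that any finite subset of N lies in the common part of a tree that is
    spanned by a set of monomials closed under prefixes; removing longest
    monomials collapses it to b (collapsible_grow). Take such a tree whose common
    part contains b', and apply the normal form to b'. If x is a monomial of
    maximal degree, at least 1, in the common part, and nu is the label of its last
    letter, then the coefficients at x over the base and over all factors except
    that of nu agree on the common part, so they define a collapse along nu whose
    common part still contains b'. In the end the common part is spanned by b'
    over the base, and the tree collapses to b' (collapsible_shrink). *)

Set Implicit Arguments.
Unset Strict Implicit.
Unset Printing Implicit Defensive.

Import GRing.Theory.
Local Open Scope ring_scope.

(** * Right modules *)

Notation "x ** r" := (ract x r) (at level 40, left associativity) : ring_scope.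

Section RightAction.
Variables (R : pzRingType) (N : lmodType R^c).
Implicit Types (x y : N) (r s : R).

Lemma ractDl x y r : (x + y) ** r = x ** r + y ** r.
Proof. exact: scalerDr. Qed.
Lemma ractDr x r s : x ** (r + s) = x ** r + x ** s.
Proof. exact: scalerDl. Qed.
Lemma ractM x r s : x ** (r * s) = x ** r ** s.
Proof. by rewrite /ract scalerA. Qed.
Lemma ract1 x : x ** 1 = x.
Proof. exact: scale1r. Qed.
Lemma ractr0 x : x ** 0 = 0.
Proof. exact: scale0r. Qed.
Lemma ract0r r : (0 : N) ** r = 0.
Proof. exact: scaler0. Qed.
Lemma ractNl x r : (- x) ** r = - (x ** r).
Proof. exact: scalerN. Qed.
Lemma ractNr x r : x ** (- r) = - (x ** r).
Proof. exact: scaleNr. Qed.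
Lemma ract_suml (I : Type) (s : seq I) (P : pred I) (f : I -> N) r :
  (\sum_(i <- s | P i) f i) ** r = \sum_(i <- s | P i) f i ** r.
Proof. exact: scaler_sumr. Qed.
Lemma ract_sumr (I : Type) (s : seq I) (P : pred I) x (f : I -> R) :
  x ** (\sum_(i <- s | P i) f i) = \sum_(i <- s | P i) x ** f i.
Proof. exact: scaler_suml. Qed.

End RightAction.

(** * Spans, functionals and transvections *)

(** The setting of the argument about trees: a ring with a family of subrings
    im mu, all containing the subring im None, which plays the part of a finite
    product of skew fields with identities e j. *)
Record based_subrings (R : pzRingType) (p : nat) (L : Type) (e : 'I_p -> R)
    (im : option L -> R -> Prop) : Prop := BasedSubrings {
  im1 : forall mu, im mu 1;
  imB : forall mu r s, im mu r -> im mu s -> im mu (r - s);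
  imM : forall mu r s, im mu r -> im mu s -> im mu (r * s);
  im_base : forall mu r, im None r -> im mu r;
  im_idem : forall j, im None (e j);
  idem_mul : forall i j, e i * e j = e j *+ (i == j);
  idem_sum : \sum_j e j = 1;
  idem_neq0 : forall j, e j != 0;
  idem_comm : forall j r, im None r -> e j * r = r * e j;
  base_inv : forall j r, im None r -> e j * r != 0 ->
    exists r', [/\ im None r', e j * r * r' = e j & r' * (e j * r) = e j]
}.

Section Listed.
Variable X : Type.
Implicit Types (a : X) (s : seq X).

(** Membership in a sequence over a type without decidable equality; it keeps
    track of finitely many labels. *)
Definition listed a s : Prop := foldr (fun a' P => a' = a \/ P) False s.

Lemma listed_cat a s1 s2 : listed a (s1 ++ s2) <-> listed a s1 \/ listed a s2.
Proof.
elim: s1 => [|a' s1 IH] /=; first by split; [right | case].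
by rewrite IH; tauto.
Qed.

Lemma listed_image (I : finType) (f : I -> X) i :
  listed (f i) [seq f k | k <- enum I].
Proof.
have := mem_enum I i; rewrite inE; elim: (enum I) => //= k s IH.
by rewrite inE => /orP[/eqP->|/IH]; [left | right].
Qed.

End Listed.

Section Spans.
Variables (R : pzRingType) (N : lmodType R^c).
Implicit Types (S : R -> Prop) (G V : N -> Prop) (D : N -> R).

Definition rlin D : Prop :=
  (forall x y, D (x + y) = D x + D y) /\ (forall x r, D (x ** r) = D x * r).

Definition submod S V : Prop :=
  [/\ V 0, forall x y, V x -> V y -> V (x + y)
    & forall x r, S r -> V x -> V (x ** r)].

(** The combinations of elements of G with coefficients in S. No sums occur, so
    that a submodule contains lin S G as soon as it contains G. *)
Inductive lin S G : N -> Prop :=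
| lin0 : lin S G 0
| linD x y : lin S G x -> lin S G y -> lin S G (x + y)
| linZ x r : G x -> S r -> lin S G (x ** r).

Definition any_scalar : R -> Prop := fun _ => True.

Lemma rlin0 D : rlin D -> D 0 = 0.
Proof. by case=> _ DZ; rewrite -(ractr0 0) DZ mulr0. Qed.

Lemma rlinN D x : rlin D -> D (- x) = - D x.
Proof.
by case=> _ DZ; rewrite -[x in LHS]ract1 -ractNr DZ mulrN mulr1.
Qed.

Lemma rlin_sum D (I : Type) (s : seq I) (P : pred I) (f : I -> N) :
  rlin D -> D (\sum_(i <- s | P i) f i) = \sum_(i <- s | P i) D (f i).
Proof.
by move=> lD; apply: (big_morph D); [exact: lD.1 | exact: rlin0].
Qed.

Lemma linS S G G' x :
  (forall y, G y -> G' y) -> lin S G x -> lin S G' x.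
Proof.
move=> GG'; elim=> [|y z _ IHy _ IHz|y r Gy Sr]; first exact: lin0.
  exact: linD.
by apply: linZ => //; apply: GG'.
Qed.

Lemma lin_submod S G :
  (forall r s, S r -> S s -> S (r * s)) -> submod S (lin S G).
Proof.
move=> SM; split; [exact: lin0 | exact: linD |].
move=> x r Sr; elim=> [|y z _ IHy _ IHz|y s Gy Ss].
- by rewrite ract0r; apply: lin0.
- by rewrite ractDl; apply: linD.
- by rewrite -ractM; apply: linZ => //; apply: SM.
Qed.

Lemma lin_min S G V : submod S V -> (forall x, G x -> V x) ->
  forall x, lin S G x -> V x.
Proof.
move=> [V0 VD VZ] GV x; elim=> [//|y z _ Vy _ Vz|y r Gy Sr]; first exact: VD.
by apply: VZ => //; apply: GV.
Qed.

Lemma lin_gen S G x : S 1 -> G x -> lin S G x.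
Proof. by move=> S1 Gx; rewrite -[x]ract1; apply: linZ. Qed.

Lemma lin_any_submod G : submod any_scalar (lin any_scalar G).
Proof. by apply: lin_submod. Qed.

Lemma submod_sum S V (I : Type) (s : seq I) (P : pred I) (f : I -> N) :
  submod S V -> (forall i, P i -> V (f i)) -> V (\sum_(i <- s | P i) f i).
Proof. by move=> [V0 VD VZ] Vf; apply: (big_ind V). Qed.

Lemma submodN S V x : S (- 1) -> submod S V -> V x -> V (- x).
Proof.
by move=> S1 [_ _ VZ] Vx; rewrite -[x]ract1 -ractNr; apply: VZ.
Qed.

Lemma submodB S V x y : S (- 1) -> submod S V -> V x -> V y -> V (x - y).
Proof.
by move=> S1 sV Vx Vy; case: (sV) => _ VD _; apply: VD => //; exact: (submodN S1 sV).
Qed.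

Lemma eq_rlin G D D' : rlin D -> rlin D' -> (forall x, lin any_scalar G x) ->
  (forall x, G x -> D x = D' x) -> D =1 D'.
Proof.
move=> lD lD' spG DD' x; elim: (spG x) => [|y z _ IHy _ IHz|y r Gy _].
- by rewrite !rlin0.
- by rewrite lD.1 lD'.1 IHy IHz.
- by rewrite lD.2 lD'.2 DD'.
Qed.

Definition rauto (t t' : N -> N) : Prop :=
  [/\ forall x y, t (x + y) = t x + t y, forall x r, t (x ** r) = t x ** r,
      cancel t t' & cancel t' t].

Lemma rauto_sym t t' : rauto t t' -> rauto t' t.
Proof.
move=> [tD tZ tK tK']; split=> // [x y|x r]; apply: (can_inj tK).
  by rewrite tK' tD !tK'.
by rewrite tK' tZ tK'.
Qed.

Lemma rauto_lin S G t t' x : rauto t t' ->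
  lin S G x -> lin S (fun y => G (t' y)) (t x).
Proof.
move=> [tD tZ tK tK']; elim=> [|y z _ IHy _ IHz|y r Gy Sr].
- by rewrite -(ractr0 0) tZ ractr0; apply: lin0.
- by rewrite tD; apply: linD.
- by rewrite tZ; apply: linZ; rewrite ?tK.
Qed.

Lemma rauto0 t t' : rauto t t' -> t 0 = 0.
Proof. by case=> _ tZ _ _; rewrite -{1}(ractr0 0) tZ ractr0. Qed.

Lemma rlin_comp D t t' : rauto t t' -> rlin D -> rlin (D \o t).
Proof.
by move=> [tD tZ _ _] [DD DZ]; split=> [x y|x r] /=; rewrite ?tD ?tZ ?DD ?DZ.
Qed.

Definition transvect x D (y : N) : N := y + x ** D y.

(** Transvections along one functional D compose by adding their vectors, as D
    kills the vectors; in particular they are invertible. *)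
Lemma transvect_comp x y D z : rlin D -> D y = 0 ->
  transvect x D (transvect y D z) = transvect (x + y) D z.
Proof.
move=> lD Dy; rewrite /transvect lD.1 lD.2 Dy mul0r addr0 ractDl -!addrA.
by congr (_ + _); rewrite addrC.
Qed.

Lemma transvect_auto x D : rlin D -> D x = 0 -> rauto (transvect x D) (transvect (- x) D).
Proof.
move=> lD Dx; split=> [y z|y r|y|y].
- by rewrite /transvect lD.1 ractDr -!addrA; congr (_ + _); rewrite addrCA.
- by rewrite /transvect lD.2 ractDl -ractM.
- by rewrite transvect_comp // addNr /transvect ract0r addr0.
- by rewrite transvect_comp ?rlinN ?Dx ?oppr0 // addrN /transvect ract0r addr0.
Qed.

End Spans.

(** * Trees of submodules and their collapses *)

Section Trees.
Variables (R : pzRingType) (p : nat) (L : Type) (e : 'I_p -> R).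
Variables (im : option L -> R -> Prop) (N : lmodType R^c).
Hypothesis bs : based_subrings e im.
Implicit Types (x y z : N) (r s : R) (mu : option L) (l nu : L).

Lemma im0 mu : im mu 0.
Proof. by rewrite -(subrr 1); apply: (imB bs); apply: (im1 bs). Qed.
Lemma imN1 mu : im mu (- 1).
Proof. by rewrite -[- 1]add0r; apply: (imB bs); [apply: im0 | apply: (im1 bs)]. Qed.
Lemma imN mu r : im mu r -> im mu (- r).
Proof. by move=> ir; rewrite -mulN1r; apply: (imM bs) => //; apply: imN1. Qed.
Lemma imD mu r s : im mu r -> im mu s -> im mu (r + s).
Proof. by move=> ir is_; rewrite -[s]opprK; apply: (imB bs) => //; apply: imN. Qed.
Lemma im_e mu j : im mu (e j).
Proof. by apply: (im_base bs); apply: (im_idem bs). Qed.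
Lemma im_eM mu j r : im mu r -> im mu (e j * r).
Proof. by apply: (imM bs); apply: im_e. Qed.
Lemma eeM j r : e j * (e j * r) = e j * r.
Proof. by rewrite mulrA (idem_mul bs) eqxx. Qed.
Lemma ee j : e j * e j = e j.
Proof. by rewrite (idem_mul bs) eqxx. Qed.

Lemma lin_im_submod mu (G : N -> Prop) : submod (im mu) (lin (im mu) G).
Proof. by apply: lin_submod; apply: (imM bs). Qed.

Lemma submod_imB mu (V : N -> Prop) x y :
  submod (im mu) V -> V x -> V y -> V (x - y).
Proof. by apply: submodB; apply: imN1. Qed.

Lemma submod_add_line mu (V : N -> Prop) x : submod (im mu) V ->
  submod (im mu) (fun y => exists u r, [/\ V u, im mu r & y = u + x ** r]).
Proof.
move=> [V0 VD VZ]; split=> [|y z [u [r [Vu ir ->]]] [v [s [Vv is_ ->]]]|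
    y s is_ [u [r [Vu ir ->]]]].
- by exists 0, 0; rewrite ractr0 addr0; split=> //; apply: im0.
- exists (u + v), (r + s); split; [exact: VD | exact: imD |].
  by rewrite ractDr addrACA.
- exists (u ** s), (r * s); split; [exact: VZ | exact: (imM bs) |].
  by rewrite ractDl ractM.
Qed.

Definition tree : Type := option L -> N -> Prop.

Definition wf (V : tree) : Prop :=
  (forall mu, submod (im mu) (V mu)) /\
  (forall l x, V None x -> V (Some l) x).

(** A collapse splits the pivot x off from every component but one. The
    component with label nu keeps x, so nothing of the module is lost: a family
    of functionals that agree on the common part of the larger tree is
    determined by its restriction to the smaller one. *)
Record collapse (V : tree) (nu : L) (j : 'I_p) (x : N) (U : tree) : Prop :=
  Collapse {
    coll_wf : wf U;
    coll_e : x ** e j = x;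
    coll_x : V None x;
    coll_sub : forall mu y, U mu y -> V mu y;
    coll_nu : forall y, V (Some nu) y -> U (Some nu) y;
    coll_dec : forall mu, mu <> Some nu -> forall y, V mu y ->
      exists u r, [/\ U mu u, im mu r & y = u + x ** r];
    coll_dir : forall mu, mu <> Some nu -> forall r, im mu r ->
      U mu (x ** r) -> e j * r = 0
  }.

(** The labels fl only record, for a fully collapsed tree, the component in which
    a basis vector lies; the relation bequiv below ignores them. *)
Record fam := Fam {
  fI : finType; ft : fI -> 'I_p; fb :> fI -> N; fl : fI -> L }.

Definition gen (b : fam) : N -> Prop := fun x => exists i, x = b i.
Definition genl (b : fam) mu : N -> Prop :=
  fun x => exists i, Some (fl i) = mu /\ x = b i.

(** Pseudo-bases over R; the dual functionals express the uniqueness of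
    coordinates. *)
Definition is_basis (b : fam) : Prop :=
  [/\ forall i, b i ** e (ft i) = b i,
      forall x, lin (@any_scalar R) (gen b) x
    & forall i, exists D, rlin D /\
        forall k, D (b k) = if k == i then e (ft i) else 0].

(** The trees that present N as an amalgam: after n collapses the common part is
    zero and N is the direct sum of the modules generated by the components,
    whose bases together form the basis b. *)
Inductive collapsible : nat -> tree -> fam -> Prop :=
| collapsible0 V b : is_basis b ->
    (forall mu x, V mu x <-> lin (im mu) (genl b mu) x) -> collapsible 0 V b
| collapsibleS n nu j x V U b : wf V -> collapse V nu j x U -> collapsible n U b -> collapsible n.+1 V b.

(** The two moves are, in coordinates, right multiplication by a matrix over one
    of the subrings and by a transvection based on it. Both are phrased without
    coordinates, which makes them stable under automorphisms of N. *)
Inductive bstep (b : fam) : fam -> Prop :=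
| step_span mu (b' : fam) : (forall i, lin (im mu) (gen b) (b' i)) ->
    (forall i, lin (im mu) (gen b') (b i)) -> bstep b b'
| step_transvect mu a beta D (l' : fI b -> L) : lin (im mu) (gen b) a -> rlin D ->
    (forall k, im mu (D (b k))) -> D a = 0 ->
    bstep b (Fam (@ft b) (transvect (a ** beta) D \o b) l').

Inductive bequiv : fam -> fam -> Prop :=
| bequiv_step b b' : is_basis b -> is_basis b' -> bstep b b' -> bequiv b b'
| bequiv_trans b b' b'' : bequiv b b' -> bequiv b' b'' -> bequiv b b''.

Lemma genl_gen b mu x : genl b mu x -> gen b x.
Proof. by case=> i [_ ->]; exists i. Qed.

Lemma bequiv_refl b : is_basis b -> bequiv b b.
Proof.
move=> bb; apply: bequiv_step => //; apply: (@step_span _ None) => i;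
  by apply: lin_gen; [exact: (im1 bs) | exists i].
Qed.

Lemma bequiv_basis b b' : bequiv b b' -> is_basis b /\ is_basis b'.
Proof. by elim=> [//|? ? ? _ [? _] _ [_ ?]]. Qed.

Lemma basis_functional b : is_basis b -> forall c : fI b -> R,
  (forall i, c i * e (ft i) = c i) ->
  exists D, rlin D /\ forall i, D (b i) = c i.
Proof.
move=> [_ _ dual] c ce; have [D PD] := choice dual.
exists (fun x => \sum_i c i * D i x); split; first split=> [x y|x r].
- by rewrite -big_split; apply: eq_bigr => i _; rewrite (PD i).1.1 mulrDr.
- by rewrite mulr_suml; apply: eq_bigr => i _; rewrite (PD i).1.2 mulrA.
move=> k; rewrite (bigD1 k) //= big1 => [|i nik]; rewrite (PD _).2.
  by rewrite eqxx ce addr0.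
by rewrite eq_sym (negbTE nik) mulr0.
Qed.

Definition map_fam (t : N -> N) (b : fam) : fam := Fam (@ft b) (t \o b) (@fl b).

Lemma map_basis t t' b : rauto t t' -> is_basis b -> is_basis (map_fam t b).
Proof.
move=> at_ [b1 b2 b3]; have [tD tZ tK tK'] := at_.
split=> [i|x|i] /=; first by rewrite -tZ b1.
- rewrite -[x]tK'; apply: linS (rauto_lin at_ (b2 (t' x))) => y [i yi].
  by exists i; rewrite /= -yi tK'.
- have [D [lD Dk]] := b3 i; exists (D \o t'); split; last first.
    by move=> k; rewrite /= tK Dk.
  by apply: rlin_comp lD; apply: rauto_sym at_.
Qed.

Lemma rauto_gen t t' b mu x : rauto t t' -> lin (im mu) (gen b) x ->
  lin (im mu) (gen (map_fam t b)) (t x).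
Proof.
move=> at_ /(rauto_lin at_); apply: linS => y [i yi].
by exists i; rewrite /= -yi; case: at_ => _ _ _ ->.
Qed.

Lemma map_step t t' b b' :
  rauto t t' -> bstep b b' -> bstep (map_fam t b) (map_fam t b').
Proof.
move=> at_ []; have [tD tZ tK tK'] := at_.
  by move=> mu c h1 h2; apply: (@step_span _ mu) => i /=; apply: rauto_gen at_ _.
move=> mu a beta D l' la lD iD Da.
have -> : map_fam t (Fam (@ft b) (transvect (a ** beta) D \o b) l') =
    Fam (@ft (map_fam t b)) (transvect (t a ** beta) (D \o t') \o map_fam t b) l'.
  by congr Fam; apply/funext=> i /=; rewrite /transvect /= tD !tZ tK.
apply: (@step_transvect _ mu).
- exact: rauto_gen at_ _.
- by apply: rlin_comp lD; apply: rauto_sym at_.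
- by move=> k /=; rewrite tK.
- by rewrite /= tK.
Qed.

Lemma map_equiv t t' b b' :
  rauto t t' -> bequiv b b' -> bequiv (map_fam t b) (map_fam t b').
Proof.
move=> at_; elim=> [c c' bc bc' s|c c' c'' _ IH1 _ IH2]; last exact: bequiv_trans IH2.
apply: bequiv_step; [exact: map_basis at_ _ | exact: map_basis at_ _ |].
exact: map_step at_ s.
Qed.

Lemma collapsible_basis n V b : collapsible n V b -> is_basis b.
Proof. by elim. Qed.

Lemma genl_None b x : ~ genl b None x.
Proof. by case=> i []. Qed.

Lemma lin_genl_None b x : lin (im None) (genl b None) x -> x = 0.
Proof.
elim=> [//|y z _ -> _ ->|y r /genl_None //]; exact: addr0.
Qed.

Lemma collapsible_wf n V b : collapsible n V b -> wf V.
Proof.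
case=> // {}V {}b bb PV; split=> [mu|l x].
  have [s0 sD sZ] := @lin_im_submod mu (genl b mu).
  split=> [|x y|x r ir]; rewrite !PV //; [exact: sD | exact: sZ].
by move/PV/lin_genl_None->; apply/PV; apply: lin0.
Qed.

(** The universal property of an amalgam, for functionals: a collapse does not
    change the amalgam, and for a fully collapsed tree the values on a basis can
    be prescribed. *)
Lemma collapsible_ext n V b : collapsible n V b -> forall d : option L -> N -> R,
  (forall mu x y, V mu x -> V mu y -> d mu (x + y) = d mu x + d mu y) ->
  (forall mu x r, V mu x -> im mu r -> d mu (x ** r) = d mu x * r) ->
  (forall l x, V None x -> d (Some l) x = d None x) ->
  exists D, rlin D /\ forall mu x, V mu x -> D x = d mu x.
Proof.
elim=> {n V b} [V b bb PV|n nu j x V U b wV cU _ IH] d dD dZ dN.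
  have [b1 _ _] := bb.
  have Vb i : V (Some (fl i)) (b i).
    by apply/PV; apply: lin_gen; [exact: (im1 bs) | exists i].
  have [|D [lD Db]] := basis_functional bb (c := fun i => d (Some (fl i)) (b i)).
    by move=> i; rewrite -dZ ?b1 //; apply: im_e.
  exists D; split=> // mu x Vx; move/PV: (Vx).
  suff H : lin (im mu) (genl b mu) x -> V mu x /\ D x = d mu x by case/H.
  have [s0 sD sZ] := (collapsible_wf (collapsible0 bb PV)).1 mu.
  have d0 : d mu 0 = 0 by rewrite -(ractr0 0) dZ ?mulr0 //; apply: im0.
  elim=> [|y z _ [Vy Dy] _ [Vz Dz]|y r [i [<- ->]] ir].
  - by split=> //; rewrite rlin0.
  - by split; [exact: sD | rewrite lD.1 Dy Dz dD].
  - split; last by rewrite lD.2 Db dZ.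
    by apply/PV; apply: linZ => //; exists i.
have sub := coll_sub cU; have xV := coll_x cU.
have [||//|D [lD DU]] := IH d.
- by move=> mu y z /sub Vy /sub; apply: dD.
- by move=> mu y r /sub; apply: dZ.
- by move=> l y /sub; apply: dN.
have Dx : D x = d None x.
  by rewrite -(dN nu) //; apply: DU; apply: (coll_nu cU); apply: wV.2.
exists D; split=> // mu y Vy.
have [mnu|mnu] := EM (mu = Some nu).
  by apply: DU; rewrite mnu; apply: (coll_nu cU); rewrite -mnu.
have [u [r [Uu ir yE]]] := coll_dec cU mnu Vy.
have Vx : V mu x by case: (mu) => [l|//]; apply: wV.2.
have Vxr : V mu (x ** r) by have [_ _ sZ] := wV.1 mu; apply: sZ.
rewrite yE lD.1 lD.2 (DU _ _ Uu) Dx dD ?dZ //; last exact: sub.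
by congr (_ + _ * r); case: (mu) => // l; rewrite dN.
Qed.

Lemma collapsible_iff n V b : collapsible n V b -> forall V' : tree,
  (forall mu x, V mu x <-> V' mu x) -> collapsible n V' b.
Proof.
move=> fV V' VV'; suff -> : V' = V by [].
by apply/funext=> mu; apply/funext=> x; apply/propext; rewrite VV'.
Qed.

Lemma map_collapsible t t' n V b : rauto t t' -> collapsible n V b ->
  collapsible n (fun mu y => V mu (t' y)) (map_fam t b).
Proof.
move=> at_; have [tD tZ tK tK'] := at_; have at' := rauto_sym at_.
have [tD' tZ' _ _] := at'.
have wft W : wf W -> wf (fun mu y => W mu (t' y)).
  move=> [sW WN]; split=> [mu|l x]; last exact: WN.
  have [s0 sD sZ] := sW mu; split=> [|x y|x r ir].
  - by rewrite (rauto0 at').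
  - by rewrite tD'; apply: sD.
  - by rewrite tZ'; apply: sZ.
elim=> {n V b} [V b bb PV|n nu j x V U b wV cU _ IH].
  apply: collapsible0; first exact: map_basis at_ _.
  move=> mu y; rewrite PV; split=> [/(rauto_lin at_)|/(rauto_lin at')].
    rewrite tK'; apply: linS => z [i [il zi]].
    by exists i; rewrite /= -zi tK'.
  by apply: linS => z [i [il zi]]; exists i; rewrite -[z]tK zi /= tK.
apply: (@collapsibleS n nu j (t x) _ (fun mu y => U mu (t' y))) => //; first exact: wft.
case: cU => wU xe xV sub nuU dec dir; split=> //.
- exact: wft.
- by rewrite -tZ xe.
- by rewrite tK.
- by move=> mu y; apply: sub.
- by move=> y; apply: nuU.
- move=> mu mnu y /(dec _ mnu) [u [r [Uu ir yE]]].
  by exists (t u), r; rewrite tK -tZ -tD -yE tK'; split.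
- by move=> mu mnu r ir; rewrite tZ' tK; apply: dir.
Qed.

End Trees.

(** * Transvections along a functional on a tree *)

Section Transvect.
Variables (R : pzRingType) (p : nat) (L : Type) (e : 'I_p -> R).
Variables (im : option L -> R -> Prop) (N : lmodType R^c).
Hypothesis bs : based_subrings e im.
Implicit Types (x y z : N) (r s : R) (mu : option L) (l nu : L).
Implicit Types (U V : tree L N) (b : fam p L N).

Notation wf := (wf im).
Notation collapse := (collapse e im).
Notation is_basis := (is_basis e).
Notation collapsible := (collapsible e im).
Notation bequiv := (bequiv e im).

(** A vector of the kernel of D that is an R-combination of vectors in the
    kernel having coordinates in im mu: the transvection is a product of one
    based transvection for each term. *)
Lemma bequiv_transvect_span mu b D x : is_basis b -> rlin D ->
  (forall k, im mu (D (b k))) ->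
  lin (@any_scalar R) (fun y => lin (im mu) (gen b) y /\ D y = 0) x ->
  D x = 0 /\ bequiv b (map_fam (transvect x D) b).
Proof.
move=> bb lD iD; elim=> [|y z _ [Dy Ey] _ [Dz Ez]|y r [by_ Dy] _].
- split; first exact: rlin0.
  suff -> : map_fam (transvect 0 D) b = b by exact: bequiv_refl bs _ bb.
  case: (b) => I t f l; congr Fam; apply/funext=> i.
  by rewrite /= /transvect ract0r addr0.
- split; first by rewrite lD.1 Dy Dz addr0.
  have -> : map_fam (transvect (y + z) D) b = map_fam (transvect y D) (map_fam (transvect z D) b).
    by congr Fam; apply/funext=> i; rewrite /= transvect_comp.
  by apply: bequiv_trans Ey _; apply: map_equiv Ez; apply: transvect_auto.
- have Dyr : D (y ** r) = 0 by rewrite lD.2 Dy mul0r.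
  split=> //; apply: bequiv_step => //; first exact: map_basis (transvect_auto lD Dyr) bb.
  exact: step_transvect by_ lD iD Dy.
Qed.

(** The vectors x for which the part of the transvection 1 + x D that comes from
    the component with label l is a product of based transvections: outside that
    component this part of D vanishes anyway. *)
Definition pivotal U (D : N -> R) l : N -> Prop :=
  lin (@any_scalar R) (fun y => (U (Some l) y /\ D y = 0) \/
                           (exists2 l', l' <> l & U (Some l') y)).

(** The pivot lies in the kernel of D and in the surviving component, so it can
    be removed from the other components without leaving the span. *)
Lemma pivotal_collapse U V D nu j x l y : wf V -> collapse V nu j x U ->
  rlin D -> (forall z, V None z -> D z = 0) ->
  pivotal V D l y -> pivotal U D l y.
Proof.
move=> wV cU lD DN; have xV := coll_x cU.
have xU : U (Some nu) x by apply: (coll_nu cU); apply: wV.2.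
have xK r : pivotal U D l (x ** r).
  apply: linZ => //; have [nl|nl] := EM (nu = l).
    by left; split; [rewrite -nl | apply: DN].
  by right; exists nu.
apply: lin_min; first exact: lin_any_submod.
have dec l' z : V (Some l') z -> exists u r,
    [/\ U (Some l') u, z = u + x ** r & D z = D u].
  move=> Vz; have [nl|nl] := EM (Some l' = Some nu).
    exists z, 0; rewrite ractr0 addr0; split=> //.
    by rewrite nl; apply: (coll_nu cU); rewrite -nl.
  have [u [r [Uu ir ->]]] := coll_dec cU nl Vz.
  by exists u, r; split=> //; rewrite lD.1 lD.2 (DN _ xV) mul0r addr0.
move=> z [[Vz Dz]|[l' l'l Vz]]; have [u [r [Uu zE DE]]] := dec _ _ Vz;
  rewrite zE; (apply: linD; last exact: xK); apply: lin_gen => //; [left|right].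
  by split=> //; rewrite -DE.
by exists l'.
Qed.

(** Passing to a full collapse changes neither the hypotheses nor the conclusion.
    For a direct sum of components, D is the sum of its restrictions to the
    finitely many components that occur, and the transvections along these
    restrictions commute. *)
Lemma bequiv_transvect n U b D x : collapsible n U b -> rlin D ->
  (forall mu y, U mu y -> im mu (D y)) -> (forall y, U None y -> D y = 0) ->
  (forall l, pivotal U D l x) -> D x = 0 /\ bequiv b (map_fam (transvect x D) b).
Proof.
elim=> {n U b} [U b bb PU|n nu j z V U b wV cU _ IH] lD iD DN Kx; last first.
  have sub := coll_sub cU.
  apply: IH => // [mu y /sub|y /sub|l]; [exact: iD | exact: DN |].
  exact: pivotal_collapse wV cU lD DN (Kx l).
have [b1 b2 _] := bb.
have Ub i : U (Some (fl i)) (b i).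
  by apply/PU; apply: lin_gen; [exact: (im1 bs) | exists i].
pose P D' (sl : seq L) := rlin D' /\
  forall i, D' (b i) = if `[< listed (fl i) sl >] then D (b i) else 0.
suff H (sl : seq L) D' : P D' sl -> D' x = 0 /\ bequiv b (map_fam (transvect x D') b).
  apply: (H [seq fl i | i <- enum (fI b)]); split=> // i.
  by rewrite asboolT //; apply: listed_image.
(* D' is the part of D carried by the labels in sl. *)
elim: sl D' => [|l sl IHs] D' [lD' D'b].
  apply: (bequiv_transvect_span (mu := None)) => // [k|].
    by rewrite D'b asboolF //; apply: im0 bs _.
  apply: linS (b2 x) => y [i ->]; split; last by rewrite D'b asboolF.
  by apply: lin_gen; [exact: (im1 bs) | exists i].
have [|D1 [lD1 D1b]] := basis_functional bb
    (c := fun i => if `[< listed (fl i) sl >] then D (b i) else 0).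
  by move=> i; case: ifP => _; rewrite ?mul0r // -lD.2 b1.
have [D1x E1] := IHs D1 (conj lD1 D1b).
have [lin_|lin_] := EM (listed l sl).
  suff -> : D' = D1 by split.
  apply/funext; apply: (eq_rlin lD' lD1 b2) => _ [i ->]; rewrite D'b D1b.
  congr (if _ then _ else _); apply: asbool_equiv_eq.
  by split; [case=> [<-|] | move=> ?; right].
pose D2 y := D' y - D1 y.
have lD2 : rlin D2.
  split=> [y z|y r]; rewrite /D2 ?lD'.1 ?lD1.1 ?lD'.2 ?lD1.2; last first.
    by rewrite mulrBl.
  by rewrite opprD -!addrA; congr (_ + _); rewrite addrCA.
have D2b i : D2 (b i) = if `[< l = fl i >] then D (b i) else 0.
  rewrite /D2 D'b D1b; have [<-|li] := EM (l = fl i).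
    by rewrite (asboolF lin_) !asboolT ?subr0 //=; left.
  rewrite (asboolF li); rewrite (_ : `[< listed _ (l :: sl) >] = `[< listed (fl i) sl >]).
    by rewrite subrr.
  by apply: asbool_equiv_eq; split; [case=> [/li []|] | move=> ?; right].
have eqD2 y : U (Some l) y -> D2 y = D y.
  move/PU; elim=> [|u v _ IHu _ IHv|u r [i [[il] ->]] _].
  - by rewrite !rlin0.
  - by rewrite lD2.1 IHu IHv lD.1.
  - by rewrite lD2.2 D2b asboolT ?lD.2.
have zD2 l' y : l' <> l -> U (Some l') y -> D2 y = 0.
  move=> nl' /PU; elim=> [|u v _ IHu _ IHv|u r [i [[il] ->]] _].
  - by rewrite !rlin0.
  - by rewrite lD2.1 IHu IHv addr0.
  - by rewrite lD2.2 D2b asboolF ?mul0r // il => /esym.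
have [D2x E2] : D2 x = 0 /\ bequiv b (map_fam (transvect x D2) b).
  apply: (bequiv_transvect_span (mu := Some l)) => // [k|].
    rewrite D2b; case: asboolP => [->|_]; last exact: im0 bs _.
    exact: iD (Ub k).
  apply: lin_min (Kx l); first exact: lin_any_submod.
  move=> y [[Uy Dy]|[l' nl' Uy]].
    apply: lin_gen => //; split; last by rewrite eqD2.
    by move/PU: Uy; apply: linS => u /genl_gen.
  move/PU: Uy; elim=> [|u v _ IHu _ IHv|u r [i [[il] ->]] _]; first exact: lin0.
    exact: linD.
  apply: linZ => //; split; last by rewrite D2b asboolF // il => /esym.
  by apply: lin_gen; [exact: (im1 bs) | exists i].
have D'E y : D' y = D1 y + D2 y by rewrite /D2 addrCA subrr addr0.
split; first by rewrite D'E D1x D2x addr0.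
have -> : map_fam (transvect x D') b = map_fam (transvect x D2) (map_fam (transvect x D1) b).
  congr Fam; apply/funext=> i /=; rewrite /transvect D'E lD2.1 lD2.2 D2x mul0r addr0.
  by rewrite ractDr addrA.
by apply: bequiv_trans E2 _; apply: map_equiv E1; apply: transvect_auto.
Qed.

(** Two complements of x in the components of V, with the same common part, are
    graphs over one another. The difference is a functional D that vanishes on
    the common part, so it extends to N, and 1 - x D carries one tree to the
    other. *)
Lemma collapse_same_label n V U U' nu j x b : wf V ->
  collapse V nu j x U -> collapse V nu j x U' ->
  (forall y, U None y <-> U' None y) -> collapsible n U b ->
  exists b', collapsible n U' b' /\ bequiv b b'.
Proof.
move=> wV cU cU' UU' fU.
have xN l : V (Some l) x by apply: wV.2; apply: coll_x cU.
have xm mu : V mu x by case: mu => [l|]; [exact: xN | exact: coll_x cU].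
have sub := coll_sub cU; have sub' := coll_sub cU'.
have sU := (coll_wf cU).1; have sU' := (coll_wf cU').1.
(* Q mu y r says that r is the value of the difference functional at y. *)
pose Q mu y r := mu = Some nu /\ r = 0 \/ [/\ mu <> Some nu, im mu r,
  e j * r = r & U' mu (y - x ** r)].
have Qex mu y : U mu y -> exists r, Q mu y r.
  move=> Uy; have [mnu|mnu] := EM (mu = Some nu); first by exists 0; left.
  have [u [r [Uu ir yE]]] := coll_dec cU' mnu (sub _ _ Uy).
  exists (e j * r); right; split=> //; [exact: im_eM bs _ _ _ ir | exact: eeM bs _ _|].
  by rewrite ractM (coll_e cU) yE addrK.
have Quniq mu y r r' : Q mu y r -> Q mu y r' -> r = r'.
  move=> [[-> ->]|[nmu ir er Ur]] [[mE ->]|[nmu' ir' er' Ur']] //.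
  apply/eqP; rewrite -subr_eq0 -er -er' -mulrBr; apply/eqP.
  apply: (coll_dir cU' nmu); first exact: (imB bs).
  have := submod_imB bs (sU' mu) Ur' Ur.
  by rewrite ractDr ractNr opprB addrC addrA subrK.
have /choice [d Pd] : forall my : option L * N, exists r,
    U my.1 my.2 -> Q my.1 my.2 r.
  move=> [mu y]; have [/Qex [r Qr]|nU] := EM (U mu y); first by exists r.
  by exists 0.
have dP mu y r : U mu y -> Q mu y r -> d (mu, y) = r.
  by move=> Uy; apply: Quniq; apply: (Pd (mu, y)).
have [|||D [lD DU]] := collapsible_ext bs fU (d := fun mu y => d (mu, y)).
- move=> mu y z Uy Uz; have [_ UD _] := sU mu; apply: dP; first exact: UD.
  case: (Pd (mu, y) Uy) (Pd (mu, z) Uz).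
    move=> [/= mE ->] [[_ ->]|[]//]; left; by rewrite addr0.
  move=> [/= mE i1_ e1 U1] [[//]|[/= _ i2 e2 U2]]; right; split=> //.
  - exact: imD bs _ _ _ i1_ i2.
  - by rewrite mulrDr e1 e2.
  - rewrite ractDr opprD addrACA; have [_ UD' _] := sU' mu; exact: UD'.
- move=> mu y r Uy ir; have [_ _ UZ] := sU mu; apply: dP; first exact: UZ.
  case: (Pd (mu, y) Uy) => [[/= mE ->]|[/= mE i1_ e1 U1]]; [left|right].
    by rewrite mul0r.
  split=> //; first exact: (imM bs).
    by rewrite mulrA e1.
  by rewrite ractM -ractNl -ractDl; have [_ _ UZ'] := sU' mu; apply: UZ'.
- have dN mu y : U None y -> d (mu, y) = 0.
    move=> Uy; have Um : U mu y by case: (mu) => // l; apply: (coll_wf cU).2.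
    apply: dP => //.
    have [mnu|mnu] := EM (mu = Some nu); [by left | right; split=> //].
    - exact: im0 bs _.
    - by rewrite mulr0.
    - rewrite ractr0 subr0; move/UU': Uy; case: (mu) => // l.
      exact: (coll_wf cU').2.
  by move=> l y Uy; rewrite !dN.
have DQ mu y : U mu y -> Q mu y (D y).
  by move=> Uy; rewrite (DU _ _ Uy); apply: (Pd (mu, y)).
have xU : U (Some nu) x by apply: (coll_nu cU).
have Dx : D x = 0 by case: (DQ _ _ xU) => [[_ ->]|[]//].
have DN y : U None y -> D y = 0.
  move=> Uy; have := DQ (Some nu) y ((coll_wf cU).2 _ _ Uy).
  by case=> [[_ ->]|[]].
have Dx' : D (- x) = 0 by rewrite rlinN // Dx oppr0.
have at_ := transvect_auto lD Dx'.
exists (map_fam (transvect (- x) D) b); split.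
  apply: (collapsible_iff (map_collapsible at_ fU)) => mu y; rewrite opprK.
  have [mnu|mnu] := EM (mu = Some nu).
    rewrite {}mnu; split=> Uy.
      have Uy' : U (Some nu) y.
        have D0 : D (transvect x D y) = 0 by case: (DQ _ _ Uy) => [[_ ->]|[]//].
        move: Uy; rewrite /transvect; move: D0; rewrite /transvect lD.1 lD.2 Dx mul0r addr0.
        by move=> ->; rewrite ractr0 addr0.
      by apply: (coll_nu cU'); apply: sub.
    have Uy' : U (Some nu) y by apply: (coll_nu cU); apply: sub'.
    have D0 : D y = 0 by case: (DQ _ _ Uy') => [[_ ->]|[]//].
    by rewrite /transvect D0 ractr0 addr0.
  split=> Uy.
    have DD : D (transvect x D y) = D y by rewrite /transvect lD.1 lD.2 Dx mul0r addr0.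
    case: (DQ _ _ Uy) => [[/mnu //]|[_ _ _]].
    by rewrite DD /transvect addrK.
  have [u [r [Uu ir yE]]] := coll_dec cU mnu (sub' _ _ Uy).
  have Du : D u = - (e j * r).
    rewrite (DU _ _ Uu); apply: dP => //; right; split=> //.
    - by apply: imN bs _ _ _; apply: im_eM bs _ _ _ ir.
    - by rewrite mulrN (eeM bs).
    - by rewrite ractNr opprK ractM (coll_e cU) -yE.
  rewrite /transvect yE lD.1 lD.2 Dx mul0r addr0 Du ractNr ractM (coll_e cU).
  by rewrite addrK.
have [|||_ //] := bequiv_transvect fU lD (x := - x).
- move=> mu y Uy; case: (DQ _ _ Uy) => [[_ ->]|[]//]; exact: im0 bs _.
- exact: DN.
move=> l; have sK := lin_any_submod (fun y : N => (U (Some l) y /\ D y = 0) \/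
  (exists2 l', l' <> l & U (Some l') y)).
apply: (submodN _ sK) => //; apply: lin_gen => //.
by have [<-|nl] := EM (nu = l); [left | right; exists nu].
Qed.

End Transvect.

(** * Moving a pivot from one component to another *)

Section Confluence.
Variables (R : pzRingType) (p : nat) (L : Type) (e : 'I_p -> R).
Variables (im : option L -> R -> Prop) (N : lmodType R^c).
Hypothesis bs : based_subrings e im.
Implicit Types (x y z : N) (r s : R) (mu : option L) (l nu : L).
Implicit Types (U V : tree L N) (b : fam p L N).

Notation wf := (wf im).
Notation collapse := (collapse e im).
Notation is_basis := (is_basis e).
Notation collapsible := (collapsible e im).
Notation bequiv := (bequiv e im).

Definition factor_basis l (U : N -> Prop) (J : finType) (t : J -> 'I_p)
    (w : J -> N) : Prop :=
  [/\ forall k, w k ** e (t k) = w k,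
      forall y, U y <-> lin (im (Some l)) (fun z => exists k, z = w k) y
    & forall r : J -> R, (forall k, im (Some l) (r k)) ->
        \sum_k w k ** r k = 0 -> forall k, e (t k) * r k = 0].

Definition splitting l (U W : N -> Prop) (j : 'I_p) x : Prop :=
  [/\ submod (im (Some l)) W, forall y, W y -> U y, x ** e j = x /\ U x,
      forall y, U y -> exists u r, [/\ W u, im (Some l) r & y = u + x ** r]
    & forall r, im (Some l) r -> W (x ** r) -> e j * r = 0].

(** Condition (P) for submodules of N and the complement of one basis vector. *)
Definition cancellation : Prop :=
  forall l (U W : N -> Prop) j x (J : finType) (t : J -> 'I_p) (w : J -> N),
    factor_basis l U t w -> splitting l U W j x ->
    exists (J' : finType) (t' : J' -> 'I_p) (w' : J' -> N), factor_basis l W t' w'.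

Hypothesis canP : cancellation.

Lemma lin_coord mu (J : finType) (w : J -> N) y :
  lin (im mu) (fun z => exists k, z = w k) y ->
  exists r : J -> R, (forall k, im mu (r k)) /\ y = \sum_k w k ** r k.
Proof.
elim=> [|u v _ [r [ir ->]] _ [s [is_ ->]]|u r [k ->] ir].
- exists (fun=> 0); split=> [k|]; first exact: im0 bs _.
  by rewrite big1 // => k _; rewrite ractr0.
- exists (fun k => r k + s k); split=> [k|]; first exact: imD bs _ _ _ (ir k) (is_ k).
  by rewrite -big_split; apply: eq_bigr => k _; rewrite ractDr.
- exists (fun k' => if k' == k then r else 0); split=> [k'|].
    by case: eqP => _ //; apply: im0 bs _.
  rewrite (bigD1 k) //= eqxx big1 ?addr0 // => k' /negbTE->.
  by rewrite ractr0.
Qed.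

Lemma factor_basis_dual l (U : N -> Prop) (J : finType) (t : J -> 'I_p)
    (w : J -> N) k0 : factor_basis l U t w -> exists d : N -> R,
  [/\ forall y z, U y -> U z -> d (y + z) = d y + d z,
      forall y r, U y -> im (Some l) r -> d (y ** r) = d y * r
    & forall k, d (w k) = if k == k0 then e (t k0) else 0].
Proof.
move=> [we Uw ind]; have sU : submod (im (Some l)) U.
  have [s0 sD sZ] := lin_im_submod bs (Some l) (fun z => exists k, z = w k).
  by split=> [|y z|y r]; rewrite !Uw //; [apply: sD | apply: sZ].
pose Q y (r : R) := exists c : J -> R, [/\ forall k, im (Some l) (c k),
  y = \sum_k w k ** c k & r = e (t k0) * c k0].
have Qu y r r' : Q y r -> Q y r' -> r = r'.
  move=> [c [ic yc ->]] [c' [ic' yc' ->]]; apply/eqP.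
  rewrite -subr_eq0 -mulrBr; apply/eqP; apply: (ind (fun k => c k - c' k)).
    by move=> k; apply: (imB bs).
  under eq_bigr do rewrite ractDr ractNr; rewrite sumrB -yc -yc'.
  exact: subrr.
have /choice [d Pd] : forall y, exists r, U y -> Q y r.
  move=> y; have [/Uw/lin_coord [c [ic yc]]|] := EM (U y); last by exists 0.
  by exists (e (t k0) * c k0) => _; exists c.
have dP y r : U y -> Q y r -> d y = r by move=> Uy; apply: Qu; apply: Pd.
have [s0 sD sZ] := sU; exists d; split=> [y z Uy Uz|y r Uy ir|k].
- have [c [ic yc ->]] := Pd y Uy; have [c' [ic' yc' ->]] := Pd z Uz.
  apply: dP; first exact: sD.
  exists (fun k => c k + c' k); split; last by rewrite mulrDr.
    by move=> k; apply: imD bs _ _ _ (ic k) (ic' k).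
  by under eq_bigr do rewrite ractDr; rewrite big_split -yc -yc'.
- have [c [ic yc ->]] := Pd y Uy; apply: dP; first exact: sZ.
  exists (fun k => c k * r); split; last by rewrite mulrA.
    by move=> k; apply: (imM bs).
  by under eq_bigr do rewrite ractM; rewrite -ract_suml -yc.
apply: dP; first by apply/Uw; apply: lin_gen; [exact: (im1 bs) | exists k].
exists (fun k' => if k' == k then e (t k) else 0); split.
- by move=> k'; case: eqP => _; [exact: im_e bs _ _ | exact: im0 bs _].
- rewrite (bigD1 k) //= eqxx big1 ?addr0 ?we // => k' /negbTE->.
  by rewrite ractr0.
- by rewrite eq_sym; case: eqP => [->|]; rewrite ?mulr0 // (ee bs).
Qed.

(** Extension by zero on the other components is compatible with the common part
    exactly when d vanishes there. *)
Lemma collapsible_ext_one n U b l (d : N -> R) : collapsible n U b ->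
  (forall y z, U (Some l) y -> U (Some l) z -> d (y + z) = d y + d z) ->
  (forall y r, U (Some l) y -> im (Some l) r -> d (y ** r) = d y * r) ->
  (forall y, U None y -> d y = 0) ->
  exists D, [/\ rlin D, forall y, U (Some l) y -> D y = d y
              & forall mu y, mu <> Some l -> U mu y -> D y = 0].
Proof.
move=> fU dD dZ dN.
have [|||D [lD DU]] :=
    collapsible_ext bs fU (d := fun mu y => if `[< mu = Some l >] then d y else 0).
- move=> mu y z; case: asboolP => [->|_] *; [exact: dD | by rewrite addr0].
- move=> mu y r; case: asboolP => [->|_] *; [exact: dZ | by rewrite mul0r].
- by move=> l' y Uy; rewrite dN //; case: asboolP; case: asboolP.
exists D; split=> // [y Uy|mu y nl Uy]; rewrite (DU _ _ Uy) /=.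
  by rewrite asboolT.
by rewrite asboolF.
Qed.

Definition repl_idx b l (J : finType) : finType :=
  ({i : fI b | ~~ `[< fl i = l >]} + J)%type.

Definition repl b l (J : finType) (t : J -> 'I_p) (w : J -> N) (lab : J -> L)
    : fam p L N :=
  @Fam R p L N (repl_idx b l J)
    (fun i => match i with inl i => ft (sval i) | inr k => t k end)
    (fun i => match i with inl i => b (sval i) | inr k => w k end)
    (fun i => match i with inl i => fl (sval i) | inr k => lab k end).

Lemma collapsible0_span U b : collapsible 0 U b ->
  forall mu x, U mu x <-> lin (im mu) (genl b mu) x.
Proof. by move E: 0%N => n fU; case: fU E. Qed.

Lemma collapsibleS_inv n V b : collapsible n.+1 V b ->
  exists nu j x U, [/\ wf V, collapse V nu j x U & collapsible n U b].
Proof.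
move E: n.+1 => m fV; case: fV E => // m' nu j x {}V U {}b wV cU fU [->].
by exists nu, j, x, U.
Qed.

Lemma collapsible0_gen U b : collapsible 0 U b -> forall i, U (Some (fl i)) (b i).
Proof.
move=> fU i; apply/(collapsible0_span fU).
by apply: lin_gen; [exact: (im1 bs) | exists i].
Qed.

Lemma collapsible0_factor_basis U b : collapsible 0 U b -> forall l,
  factor_basis l (U (Some l)) (fun i : {i : fI b | `[< fl i = l >]} => ft (sval i))
    (fun i => b (sval i)).
Proof.
move=> fU l; have sU := collapsible0_span fU.
have [b1 b2 b3] := collapsible_basis fU.
split=> [[i il] /=|z|r ir]; first exact: b1.
  rewrite sU; split; apply: linS => u.
    case=> i [[/asboolP il] ->]; by exists (exist _ i il).
  by move=> [[i il] ->] /=; exists i; split=> //; congr Some; apply/asboolP.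
move=> h [i il] /=; have [D [lD Db]] := b3 i.
have := rlin0 lD; rewrite -[in D _]h rlin_sum // (bigD1 (exist _ i il)) //=.
rewrite big1 => [|i' ni']; rewrite lD.2 Db ?eqxx ?addr0 //.
case: eqP => [i'i|_]; last by rewrite mul0r.
by case/eqP: ni'; apply: val_inj.
Qed.

(** The two bases have the same span over im (Some l). The dual functionals of
    the new vectors are defined on one component, hence extend to N. *)
Lemma repl_equiv U b l (J : finType) (t : J -> 'I_p) (w : J -> N)
    (lab : J -> L) : collapsible 0 U b -> factor_basis l (U (Some l)) t w ->
  bequiv b (repl b l t w lab).
Proof.
move=> fU fw; have bb := collapsible_basis fU; have sU := collapsible0_span fU.
have [we Uw ind] := fw; set c := repl _ _ _ _ _.
have cb i : lin (im (Some l)) (gen c) (b i).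
  have [il|il] := EM (fl i = l).
    have /Uw : U (Some l) (b i) by rewrite -il; apply: collapsible0_gen.
    by apply: linS => _ [k ->]; exists (inr k).
  have ni : ~~ `[< fl i = l >] by apply/asboolPn.
  by apply: lin_gen; [exact: (im1 bs) | exists (inl (exist _ i ni))].
have wU k : U (Some l) (w k).
  by apply/Uw; apply: lin_gen; [exact: (im1 bs) | exists k].
apply: (bequiv_step bb); last first.
  apply: (step_span (mu := Some l)) => [[[i /= ni]|k]|//].
    by apply: lin_gen; [exact: (im1 bs) | exists i].
  by move/sU: (wU k); apply: linS => y /genl_gen.
have [b1 b2 b3] := bb; split=> [[[i ni]|k] //=|x|[[i ni]|k] /=].
- apply: lin_min (b2 x); first exact: lin_any_submod.
  move=> _ [i ->]; apply: lin_min (cb i); first by split=> *;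
    [exact: lin0 | exact: linD | have [_ _] := @lin_any_submod R N (gen c); apply].
  by move=> y cy; apply: lin_gen.
- have [D [lD Db]] := b3 i; exists D; split=> // -[[i' ni']|k] /=.
    by rewrite Db.
  have /sU := wU k; elim=> [|u v _ IHu _ IHv|u r [i' [[il] ->]] _].
  - exact: rlin0.
  - by rewrite lD.1 IHu IHv addr0.
  - rewrite lD.2 Db; case: eqP => [ii'|_]; last by rewrite mul0r.
    by move/asboolP: ni; rewrite -ii'.
have [d [dD dZ dw]] := factor_basis_dual k fw.
have [||y UN|D [lD Dl D0]] := collapsible_ext_one fU (d := d) (l := l) => //.
  move/sU/lin_genl_None: UN => ->.
  by rewrite -(ractr0 (w k)) dZ ?mulr0 //; apply: im0 bs _.
exists D; split=> // -[[i' ni']|k'] /=; last by rewrite Dl.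
apply: (D0 (Some (fl i'))); last exact: collapsible0_gen.
by move/asboolP: ni' => ni [].
Qed.

Lemma repl_collapsible U b l (J : finType) (t : J -> 'I_p) (w : J -> N) :
  collapsible 0 U b -> factor_basis l (U (Some l)) t w ->
  collapsible 0 U (repl b l t w (fun=> l)).
Proof.
move=> fU fw; have sU := collapsible0_span fU; have [we Uw ind] := fw.
apply: collapsible0; first by have [] := bequiv_basis (repl_equiv (fun=> l) fU fw).
move=> mu x; have [->|ml] := EM (mu = Some l).
  rewrite Uw; split; apply: linS => y; first by case=> k ->; exists (inr k).
  case=> -[[i ni]|k] [] /= h ->; last by exists k.
  by case: h => h; move/asboolP: ni.
rewrite sU; split; apply: linS => y [].
  move=> i [il ->]; have ni : ~~ `[< fl i = l >].
    by apply/asboolPn => h; apply: ml; rewrite -il h.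
  by exists (inl (exist _ i ni)).
by move=> [[i ni]|k] [/= il ->]; [exists i | case: ml].
Qed.

Definition moved U (W : N -> Prop) nu nu' x : tree L N := fun mu y =>
  [\/ mu = Some nu /\ W y,
      mu = Some nu' /\ (exists u r, [/\ U mu u, im mu r & y = u + x ** r])
    | [/\ mu <> Some nu, mu <> Some nu' & U mu y]].

Section Move.
Variables (U : tree L N) (W : N -> Prop) (nu nu' : L) (x : N).
Hypothesis nn' : nu <> nu'.

Lemma moved_nu y : moved U W nu nu' x (Some nu) y <-> W y.
Proof.
split=> [[[_ //]|[[/nn' //]]|[//]]|Wy]; by constructor 1.
Qed.

Lemma moved_nu' y : moved U W nu nu' x (Some nu') y <->
  exists u r, [/\ U (Some nu') u, im (Some nu') r & y = u + x ** r].
Proof.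
split=> [[[[/esym/nn' //]]|[//]|[//]]|H]; by constructor 2.
Qed.

Lemma moved_other mu y : mu <> Some nu -> mu <> Some nu' ->
  (moved U W nu nu' x mu y <-> U mu y).
Proof. by move=> h h'; split=> [[[/h]|[/h']|[]]|]; last by constructor 3. Qed.

Lemma moved_None y : moved U W nu nu' x None y <-> U None y.
Proof. exact: moved_other. Qed.

Lemma moved_wf : wf U -> submod (im (Some nu)) W ->
  (forall y, U None y -> W y) -> wf (moved U W nu nu' x).
Proof.
move=> [sU UN] sW NW; split=> [mu|l y].
  have [->|h] := EM (mu = Some nu).
    by have [s0 sD sZ] := sW; split=> *; rewrite !moved_nu //;
      [apply: sD | apply: sZ] => //; apply/moved_nu.
  have [s0 sD sZ] := sU mu; have [->|h'] := EM (mu = Some nu').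
    have [l0 lD lZ] := submod_add_line bs x (sU (Some nu')).
    by split=> [|y z|y r ir]; rewrite !moved_nu' //; [exact: lD | exact: lZ].
  split=> [|y z /(moved_other _ h h') Uy /(moved_other _ h h') Uz|y r ir].
  - exact/moved_other.
  - by apply/moved_other => //; apply: sD.
  - by move=> /(moved_other _ h h') Uy; apply/moved_other => //; apply: sZ.
move/moved_None => Uy; have [->|h] := EM (Some l = Some nu).
  by apply/moved_nu; apply: NW.
have [->|h'] := EM (Some l = Some nu'); last by apply/moved_other => //; apply: UN.
apply/moved_nu'; exists y, 0; rewrite ractr0 addr0; split=> //; first exact: UN.
exact: im0 bs _.
Qed.

End Move.

Lemma splitting_functional l (U W : N -> Prop) j x : submod (im (Some l)) U ->
  splitting l U W j x -> exists d : N -> R,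
  [/\ forall y z, U y -> U z -> d (y + z) = d y + d z,
      forall y r, U y -> im (Some l) r -> d (y ** r) = d y * r,
      forall y, W y -> d y = 0 & d x = e j].
Proof.
move=> sU [sW WU [xe Ux] dec dir].
pose Q y (r : R) := exists s, [/\ im (Some l) s, W (y - x ** s) & r = e j * s].
have Qu y r r' : Q y r -> Q y r' -> r = r'.
  move=> [s [is_ Ws ->]] [s' [is' Ws' ->]]; apply/eqP.
  rewrite -subr_eq0 -mulrBr; apply/eqP; apply: dir; first exact: (imB bs).
  have := submod_imB bs sW Ws' Ws.
  by rewrite ractDr ractNr opprB addrC addrA subrK.
have /choice [d Pd] : forall y, exists r, U y -> Q y r.
  move=> y; have [/dec [u [r [Wu ir ->]]]|] := EM (U y); last by exists 0.
  by exists (e j * r) => _; exists r; rewrite addrK; split.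
have dP y r : U y -> Q y r -> d y = r by move=> Uy; apply: Qu; apply: Pd.
have [s0 sD sZ] := sU; have [w0 wD wZ] := sW.
exists d; split=> [y z Uy Uz|y r Uy ir|y Wy|].
- have [s [is_ Ws ->]] := Pd y Uy; have [s' [is' Ws' ->]] := Pd z Uz.
  apply: dP; first exact: sD.
  exists (s + s'); split; [exact: imD bs _ _ _ is_ is' | | by rewrite mulrDr].
  by rewrite ractDr opprD addrACA; apply: wD.
- have [s [is_ Ws ->]] := Pd y Uy; apply: dP; first exact: sZ.
  exists (s * r); split; [exact: (imM bs) | | by rewrite mulrA].
  by rewrite ractM -ractNl -ractDl; apply: wZ.
- apply: dP; first exact: WU.
  by exists 0; rewrite ractr0 subr0 mulr0; split=> //; apply: im0 bs _.
- apply: dP => //; exists 1; rewrite ract1 subrr mulr1; split=> //.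
  exact: (im1 bs).
Qed.

Lemma splitting_factor_basis l (U W : N -> Prop) j x (J : finType)
    (t : J -> 'I_p) (w : J -> N) : submod (im (Some l)) U ->
  splitting l U W j x -> factor_basis l W t w ->
  factor_basis l U (fun k : J + unit => if k is inl k then t k else j)
             (fun k => if k is inl k then w k else x).
Proof.
move=> sU [sW WU [xe Ux] dec dir] [we Ww ind].
have wW k : W (w k).
  by apply/Ww; apply: lin_gen; [exact: (im1 bs) | exists k].
split=> [[k|[]] //|y|r ir].
- split; last first.
    apply: lin_min => //.
    by move=> z [[k|[]] ->] //; apply: WU.
  move=> /dec [u [r [/Ww Wu ir ->]]]; apply: linD.
    by apply: linS Wu => _ [k ->]; exists (inl k).
  by apply: linZ => //; exists (inr tt).
rewrite big_sumType /=; set v := \sum_k _; rewrite (bigD1 tt) //=.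
rewrite big1 ?addr0; last by case.
move=> vx; have Wv : W v.
  by rewrite /v; apply: (submod_sum _ sW) => k _; have [_ _ sZ] := sW; apply: sZ.
have er : e j * r (inr tt) = 0.
  apply: dir => //; have -> : x ** r (inr tt) = - v.
    by rewrite -[LHS](addKr v) vx addr0.
  exact: submodN (imN1 bs _) sW Wv.
move=> [k|[] //]; apply: (ind (fun k => r (inl k))) => //.
by move: vx; rewrite -xe -ractM er ractr0 addr0.
Qed.

(** Fully collapsed trees are the place where cancellation is needed: W has a
    basis, and together with x it replaces a basis of the component. In general
    a collapse of U with pivot y yields one of the moved tree, after the collapse
    has been adjusted so that its component with label nu contains x. *)
Lemma collapsible_move n U b : collapsible n U b -> forall (W : N -> Prop) nu nu' j x,
  nu <> nu' -> splitting nu (U (Some nu)) W j x ->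
  (forall y, U None y -> W y) ->
  exists b', collapsible n (moved U W nu nu' x) b' /\ bequiv b b'.
Proof.
elim: n U b => [|n IH] U b fU W nu nu' j x nn' spl NW.
  have PU := collapsible0_span fU; have bb := collapsible_basis fU.
  have sU := (collapsible_wf bs fU).1.
  have fb := collapsible0_factor_basis fU nu.
  have [J [t [w fw]]] := canP fb spl.
  have fx := splitting_factor_basis (sU _) spl fw.
  set t' := fun _ : J + unit => _ in fx; set w' := fun _ => _ in fx.
  exists (repl b nu t' w' (fun k => if k is inl _ then nu else nu')).
  have E := repl_equiv (fun k => if k is inl _ then nu else nu') fU fx.
  split=> //; have [_ bc] := bequiv_basis E; apply: collapsible0 => // mu z.
  have [_ Ww _] := fw; have [sW WU [xe Ux] dec dir] := spl.
  have [->|h] := EM (mu = Some nu).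
    rewrite (moved_nu _ _ _ nn') Ww; split; apply: linS => u.
      by case=> k ->; exists (inr (inl k)).
    case=> -[[i ni]|[k|[]]] [/= h ->]; [|by exists k|].
      by case: h => h; move/asboolP: ni.
    by case: h => /esym.
  have [->|h'] := EM (mu = Some nu').
    rewrite (moved_nu' _ _ _ nn'); split.
      case=> u [r [/PU Uu ir ->]]; apply: linD; last first.
        by apply: linZ => //; exists (inr (inr tt)).
      apply: linS Uu => v [i [il ->]].
      have ni : ~~ `[< fl i = nu >].
        by apply/asboolPn => hi; case: nn'; case: il => <-.
      by exists (inl (exist _ i ni)).
    apply: lin_min (submod_add_line bs x (sU (Some nu'))) _ _ => u [[[i ni]|[k|[]]] [/= hl ->]].
    - exists (b i), 0; rewrite ractr0 addr0; split=> //; last exact: im0 bs _.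
      by rewrite -hl; apply: collapsible0_gen.
    - by case: hl => hl; case: nn'.
    - exists 0, 1; rewrite ract1 add0r; split=> //; last exact: (im1 bs).
      by have [] := sU (Some nu').
  rewrite (moved_other _ _ _ _ h h') PU; split; apply: linS => u [].
    move=> i [il ->]; have ni : ~~ `[< fl i = nu >].
      by apply/asboolPn => hi; apply: h; rewrite -il hi.
    by exists (inl (exist _ i ni)).
  by move=> [[i ni]|[k|[]]] [/= il ->]; [exists i | case: h | case: h'].
have [ka [jy [y [Y [wU cY fY]]]]] := collapsibleS_inv fU.
have [sW WU [xe Ux] dec dir] := spl; have [w0 wD wZ] := sW.
have [d [dD dZ dW dx]] := splitting_functional (wU.1 _) spl.
have [z Uz|D [lD Dd D0]] := collapsible_ext_one fU dD dZ; first by apply: dW; apply: NW.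
have DW z : W z -> D z = 0 by move=> Wz; rewrite Dd ?dW //; apply: WU.
have Dx : D x = e j by rewrite Dd.
have ye := coll_e cY; have yU := coll_x cY; have sub := coll_sub cY.
have Wy r : im (Some nu) r -> W (y ** r) by move=> ir; apply: wZ => //; apply: NW.
have Dy : D y = 0 by apply: DW; apply: NW.
have Dxr z r : D z = 0 -> D (z + x ** r) = 0 -> x ** r = 0.
  by move=> Dz; rewrite lD.1 lD.2 Dz Dx add0r -[x]xe -ractM => ->; rewrite ractr0.
have [wY YN] := coll_wf cY.
(* The functional D separates x from the old component nu'. *)
have dir' r : im (Some nu') r -> (exists u s, [/\ Y (Some nu') u,
    im (Some nu') s & y ** r = u + x ** s]) -> e jy * r = 0 \/ nu' = ka.
  move=> ir [u [s [Yu is_ yE]]]; have [->|nk] := EM (nu' = ka); [by right|left].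
  have xs : x ** s = 0.
    apply: (Dxr u); last by rewrite -yE lD.2 Dy mul0r.
    by apply: (D0 (Some nu')); [case=> /esym | apply: sub].
  by apply: (coll_dir cY) (ir) _; [case | rewrite yE xs addr0].
have dec' z : nu' <> ka -> (exists u r, [/\ U (Some nu') u, im (Some nu') r
    & z = u + x ** r]) -> exists v s, [/\ (exists u r, [/\ Y (Some nu') u,
    im (Some nu') r & v = u + x ** r]), im (Some nu') s & z = v + y ** s].
  move=> nk [u [r [Uu ir ->]]].
  have [|v [s [Yv is_ ->]]] := coll_dec cY _ Uu; first by case.
  exists (v + x ** r), s; split=> //; first by exists v, r.
  by rewrite addrAC.
have [kn|kn] := EM (ka = nu).
  rewrite {}kn in cY dir' dec' *.
  have spl' : splitting nu (Y (Some nu)) W j x.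
    have nuY := coll_nu cY.
    by split=> // [z /WU /nuY //||z /sub /dec //]; split=> //; apply: nuY.
  have [|b' [fb' E]] := IH Y b fY W nu nu' j x nn' spl'.
    by move=> z /sub; apply: NW.
  exists b'; split=> //; apply: (collapsibleS (nu := nu) (j := jy) (x := y)) fb'.
    exact: moved_wf.
  have NWY z : Y None z -> W z by move/sub; apply: NW.
  split=> //.
  - by apply: moved_wf => //.
  - exact/moved_None.
  - move=> mu z [[-> Wz]|[-> [u [r [Yu ir ->]]]]|[h h' Yz]].
    + by constructor 1.
    + by constructor 2; split=> //; exists u, r; split=> //; apply: sub.
    + by constructor 3; split=> //; apply: sub.
  - by move=> z /(moved_nu _ _ _ nn') Wz; apply/(moved_nu _ _ _ nn').
  - move=> mu h z; have [->|h'] := EM (mu = Some nu').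
      move/(moved_nu' _ _ _ nn')/dec' => -[|v [s [Yv is_ ->]]]; first exact/nesym.
      by exists v, s; split=> //; apply/(moved_nu' _ _ _ nn').
    move/(moved_other _ _ _ _ h h') => /(coll_dec cY h) [u [r [Yu ir ->]]].
    by exists u, r; split=> //; apply/moved_other.
  - move=> mu h r ir; have [mE|h'] := EM (mu = Some nu').
      rewrite mE in ir *; move/(moved_nu' _ _ _ nn') => H.
      by have [//|/esym/nn'] := dir' r ir H.
    by move/(moved_other _ _ _ _ h h'); apply: (coll_dir cY).
(* Y1 differs from Y in the component nu, where a complement of y in U is chosen
   that contains x. *)
pose W1 z := W z /\ Y (Some nu) z.
have sW1 : submod (im (Some nu)) W1.
  have [y0 yD yZ] := wY (Some nu).
  split=> // [z1 z2 [? ?] [? ?]|z r ir [? ?]]; first by split; [exact: wD | exact: yD].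
  by split; [exact: wZ | exact: yZ].
pose Y1 : tree L N := fun mu z =>
  (mu = Some nu /\ (exists u r, [/\ W1 u, im (Some nu) r & z = u + x ** r])) \/
  (mu <> Some nu /\ Y mu z).
have Y1nu z : Y1 (Some nu) z <->
    exists u r, [/\ W1 u, im (Some nu) r & z = u + x ** r].
  by split=> [[[_ //]|[//]]|]; left.
have Y1o mu z : mu <> Some nu -> (Y1 mu z <-> Y mu z).
  by move=> h; split=> [[[/h]|[]]|] //; right.
have wfY1 : wf Y1.
  split=> [mu|l z].
    have [->|h] := EM (mu = Some nu); last first.
      have [y0 yD yZ] := wY mu; split=> [|z1 z2|z r ir]; rewrite !Y1o //.
        exact: yD.
      exact: yZ.
    have [l0 l1 lZ] := submod_add_line bs x sW1.
    by split=> [|y1 z|y1 r ir]; rewrite !Y1nu //; [exact: l1 | exact: lZ].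
  rewrite Y1o // => Yz; have [->|h] := EM (Some l = Some nu); last first.
    by apply/Y1o => //; apply: YN.
  apply/Y1nu; exists z, 0; rewrite ractr0 addr0; split=> //; last exact: im0 bs _.
  by split; [apply: NW; apply: sub | apply: YN].
have knS : Some nu <> Some ka by case=> /esym.
have cY1 : collapse U ka jy y Y1.
  split=> //.
  - move=> mu z; have [->|h] := EM (mu = Some nu); last by move/(Y1o _ _ h)/sub.
    move/Y1nu => [u [r [[Wu _] ir ->]]]; have [_ uD uZ] := wU.1 (Some nu).
    by apply: uD; [exact: WU | exact: uZ].
  - move=> z Uz; apply/Y1o; first exact/nesym.
    exact: coll_nu cY _ Uz.
  - move=> mu h z; have [->|h'] := EM (mu = Some nu); last first.
      move/(coll_dec cY h) => [u [r [Yu ir ->]]].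
      by exists u, r; split=> //; apply/Y1o.
    move/dec => [w [r [Ww ir ->]]].
    have [u [s [Yu is_ wE]]] := coll_dec cY knS (WU _ Ww).
    exists (u + x ** r), s; split=> //; last by rewrite wE addrAC.
    apply/Y1nu; exists u, r; split=> //; split=> //.
    have -> : u = w - y ** s by rewrite wE addrK.
    by apply: (submod_imB bs sW) => //; apply: Wy.
  - move=> mu h r ir; have [mE|h'] := EM (mu = Some nu); last first.
      by move/(Y1o _ _ h'); apply: (coll_dir cY).
    rewrite mE in ir *; move/Y1nu=> [u [s [[Wu Yu] is_ yE]]].
    have xs : x ** s = 0.
      by apply: (Dxr u); [exact: DW | rewrite -yE lD.2 Dy mul0r].
    by apply: (coll_dir cY knS ir); rewrite yE xs addr0.
have [|b1 [fb1 E1]] := collapse_same_label bs wU cY cY1 _ fY.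
  by move=> z; rewrite Y1o.
have spl1 : splitting nu (Y1 (Some nu)) W1 j x.
  split=> //.
  - move=> z Wz; apply/Y1nu; exists z, 0; rewrite ractr0 addr0; split=> //.
    exact: im0 bs _.
  - split=> //; apply/Y1nu; exists 0, 1; rewrite ract1 add0r; split=> //.
      by have [] := sW1.
    exact: (im1 bs).
  - by move=> z /Y1nu.
  - by move=> r ir [Wx _]; apply: dir.
have [z Yz|b2 [fb2 E2]] := IH Y1 b1 fb1 W1 nu nu' j x nn' spl1.
  have {}Yz : Y None z by move: Yz; rewrite Y1o.
  by split; [apply: NW; apply: sub | apply: YN].
exists b2; split; last exact: bequiv_trans E2.
apply: (collapsibleS (nu := ka) (j := jy) (x := y)) fb2; first exact: moved_wf.
have wfm : wf (moved Y1 W1 nu nu' x).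
  apply: moved_wf => // z; rewrite Y1o // => Yz.
  by split; [apply: NW; apply: sub | apply: YN].
have nn'S : Some nu' <> Some nu by case=> /esym.
split=> //.
- exact/moved_None.
- move=> mu z [[-> [Wz _]]|[-> [u [r [/(Y1o _ _ nn'S) Yu ir ->]]]]|].
  + by constructor 1.
  + by constructor 2; split=> //; exists u, r; split=> //; apply: sub.
  + move=> [h h' /(Y1o _ _ h) Yz]; constructor 3; split=> //; exact: sub.
- move=> z [[/esym/knS //]|[[kE] [u [r [Uu ir ->]]]]|[h h' Uz]].
    constructor 2; split; first by rewrite kE.
    exists u, r; split=> //; apply/Y1o; first exact/nesym.
    exact: (coll_nu cY).
  constructor 3; split=> //; apply/Y1o => //; exact: (coll_nu cY).
- move=> mu h z; have [->|h1] := EM (mu = Some nu).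
    move/(moved_nu _ _ _ nn') => Wz.
    have [u [s [Yu is_ zE]]] := coll_dec cY knS (WU _ Wz).
    exists u, s; split=> //; apply/(moved_nu _ _ _ nn'); split=> //.
    have -> : u = z - y ** s by rewrite zE addrK.
    by apply: (submod_imB bs sW) => //; apply: Wy.
  have [mE|h'] := EM (mu = Some nu').
    rewrite mE in h *; move/(moved_nu' _ _ _ nn')/dec' => -[|v [s [Yv is_ ->]]].
      by move=> k; apply: h; rewrite k.
    exists v, s; split=> //; apply/(moved_nu' _ _ _ nn').
    move: Yv => [u [r [Yu ir ->]]]; exists u, r; split=> //.
    exact/Y1o.
  move/(moved_other _ _ _ _ h1 h') => /(coll_dec cY h) [u [r [Yu ir ->]]].
  by exists u, r; split=> //; apply/moved_other => //; apply/Y1o.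
- move=> mu h r ir; have [mE|h1] := EM (mu = Some nu).
    rewrite mE in ir *; move/(moved_nu _ _ _ nn') => [_].
    exact: (coll_dir cY).
  have [mE|h'] := EM (mu = Some nu').
    rewrite mE in h ir *; move/(moved_nu' _ _ _ nn') => [u [s [Yu is_ yE]]].
    have [|//|k] := dir' r ir; last by case: h; rewrite k.
    by exists u, s; split=> //; rewrite -Y1o.
  move/(moved_other _ _ _ _ h1 h')/(Y1o _ _ h1); exact: (coll_dir cY).
Qed.

End Confluence.

(** * The basis reached by collapsing a tree *)

Section Unique.
Variables (R : pzRingType) (p : nat) (L : Type) (e : 'I_p -> R).
Variables (im : option L -> R -> Prop) (N : lmodType R^c).
Hypothesis bs : based_subrings e im.
Hypothesis canP : cancellation e im N.
Implicit Types (x y z : N) (r s : R) (mu : option L) (l nu : L).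
Implicit Types (U V : tree L N) (b : fam p L N).

Notation wf := (wf im).
Notation collapse := (collapse e im).
Notation is_basis := (is_basis e).
Notation collapsible := (collapsible e im).
Notation bequiv := (bequiv e im).

Lemma wf_None V mu x : wf V -> V None x -> V mu x.
Proof. by move=> [_ VN]; case: mu => // l; apply: VN. Qed.

(** Any element of the common part outside the complement is a pivot, because a
    nonzero element of a skew field is invertible. *)
Lemma collapse_scale V nu j x U x1 u0 k : collapse V nu j x U ->
  V None x1 -> x1 ** e j = x1 -> x1 = u0 + x ** k -> U None u0 -> im None k ->
  e j * k != 0 -> collapse V nu j x1 U.
Proof.
move=> cU Vx1 x1e x1E Uu0 ik nk.
have [k' [ik' kk' k'k]] := base_inv bs ik nk.
have xE : x = x1 ** k' - u0 ** k'.
  rewrite x1E ractDl addrAC subrr add0r -ractM -(coll_e cU) -ractM.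
  by rewrite !mulrA kk'.
have sU mu := (coll_wf cU).1 mu.
have Uu0r mu r : im mu r -> U mu (u0 ** r).
  move=> ir; have [_ _ sZ] := sU mu; apply: sZ => //.
  exact: wf_None (coll_wf cU) Uu0.
case: (cU) => wU xe xV sub nuU dec dir; split=> // [mu h y|mu h r ir].
  move=> /(dec _ h) [u [r [Uu ir ->]]].
  have ik'r : im mu (k' * r) by apply: (imM bs) => //; apply: (im_base bs).
  exists (u - u0 ** (k' * r)), (k' * r); split=> //.
    by apply: (submod_imB bs (sU mu)) => //; apply: Uu0r.
  by rewrite xE ractDl ractNl -!ractM addrAC addrA.
have ikr : im mu (k * r) by apply: (imM bs) => //; apply: (im_base bs).
rewrite x1E ractDl -ractM => H.
have /(dir _ h _ ikr) E : U mu (x ** (k * r)).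
  rewrite -[x ** _](addKr (u0 ** r)) addrC.
  by apply: (submod_imB bs (sU mu)) => //; apply: Uu0r.
by rewrite -k'k -!mulrA E mulr0.
Qed.

Lemma collapse_nonzero V nu j x U : collapse V nu j x U -> ~ U None x.
Proof.
move=> cU Ux; have /eqP := idem_neq0 bs j; apply.
rewrite -[e j]mulr1; apply: (coll_dir cU (mu := None)) => //.
  exact: (im1 bs).
by rewrite ract1.
Qed.

(** The common part of a collapse is a maximal submodule. *)
Lemma collapse_incomparable V nu j x U nu' j' x' U' : wf V ->
  collapse V nu j x U -> collapse V nu' j' x' U' ->
  (forall y, U' None y -> U None y) -> forall y, U None y -> U' None y.
Proof.
move=> wV cU cU' U'U y Uy; have sU := (coll_wf cU).1 None.
have [//|nU'y] := EM (U' None y).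
have nN l : None <> Some l by [].
have [u [k [Uu ik yE]]] := coll_dec cU' (nN _) (coll_sub cU Uy).
have xe := coll_e cU'; have [U0 UD UZ] := sU.
have [k0|k0] := eqVneq (e j' * k) 0.
  by case: nU'y; rewrite yE -xe -ractM k0 ractr0 addr0.
have [k' [ik' kk' _]] := base_inv bs ik k0.
have Ux' : U None x'.
  have -> : x' = (y - u) ** k'.
    by rewrite yE addrAC subrr add0r -xe -!ractM mulrA kk'.
  by apply: UZ => //; apply: (submod_imB bs sU) => //; apply: U'U.
case: (collapse_nonzero cU).
have [v [k1 [Uv ik1 ->]]] := coll_dec cU' (nN _) (coll_x cU).
by apply: UD; [exact: U'U | exact: UZ].
Qed.

(** If the common parts differ, the pivot of either collapse can be taken in the
    common part of the other one. *)
Lemma collapse_pivot V nu j x U nu' j' x' U' : wf V ->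
  collapse V nu j x U -> collapse V nu' j' x' U' ->
  ~ (forall y, U' None y -> U None y) ->
  exists2 x1, U' None x1 & collapse V nu j x1 U.
Proof.
move=> wV cU cU' /existsNP [y /not_implyP [U'y nUy]].
have nN l : None <> Some l by [].
have [u [k [Uu ik yE]]] := coll_dec cU (nN _) (coll_sub cU' U'y).
have xe := coll_e cU.
have [k0|k0] := eqVneq (e j * k) 0.
  by case: nUy; rewrite yE -xe -ractM k0 ractr0 addr0.
have [k' [ik' kk' _]] := base_inv bs ik k0.
have ike : im None (k' * e j) by apply: (imM bs) => //; apply: (im_idem bs).
have x1E : y ** (k' * e j) = u ** (k' * e j) + x ** 1.
  rewrite yE ractDl -xe -!ractM; congr (_ + _ ** _).
  by rewrite mulr1 !mulrA kk' (ee bs).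
have [_ _ UZ'] := (coll_wf cU').1 None; have [_ _ UZ] := (coll_wf cU).1 None.
exists (y ** (k' * e j)); first exact: UZ'.
apply: (collapse_scale cU) x1E _ _ _; last 1 first.
- by rewrite mulr1; apply: (idem_neq0 bs).
- by apply: (coll_sub cU'); apply: UZ'.
- by rewrite -ractM -mulrA (ee bs).
- exact: UZ.
- exact: (im1 bs).
Qed.

Definition tree_cap U U' : tree L N := fun mu y => U mu y /\ U' mu y.

Lemma collapse_cap V nu' j' x' U U' : wf V -> wf U ->
  (forall mu y, U mu y -> V mu y) ->
  collapse V nu' j' x' U' -> U None x' -> collapse U nu' j' x' (tree_cap U U').
Proof.
move=> wV wU sub cU' Ux'; have [sU UN] := wU.
case: (cU') => -[sU' UN'] xe xV sub' nuU dec dir.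
split=> //.
- split=> [mu|l y [Uy Uy']]; last by split; [exact: UN | exact: UN'].
  have [u0 uD uZ] := sU mu; have [u0' uD' uZ'] := sU' mu.
  split=> // [y z [? ?] [? ?]|y r ir [? ?]]; split; by
    [exact: uD | exact: uD' | exact: uZ | exact: uZ'].
- by move=> mu y [].
- by move=> y Uy; split=> //; apply: nuU; apply: sub.
- move=> mu h y Uy; have [u [r [Uu ir yE]]] := dec mu h y (sub _ _ Uy).
  exists u, r; split=> //; split=> //.
  have -> : u = y - x' ** r by rewrite yE addrK.
  apply: (submod_imB bs (sU mu)) => //; have [_ _ uZ] := sU mu.
  by apply: uZ => //; apply: wf_None wU _.
- by move=> mu h r ir [_]; apply: dir.
Qed.

(** Local confluence. Compare the given collapse of V with the first step of the
    derivation. If the two common parts differ, both trees collapse to their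
    intersection. If they agree, so do the pivots up to the choice of a
    representative; for equal labels the trees differ by transvections, and for
    different labels the pivot is moved to the other component first. *)
Lemma collapsible_collapse n V b : collapsible n V b -> forall nu j x U', collapse V nu j x U' ->
  exists m b', [/\ n = m.+1, collapsible m U' b' & bequiv b b'].
Proof.
elim: n V b => [|n IH] V b fV nu' j' x' U' cU'.
  have Vx := coll_x cU'; move/(collapsible0_span fV)/lin_genl_None: Vx => x0.
  by case: (collapse_nonzero cU'); rewrite x0; have [] := (coll_wf cU').1 None.
have [nu [j [x [U [wV cU fU]]]]] := collapsibleS_inv fV.
exists n; suff: exists b', collapsible n U' b' /\ bequiv b b'.
  by move=> [b' [fb' E]]; exists b'.
have [UU'|nUU'] := EM (forall y, U' None y -> U None y); last first.
  have nU'U : ~ forall y, U None y -> U' None y.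
    by move=> h; apply: nUU' => y; apply: collapse_incomparable h _; eassumption.
  have [x1 U'x1 c1] := collapse_pivot wV cU cU' nUU'.
  have [x2 Ux2 c2] := collapse_pivot wV cU' cU nU'U.
  have c3 := collapse_cap wV (coll_wf cU) (coll_sub cU) c2 Ux2.
  have c4 := collapse_cap wV (coll_wf cU') (coll_sub cU') c1 U'x1.
  have [m [b' [nE fb' E]]] := IH _ _ fU _ _ _ _ c3.
  exists b'; split=> //; rewrite nE.
  apply: (collapsibleS (nu := nu) (j := j) (x := x1)) fb'; first exact: coll_wf cU'.
  have -> // : tree_cap U U' = tree_cap U' U.
  apply/funext => mu; apply/funext => y; apply/propext.
  by split=> [] [].
have U'U := collapse_incomparable wV cU cU' UU'.
have eqU y : U None y <-> U' None y by split; [exact: U'U | exact: UU'].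
have nN l : None <> Some l by [].
(* Both collapses may use the same pivot. *)
have jj' : j = j' /\ collapse V nu' j x U'.
  have [u [k [Uu ik xE]]] := coll_dec cU' (nN _) (coll_x cU).
  have xe := coll_e cU; have xe' := coll_e cU'.
  have nU'x : ~ U' None x by move/UU'; apply: collapse_nonzero cU.
  have k0 : e j' * k != 0.
    apply/eqP => k0; apply: nU'x.
    by rewrite xE -xe' -ractM k0 ractr0 addr0.
  have jj' : j = j'.
    apply/eqP; apply/negP => /negP njj'; apply: nU'x.
    rewrite -xe xE ractDl -ractM -xe' -ractM mulrA (idem_comm bs _ ik) -mulrA.
    rewrite (idem_mul bs) eq_sym (negbTE njj') mulr0 ractr0 addr0.
    by have [_ _ uZ] := (coll_wf cU').1 None; apply: uZ => //; apply: (im_idem bs).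
  split=> //; rewrite jj' in xe *.
  by apply: (collapse_scale cU') xE _ _ _ => //; apply: (coll_x cU).
have {jj' cU'} [_ cU'] := jj'.
have [nn'|nn'] := EM (nu = nu').
  by rewrite -nn' in cU'; apply: (collapse_same_label bs wV cU cU').
(* Move the pivot from the component nu to the component nu'. *)
have [wU' xe xV sub' nuU' dec' dir'] := cU'.
have [wU _ _ sub nuU dec dir] := cU.
have nnS : Some nu <> Some nu' by case.
have spl : splitting e im nu (U (Some nu)) (U' (Some nu)) j x.
  split=> //.
  - exact: (wU'.1 (Some nu)).
  - by move=> y /sub'/nuU.
  - by split=> //; apply: nuU; apply: wf_None wV xV.
  - by move=> y /sub; apply: dec'.
  - by move=> r; apply: dir'.
have [|b1 [fb1 E1]] := collapsible_move bs canP fU nn' spl.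
  by move=> y /U'U; apply: wf_None.
have wM : wf (moved im U (U' (Some nu)) nu nu' x).
  apply: (moved_wf bs) => //; first exact: (wU'.1 (Some nu)).
  by move=> y /U'U; apply: wf_None.
have cM : collapse V nu' j x (moved im U (U' (Some nu)) nu nu' x).
  split=> //.
  - move=> mu y [[-> /sub' //]|[-> [u [r [Uu ir ->]]]]|[_ _ /sub //]].
    have [_ vD vZ] := wV.1 (Some nu'); apply: vD; first exact: sub.
    by apply: vZ => //; apply: wf_None wV xV.
  - move=> y; have nnS' : Some nu' <> Some nu by case=> /esym.
    move/(dec _ nnS') => [u [r [Uu ir ->]]].
    by apply/(moved_nu' _ _ _ _ nn'); exists u, r.
  - move=> mu h y; have [->|h1] := EM (mu = Some nu).
      move=> /(dec' _ nnS) [u [r [Uu ir ->]]]; exists u, r; split=> //.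
      by apply/(moved_nu _ _ _ _ nn').
    move=> /(dec _ h1) [u [r [Uu ir ->]]]; exists u, r; split=> //.
    exact/moved_other.
  - move=> mu h r ir; have [mE|h1] := EM (mu = Some nu).
      by rewrite mE in ir *; move/(moved_nu _ _ _ _ nn'); apply: dir'.
    by move/(moved_other im U (U' (Some nu)) x _ h1 h); apply: dir.
have [|b2 [fb2 E2]] := collapse_same_label bs wV cM cU' _ fb1.
  by move=> y; rewrite moved_None.
by exists b2; split=> //; apply: bequiv_trans E1 E2.
Qed.

(** Two bases of a direct sum that are adapted to its decomposition: replace the
    basis of one summand at a time. *)
Lemma collapsible0_equiv V b b' : collapsible 0 V b -> collapsible 0 V b' -> bequiv b b'.
Proof.
move=> fb fb'.
have fib := collapsible0_factor_basis fb'.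
pose labs (c : fam p L N) : seq L := [seq fl i | i <- enum (fI c)].
have labsP (c : fam p L N) (i : fI c) : listed (fl i) (labs c).
  exact: listed_image.
suff H sl : exists c, [/\ collapsible 0 V c, bequiv b c,
    forall i : fI c, listed (fl i) sl -> exists k, fl k = fl i /\ b' k = c i,
    forall k, listed (fl k) sl -> exists i : fI c, fl i = fl k /\ c i = b' k
  & forall i : fI c, listed (fl i) sl \/ listed (fl i) (labs b)].
  have [c [fc E c1 c2 c3]] := H (labs b ++ labs b').
  apply: bequiv_trans E _; apply: bequiv_step; [exact: collapsible_basis fc | exact: collapsible_basis fb' |].
  apply: (step_span (mu := None)) => i.
    have [|i' [_ <-]] := c2 i; first by apply/listed_cat; right.
    by apply: lin_gen; [exact: (im1 bs) | exists i'].
  have [|k [_ <-]] := c1 i.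
    by apply/listed_cat; case: (c3 i) => [/listed_cat//|]; left.
  by apply: lin_gen; [exact: (im1 bs) | exists k].
elim: sl => [|l sl [c [fc E c1 c2 c3]]].
  exists b; split=> // [|i]; last by right.
  exact: bequiv_refl bs _ (collapsible_basis fb).
exists (repl c l (fun i : {i : fI b' | `[< fl i = l >]} => ft (sval i))
  (fun i => b' (sval i)) (fun=> l)); split.
- exact: repl_collapsible (fib l).
- exact: bequiv_trans E (repl_equiv bs _ fc (fib l)).
- move=> [[i ni]|[i il]] /=; last first.
    by exists i; split=> //; apply/asboolP.
  case=> [li|/c1 //]; by move/asboolP: ni => /(_ (esym li)).
- move=> k; have [kl _|kl] := EM (fl k = l).
    have kl' : `[< fl k = l >] by apply/asboolP.
    by exists (inr (exist _ k kl')).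
  case=> [/esym//|] /c2 [i [il ci]].
  have ni : ~~ `[< fl i = l >] by apply/asboolPn; rewrite il.
  by exists (inl (exist _ i ni)).
- move=> [[i ni]|[i il]] /=; last by left; left.
  by case: (c3 i) => h; [left; right | right].
Qed.

End Unique.

(** * Normal forms, and collapsing a tree onto a basis *)

(** A monomial whose last letter is la is one of the free generators over the
    subring with label mu exactly if that letter has another label; over the base
    all monomials are. *)
Definition off (L : Type) (mu la : option L) : Prop := mu = None \/ la <> mu.

(** For each mu the values of the monomials that are off mu freely generate R as
    a right module over im mu, with coordinates mcoef mu. A monomial with last
    letter labelled l is the product of a shorter one, off l, and an element
    of im (Some l). *)
Record normal_forms (R : pzRingType) (p : nat) (L : Type) (e : 'I_p -> R)
    (im : option L -> R -> Prop) := NormalForms {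
  mon : Type;
  msrc : mon -> 'I_p;
  mtgt : mon -> 'I_p;
  mlast : mon -> option L;
  mdeg : mon -> nat;
  mval : mon -> R;
  mone : 'I_p -> mon;
  mcoef : option L -> mon -> R -> R;
  mval_one : forall j, mval (mone j) = e j;
  msrc_one : forall j, msrc (mone j) = j;
  mdeg_one : forall j, mdeg (mone j) = 0%N;
  mlast_one : forall j, mlast (mone j) = None;
  mone_last : forall u, mlast u = None -> u = mone (msrc u);
  mval_src : forall u, e (msrc u) * mval u = mval u;
  mval_tgt : forall u, mval u * e (mtgt u) = mval u;
  mon_last : forall u l, mlast u = Some l -> exists u' t,
    [/\ msrc u' = msrc u, mlast u' <> Some l, im (Some l) t,
        mval u = mval u' * t & mdeg u = (mdeg u').+1];
  mcoefD : forall mu u r s, off mu (mlast u) ->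
    mcoef mu u (r + s) = mcoef mu u r + mcoef mu u s;
  mcoefM : forall mu u r s, off mu (mlast u) -> im mu s ->
    mcoef mu u (r * s) = mcoef mu u r * s;
  mcoef_im : forall mu u r, off mu (mlast u) -> im mu (mcoef mu u r);
  mcoef_e : forall mu u r, off mu (mlast u) ->
    e (mtgt u) * mcoef mu u r = mcoef mu u r;
  mcoef_val : forall mu u, off mu (mlast u) -> mcoef mu u (mval u) = e (mtgt u);
  mcoef_val0 : forall mu u u', off mu (mlast u) -> off mu (mlast u') -> u' <> u ->
    mcoef mu u (mval u') = 0;
  mon_span : forall P : R -> Prop, P 0 ->
    (forall r s, P r -> P s -> P (r + s)) ->
    (forall u k, im None k -> P (mval u * k)) -> forall r, P r
}.

Definition good (R : pzRingType) (p : nat) (L : Type) (e : 'I_p -> R)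
    (im : option L -> R -> Prop) (nf : normal_forms e im) mu (u : mon nf) : Prop :=
  off mu (mlast u).

Section Shrink.
Variables (R : pzRingType) (p : nat) (L : Type) (e : 'I_p -> R).
Variables (im : option L -> R -> Prop) (N : lmodType R^c).
Hypothesis bs : based_subrings e im.
Hypothesis canP : cancellation e im N.
Implicit Types (y z : N) (r s : R) (mu : option L) (l nu : L).
Implicit Types (U V : tree L N) (b : fam p L N).

Notation wf := (wf im).
Notation collapse := (collapse e im).
Notation is_basis := (is_basis e).
Notation collapsible := (collapsible e im).
Notation bequiv := (bequiv e im).

(** Collapsing is confluent, so the basis is unique up to the moves. *)
Lemma collapsible_equiv n n' V b b' : collapsible n V b -> collapsible n' V b' -> bequiv b b'.
Proof.
elim: n' n V b b' => [|n' IH] n V b b' fb fb'.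
  case: n fb => [|n] fb; first exact: (collapsible0_equiv bs fb fb').
  have [nu [j [x [U [wV cU fU]]]]] := collapsibleS_inv fb.
  have := coll_x cU; move/(collapsible0_span fb')/lin_genl_None => x0.
  by case: (collapse_nonzero bs cU); rewrite x0; have [] := (coll_wf cU).1 None.
have [nu [j [x [U [wV cU fU]]]]] := collapsibleS_inv fb'.
have [m [b1 [_ fb1 E]]] := collapsible_collapse bs canP fb cU.
exact: bequiv_trans E (IH _ _ _ _ fb1 fU).
Qed.

Definition span_tree b : tree L N := fun mu => lin (im mu) (gen b).

Lemma lin_base mu (G : N -> Prop) x : lin (im None) G x -> lin (im mu) G x.
Proof.
elim=> [|u v _ IHu _ IHv|u r Gu ir]; first exact: lin0; first exact: linD.
by apply: linZ => //; apply: (im_base bs).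
Qed.

(** Split off the basis vectors one after the other, all into one component. *)
Lemma collapsible_span_tree nu b : is_basis b -> (forall i : fI b, fl i = nu) ->
  collapsible #|fI b| (span_tree b) b.
Proof.
move=> bb lb; have [b1 b2 b3] := bb.
pose G (A : {set fI b}) mu z :=
  exists i, (i \in A \/ mu = Some nu) /\ z = b i.
have H (A : {set fI b}) : collapsible #|A| (fun mu => lin (im mu) (G A mu)) b.
  elim: {A}_.+1 {-2}A (ltnSn #|A|) => // n IH A; rewrite ltnS => An.
  have wfG (B : {set fI b}) : wf (fun mu => lin (im mu) (G B mu)).
    split=> [mu|l x]; first exact: lin_im_submod bs _ _.
    move/(lin_base (Some l)); apply: linS => _ [i [[iB|//] ->]].
    by exists i; split=> //; left.
  have [A0|[i0 iA]] := set_0Vmem A.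
    rewrite A0 cards0; apply: collapsible0 => // mu x.
    split; apply: linS => _ [i [iP ->]].
      by case: iP => [|->]; [rewrite inE | exists i; rewrite lb].
    by exists i; split=> //; right; rewrite -iP lb.
  rewrite (cardsD1 i0) iA add1n.
  apply: (collapsibleS (nu := nu) (j := ft i0) (x := b i0)); first exact: wfG.
    2: by apply: IH; move: An; rewrite (cardsD1 i0) iA.
  split=> //.
  - by apply: lin_gen; [exact: (im1 bs) | exists i0; split=> //; left].
  - move=> mu y; apply: linS => _ [i [iP ->]]; exists i; split=> //.
    by case: iP => [|]; [rewrite inE => /andP[]; left | right].
  - by move=> y; apply: linS => _ [i [_ ->]]; exists i; split=> //; right.
  - move=> mu h y; apply: (lin_min (submod_add_line bs (b i0)
      (lin_im_submod bs mu (G (A :\ i0) mu)))).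
    move=> _ [i [[Ai|//] ->]]; have [->|ni] := eqVneq i i0.
      exists 0, 1; rewrite add0r ract1; split=> //; first exact: lin0.
      exact: (im1 bs).
    exists (b i), 0; rewrite ractr0 addr0; split=> //; last exact: im0 bs _.
    apply: lin_gen; first exact: (im1 bs).
    by exists i; rewrite !inE ni; split=> //; left.
  - move=> mu h r ir; have [D [lD Db]] := b3 i0 => Hr.
    have : D (b i0 ** r) = 0.
      elim: Hr => [|u v _ IHu _ IHv|u s [i [[iA'|//] ->]] is_].
      - exact: rlin0.
      - by rewrite lD.1 IHu IHv addr0.
      - move: iA'; rewrite !inE => /andP[ni _].
        by rewrite lD.2 Db (negbTE ni) mul0r.
    by rewrite lD.2 Db eqxx.
rewrite -cardsT; apply: (collapsible_iff (H setT)) => mu x.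
split; apply: linS => z [i]; first by case=> _ ->; exists i.
by move=> ->; exists i; split=> //; left.
Qed.

(** Start from any finite list of vectors that is enough to express y, and drop
    those on which the coordinate of y vanishes one at a time. *)
Lemma lin_support mu (X : Type) (g : X -> N) (j : X -> 'I_p)
    (c : X -> N -> R) (P : X -> Prop) :
  (forall a, P a -> g a ** e (j a) = g a) ->
  (forall a, P a -> [/\ forall y z, c a (y + z) = c a y + c a z,
      forall y r, im mu r -> c a (y ** r) = c a y * r & c a (g a) = e (j a)]) ->
  (forall a a', P a -> P a' -> a' <> a -> c a (g a') = 0) ->
  forall y, lin (im mu) (fun z => exists2 a, P a & z = g a) y ->
  lin (im mu) (fun z => exists a, [/\ P a, c a y <> 0 & z = g a]) y.
Proof.
move=> ge cP c0 y ly.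
pose Q (sl : seq X) z := exists a, [/\ P a, listed a sl \/ c a y <> 0 & z = g a].
have [sl lsl] : exists sl, lin (im mu) (Q sl) y.
  have : exists sl, lin (im mu) (fun z => exists a, [/\ P a, listed a sl & z = g a]) y.
    elim: ly => [|u v _ [s1 h1] _ [s2 h2]|_ r [a Px ->] ir].
    - by exists [::]; apply: lin0.
    - exists (s1 ++ s2); apply: linD.
        by apply: linS h1 => _ [a [Px xs ->]]; exists a; split=> //; apply/listed_cat; left.
      by apply: linS h2 => _ [a [Px xs ->]]; exists a; split=> //; apply/listed_cat; right.
    - exists [:: a]; apply: linZ => //; exists a; split=> //; exact: or_introl.
  move=> [sl h]; exists sl; apply: linS h => _ [a [Px xs ->]].
  by exists a; split=> //; left.
elim: sl lsl => [|a sl IH] lsl.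
  by apply: linS lsl => _ [a [Px [//|xs] ->]]; exists a.
apply: IH; have [xQ|xQ] := EM (P a /\ ~ (listed a sl \/ c a y <> 0)); last first.
  apply: linS lsl => _ [a' [Px' [[aa'|xs]|xs] ->]]; exists a'; split=> //.
  - by apply: contrapT => h; apply: xQ; rewrite aa'.
  - by left.
  - by right.
case: xQ => Px /not_orP [nx /contrapT cxy].
have : exists u r, [/\ lin (im mu) (Q sl) u, im mu r & y = u + g a ** r].
  apply: (lin_min (submod_add_line bs (g a) (lin_im_submod bs mu (Q sl)))) lsl.
  move=> _ [a' [Px' h ->]]; have [<-|ne] := EM (a = a').
    exists 0, 1; rewrite add0r ract1; split=> //; first exact: lin0.
    exact: (im1 bs).
  exists (g a'), 0; rewrite ractr0 addr0; split=> //; last exact: im0 bs _.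
  apply: lin_gen; first exact: (im1 bs).
  by exists a'; split=> //; case: h => [[]|]; [|left|right].
case=> u [r [lu ir yE]]; have [cD cM cg] := cP a Px.
have cu : c a u = 0.
  have cx0 : c a 0 = 0 by rewrite -(ractr0 0) cM ?mulr0 //; apply: im0 bs _.
  elim: lu => [//|v w _ IHv _ IHw|_ s [a' [Px' h ->]] is_].
    by rewrite cD IHv IHw addr0.
  rewrite cM // c0 ?mul0r // => aa'; move: h; rewrite aa'.
  by case.
have er : e (j a) * r = 0.
  by move: cxy; rewrite yE cD cu add0r cM // cg.
by rewrite yE -ge // -ractM er ractr0 addr0.
Qed.

Variable nf : normal_forms e im.
Notation mon := (mon nf).
Notation good := (@good _ _ _ _ _ nf).
Implicit Types u v : mon.

Section Basis.
Variable b : fam p L N.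
Hypothesis bb : is_basis b.

Lemma basis_dual : exists D : fI b -> N -> R, (forall i, rlin (D i)) /\
  forall i k, D i (b k) = if k == i then e (ft i) else 0.
Proof.
have [_ _ /choice [D PD]] := bb.
by exists D; split=> i; case: (PD i).
Qed.

Definition bmon (x : fI b * mon) : N := b x.1 ** mval x.2.
Definition bmon_ok (x : fI b * mon) : Prop := msrc x.2 = ft x.1.

Lemma bmon_e x : bmon x ** e (mtgt x.2) = bmon x.
Proof. by rewrite /bmon -ractM mval_tgt. Qed.

Section Coef.
Variable D : fI b -> N -> R.
Hypothesis lD : forall i, rlin (D i).
Hypothesis Db : forall i k, D i (b k) = if k == i then e (ft i) else 0.

Definition bcoef mu (x : fI b * mon) (y : N) : R := mcoef mu x.2 (D x.1 y).

Lemma bcoefD mu x y z : good mu x.2 ->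
  bcoef mu x (y + z) = bcoef mu x y + bcoef mu x z.
Proof. by move=> g; rewrite /bcoef (lD _).1 mcoefD. Qed.

Lemma bcoefM mu x y r : good mu x.2 -> im mu r ->
  bcoef mu x (y ** r) = bcoef mu x y * r.
Proof. by move=> g ir; rewrite /bcoef (lD _).2 mcoefM. Qed.

Lemma bcoef0 mu x : good mu x.2 -> bcoef mu x 0 = 0.
Proof. by move=> g; rewrite -(ractr0 0) bcoefM ?mulr0 //; apply: im0 bs _. Qed.

Lemma bcoef_bmon mu x x' : bmon_ok x -> bmon_ok x' ->
  good mu x.2 -> good mu x'.2 ->
  (x' = x -> bcoef mu x (bmon x') = e (mtgt x.2)) /\
  (x' <> x -> bcoef mu x (bmon x') = 0).
Proof.
case: x x' => [i u] [i' u'] /= ok ok' g g'; rewrite /bmon_ok /= in ok ok'.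
rewrite /bcoef /bmon /= (lD _).2 Db; split=> [[-> ->]|ne].
  by rewrite eqxx -ok mval_src mcoef_val.
case: eqP => [ii'|_]; last first.
  by rewrite mul0r -[X in mcoef _ _ X](mulr0 0) mcoefM ?mulr0 //; apply: im0 bs _.
rewrite -ii' -ok' mval_src mcoef_val0 // => uu'; apply: ne.
by rewrite ii' uu'.
Qed.

(** A coefficient over one factor collects, besides the monomial itself, the
    monomials obtained by appending a letter of that factor; these are longer. *)
Lemma bcoef_base mu x x' : bmon_ok x -> bmon_ok x' -> good mu x.2 ->
  (mdeg x'.2 <= mdeg x.2)%N -> bcoef mu x (bmon x') = bcoef None x (bmon x').
Proof.
move=> ok ok' g le; have gN u : good None u by left.
have [g'|ng'] := EM (good mu x'.2).
  have [E0 E1] := bcoef_bmon ok ok' g g'.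
  have [F0 F1] := bcoef_bmon ok ok' (gN _) (gN _).
  by have [h|h] := EM (x' = x); [rewrite E0 // F0 | rewrite E1 // F1].
have [_ F1] := bcoef_bmon ok ok' (gN _) (gN _).
have ne : x' <> x by move=> h; apply: ng'; rewrite h.
rewrite F1 //; case: mu => [l|] in g ng' *; last by case: ng'; left.
have /contrapT h : ~ mlast x'.2 <> Some l by move=> h; apply: ng'; right.
have [u' [t [src' l' it vE dE]]] := mon_last h.
have -> : bmon x' = bmon (x'.1, u') ** t by rewrite /bmon vE ractM.
rewrite bcoefM //; have [||_ ->] := @bcoef_bmon (Some l) x (x'.1, u') ok _ g _.
- by rewrite /bmon_ok /= src'.
- by right.
- by rewrite mul0r.
- by move=> xE; move: le; rewrite dE -xE ltnn.
Qed.

End Coef.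

Definition deg_le m : N -> Prop := lin (im None)
  (fun z => exists2 x, bmon_ok x /\ (mdeg x.2 <= m)%N & z = bmon x).

Lemma deg_le_mono m m' y : (m <= m')%N -> deg_le m y -> deg_le m' y.
Proof.
move=> mm'; apply: linS => _ [x [ok le] ->]; exists x => //.
by split=> //; apply: leq_trans mm'.
Qed.

Lemma bmon_span y : lin (im None) (fun z => exists2 x, bmon_ok x & z = bmon x) y.
Proof.
have [b1 b2 _] := bb; set G := fun z => _.
have sG := lin_im_submod bs None G; have [_ GD _] := sG.
elim: (b2 y) => [|u v _ IHu _ IHv|_ r [i ->] _]; [exact: lin0 | exact: GD |].
move: r; apply: (@mon_span _ _ _ _ _ nf (fun r => lin (im None) G (b i ** r)))
  => [|r s h1 h2|u k ik].
- by rewrite ractr0; apply: lin0.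
- by rewrite ractDr; apply: GD.
rewrite ractM; have [ok|nok] := eqVneq (ft i) (msrc u).
  by apply: linZ => //; exists (i, u).
rewrite -[mval u]mval_src -[b i]b1 -!ractM -!mulrA mulrA (idem_mul bs).
by rewrite (negbTE nok) mul0r ractr0; apply: lin0.
Qed.

Lemma deg_le_ex y : exists m, deg_le m y.
Proof.
elim: (bmon_span y) => [|u v _ [m hm] _ [m' hm']|_ r [x ok ->] ir].
- by exists 0%N; apply: lin0.
- exists (maxn m m'); apply: linD.
    by apply: deg_le_mono hm; apply: leq_maxl.
  by apply: deg_le_mono hm'; apply: leq_maxr.
- by exists (mdeg x.2); apply: linZ => //; exists x.
Qed.

Lemma collapsible_deg_le n V c : collapsible n V c -> exists m, forall y, V None y -> deg_le m y.
Proof.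
elim: n V => [|n IH] V fV.
  exists 0%N => y /(collapsible0_span fV)/lin_genl_None->; exact: lin0.
have [nu [j [x [U [wV cU fU]]]]] := collapsibleS_inv fV.
have [m hm] := IH _ fU; have [m' hm'] := deg_le_ex x.
exists (maxn m m') => y Vy.
have [//|u [r [Uu ir ->]]] := coll_dec cU (mu := None) _ Vy.
apply: linD; first by apply: deg_le_mono (hm _ Uu); apply: leq_maxl.
have [_ _ dZ] := lin_im_submod bs None
   (fun z => exists2 x, bmon_ok x /\ (mdeg x.2 <= maxn m m')%N & z = bmon x).
by apply: dZ => //; apply: deg_le_mono hm'; apply: leq_maxr.
Qed.

Lemma mdeg0_one u : mdeg u = 0%N -> u = mone nf (msrc u).
Proof.
move=> d0; apply: mone_last; case h: (mlast u) => [l|//].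
by have [u' [t [_ _ _ _]]] := mon_last h; rewrite d0.
Qed.

Lemma bmon_one x : bmon_ok x -> mdeg x.2 = 0%N -> bmon x = b x.1.
Proof.
move=> ok /mdeg0_one uE; have [b1 _ _] := bb.
by rewrite /bmon uE mval_one ok b1.
Qed.

(** A last letter with label l is absorbed in the coefficient. *)
Lemma off_span l y : lin (im (Some l))
  (fun z => exists2 x, bmon_ok x /\ good (Some l) x.2 & z = bmon x) y.
Proof.
set G := fun z => _; have [_ GD GZ] := lin_im_submod bs (Some l) G.
elim: (bmon_span y) => [|u v _ IHu _ IHv|_ r [x ok ->] ir]; first exact: lin0.
  exact: GD.
apply: GZ; first exact: (im_base bs).
have [h|h] := EM (mlast x.2 = Some l); last first.
  by apply: lin_gen; [exact: (im1 bs) | exists x => //; split=> //; right].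
have [u' [t [src' l' it vE dE]]] := mon_last h.
have -> : bmon x = bmon (x.1, u') ** t by rewrite /bmon vE ractM.
apply: linZ => //; exists (x.1, u') => //; split; last by right.
by rewrite /bmon_ok /= src'.
Qed.

End Basis.

(** Once the common part is the span of a basis over the base, so is every other
    component over its ring: a coefficient at a monomial of positive degree
    vanishes on the common part, so its restriction to one component extends to a
    functional on N, which is zero as it vanishes on a basis. *)
Lemma collapsible_flat nu0 n V b b' : is_basis b' -> (forall i : fI b', fl i = nu0) ->
  collapsible n V b -> (forall i, V None (b' i)) ->
  (forall y, V None y -> deg_le b' 0 y) -> bequiv b b'.
Proof.
move=> bb' lb' fV Vb' V0; have [D [lD Db]] := basis_dual bb'.
have wV := collapsible_wf bs fV; have sV := wV.1.
have VNE z : V None z <-> lin (im None) (gen b') z.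
  split=> [/V0|]; last by apply: lin_min => // _ [i ->].
  apply: linS => y [x [ok]]; rewrite leqn0 => /eqP d0 ->.
  by exists x.1; rewrite bmon_one.
apply: (collapsible_equiv fV (collapsible_iff (collapsible_span_tree bb' lb') _)) => -[l|] y; last first.
  by rewrite VNE.
split=> [|Vy].
  by apply: lin_min => // _ [i ->]; apply: wf_None wV _.
have gdP (x : fI b' * mon) : bmon_ok x /\ good (Some l) x.2 ->
    [/\ forall y z, bcoef D (Some l) x (y + z) =
          bcoef D (Some l) x y + bcoef D (Some l) x z,
      forall y r, im (Some l) r ->
        bcoef D (Some l) x (y ** r) = bcoef D (Some l) x y * r
    & bcoef D (Some l) x (bmon x) = e (mtgt x.2)].
  move=> [ok g]; split=> [u v|u r ir|]; [exact: bcoefD | exact: bcoefM |].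
  by have [-> //] := bcoef_bmon lD Db ok ok g g.
have := lin_support (fun x _ => bmon_e x) gdP _ (off_span bb' l y).
have c0 x x' : bmon_ok x /\ good (Some l) x.2 ->
    bmon_ok x' /\ good (Some l) x'.2 -> x' <> x -> bcoef D (Some l) x (bmon x') = 0.
  by move=> [ok g] [ok' g'] ne; have [_ ->] := bcoef_bmon lD Db ok ok' g g'.
move=> /(_ c0); apply: linS => _ [x [[ok g] cx ->]].
exists x.1; have [/eqP dx|dx] := boolP (mdeg x.2 == 0%N); first by rewrite bmon_one.
case: cx; have [cD cM _] := gdP x (conj ok g).
have [||z|E [lE El E0]] := collapsible_ext_one bs (l := l) (d := bcoef D (Some l) x) fV.
- by move=> *; apply: cD.
- by move=> *; apply: cM.
- move/VNE; elim=> [|u v _ IHu _ IHv|_ r [i ->] ir].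
  + exact: bcoef0.
  + by rewrite cD IHu IHv addr0.
  + rewrite cM; last exact: (im_base bs).
    have ok1 : bmon_ok (i, mone nf (ft i)) by rewrite /bmon_ok /= msrc_one.
    rewrite -(@bmon_one _ bb' (i, mone nf (ft i))) ?mdeg_one // c0 ?mul0r //.
      by split=> //; right; rewrite mlast_one.
    by move=> xE; move: dx; rewrite -xE mdeg_one.
rewrite -El //.
have [_ b2 _] := bb'.
apply: (@eq_rlin _ _ (gen b') _ (fun=> 0)) => //.
  by split=> *; rewrite ?addr0 ?mul0r.
move=> _ [i ->]; have lN : None <> Some l by [].
exact: E0 lN (Vb' i).
Qed.

(** Take a monomial x of maximal degree in the common part, and let nu be the
    label of its last letter. By maximality, the coefficients at x over the base
    and over the factors other than nu agree on the common part, so they define a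
    collapse. Its common part still contains the basis, on which coefficients at
    monomials of positive degree vanish. *)
Lemma collapsible_shrink nu0 n V b b' : is_basis b' -> (forall i : fI b', fl i = nu0) ->
  collapsible n V b -> (forall i, V None (b' i)) -> bequiv b b'.
Proof.
move=> bb' lb'; elim: n V b => [|n IH] V b fV Vb'.
  apply: (collapsible_flat bb' lb' fV Vb') => y /(collapsible0_span fV)/lin_genl_None->; exact: lin0.
have [V0|nV0] := EM (forall y, V None y -> deg_le b' 0 y).
  exact: (collapsible_flat bb' lb' fV Vb' V0).
have [D [lD Db]] := basis_dual bb'; have [b1 _ _] := bb'.
have wV := collapsible_wf bs fV; have sV := wV.1.
have gN u : good None u by left.
have [m [Vm nVm]] : exists m, (forall y, V None y -> deg_le b' m.+1 y) /\ ~ (forall y, V None y -> deg_le b' m y).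
  have [m] := collapsible_deg_le bb' fV; elim: m => [//|m IHm] Vm.
  by have [/IHm|nVm] := EM (forall y, V None y -> deg_le b' m y); last exists m.
pose P (x : fI b' * mon) := bmon_ok x /\ (mdeg x.2 <= m.+1)%N.
have [x [y [[ok dx] Vy cxy]]] : exists x y,
    [/\ bmon_ok x /\ mdeg x.2 = m.+1, V None y & bcoef D None x y <> 0].
  apply: contrapT => nex; apply: nVm => y Vy.
  have PC x : P x -> [/\ forall y z, bcoef D None x (y + z) =
        bcoef D None x y + bcoef D None x z,
      forall y r, im None r -> bcoef D None x (y ** r) = bcoef D None x y * r
    & bcoef D None x (bmon x) = e (mtgt x.2)].
    move=> [ok _]; split=> [u v|u r ir|]; [exact: bcoefD | exact: bcoefM |].
    by have [-> //] := bcoef_bmon lD Db ok ok (gN _) (gN _).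
  have P0 x x' : P x -> P x' -> x' <> x -> bcoef D None x (bmon x') = 0.
    move=> [ok _] [ok' _] ne.
    by have [_ ->] := bcoef_bmon lD Db ok ok' (gN _) (gN _).
  have := lin_support (fun x _ => bmon_e x) PC P0 (Vm y Vy).
  apply: linS => z [x [[ok dx] cx ->]]; exists x => //.
  split=> //; rewrite -ltnS ltn_neqAle dx andbT; apply/eqP => dE.
  by apply: nex; exists x, y.
have [nu lx] : exists nu, mlast x.2 = Some nu.
  case h: (mlast x.2) => [nu|]; first by exists nu.
  by move: dx; rewrite (mone_last h) mdeg_one.
have gx mu : mu <> Some nu -> good mu x.2 by rewrite /good /off lx; right=> /esym.
have ne j i : (i, mone nf j) <> x.
  by move=> xE; move: dx; rewrite -xE mdeg_one.
set c := bcoef D; set j := mtgt x.2.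
have ce mu z : mu <> Some nu -> e j * c mu x z = c mu x z.
  by move=> h; apply: mcoef_e; apply: gx.
have cV mu z : mu <> Some nu -> V None z -> c mu x z = c None x z.
  move=> h Vz; elim: (Vm z Vz) => [|u v _ IHu _ IHv|_ r [x' [ok' le] ->] ir].
  - by rewrite /c !bcoef0 //; do ?[exact: gx | exact: gN].
  - rewrite /c !bcoefD //; do ?[exact: gx | exact: gN].
    by rewrite -/c IHu IHv.
  - have ir' : im mu r by apply: (im_base bs).
    rewrite /c [LHS]bcoefM ?[RHS]bcoefM //; do ?[exact: gx | exact: gN].
    by rewrite (bcoef_base lD Db) // ?dx //; apply: gx.
have ick : im None (c None x y) by apply: mcoef_im; apply: gN.
have [k' [ik' kk' _]] : exists k', [/\ im None k',
    e j * c None x y * k' = e j & k' * (e j * c None x y) = e j].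
  by apply: (base_inv bs) => //; rewrite ce //; apply/eqP.
have ike : im None (k' * e j) by apply: (imM bs) => //; apply: (im_idem bs).
set z := y ** (k' * e j).
have Vz : V None z by have [_ _ VZ] := sV None; apply: VZ.
have ze : z ** e j = z by rewrite /z -ractM -mulrA (ee bs).
have cz mu : mu <> Some nu -> c mu x z = e j.
  move=> h; rewrite cV // /z /c bcoefM // -/c -ce //.
  by rewrite mulrA kk' (ee bs).
pose U : tree L N := fun mu w => V mu w /\ (mu = Some nu \/ c mu x w = 0).
have cU : collapse V nu j z U.
  split=> //.
  - split=> [mu|l w].
      have [v0 vD vZ] := sV mu; split=> [|u v [Vu hu] [Vv hv]|u r ir [Vu hu]].
      + split=> //; have [->|h] := EM (mu = Some nu); [by left | right].
        by apply: bcoef0 => //; apply: gx.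
      + split; first exact: vD.
        have [->|h] := EM (mu = Some nu); [by left | right].
        case: hu => [/h//|hu]; case: hv => [/h//|hv].
        by rewrite /c bcoefD //; [rewrite -/c hu hv addr0 | apply: gx].
      + split; first exact: vZ.
        have [->|h] := EM (mu = Some nu); [by left | right].
        case: hu => [/h//|hu].
        by rewrite /c bcoefM //; [rewrite -/c hu mul0r | apply: gx].
    move=> [Vw [//|cw]]; split; first exact: wf_None wV Vw.
    by have [->|h] := EM (Some l = Some nu); [left | right; rewrite cV].
  - by move=> mu w [].
  - by move=> w Vw; split=> //; left.
  - move=> mu h w Vw; exists (w - z ** c mu x w), (c mu x w).
    have icw : im mu (c mu x w) by apply: mcoef_im; apply: gx.
    have Vzw : V mu (z ** c mu x w).
      by have [_ _ VZ] := sV mu; apply: VZ => //; apply: wf_None wV Vz.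
    rewrite subrK; split=> //; split.
      by apply: (submod_imB bs (sV mu)).
    right; rewrite -ractNr /c bcoefD //; last exact: gx.
    rewrite bcoefM //; [|exact: gx|exact: imN bs _ _ _].
    by rewrite -/c cz // mulrN ce // subrr.
  - move=> mu h r ir [_ [//|]].
    by rewrite /c bcoefM //; [rewrite -/c cz | apply: gx].
have [n' [b2 [[<-] fU E]]] := collapsible_collapse bs canP fV cU.
apply: (bequiv_trans E); apply: (IH _ _ fU) => i; split=> //; right.
have ok1 : bmon_ok (i, mone nf (ft i)) by rewrite /bmon_ok /= msrc_one.
rewrite -(@bmon_one _ bb' (i, mone nf (ft i))) ?mdeg_one // /c.
by have [_ ->] := bcoef_bmon lD Db ok ok1 (gN _) (gN _).
Qed.

End Shrink.

(** * Growing a tree that contains given elements *)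

Section Grow.
Variables (R : pzRingType) (p : nat) (L : Type) (e : 'I_p -> R).
Variables (im : option L -> R -> Prop) (N : lmodType R^c).
Hypothesis bs : based_subrings e im.
Hypothesis canP : cancellation e im N.
Variable nf : normal_forms e im.
Variables (b : fam p L N) (nu0 : L).
Hypothesis bb : is_basis e b.
Hypothesis lb : forall i : fI b, fl i = nu0.
Implicit Types (r s : R) (mu : option L) (l nu : L).

Notation collapsible := (collapsible e im).
Notation mon := (mon nf).
Notation bmon := (@bmon _ _ _ _ _ _ nf b).
Notation bmon_ok := (@bmon_ok _ _ _ _ _ _ nf b).
Implicit Types (x : fI b * mon) (S : fI b * mon -> Prop).

(** Trees spanned by sets of monomials in a basis. The parts with a common part
    closed under taking prefixes are collapsed by removing a longest monomial. *)
Definition mtree S : tree L N :=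
  fun mu => lin (im mu) (fun z => exists2 x, S x & z = bmon x).

Definition pclosed S : Prop := forall x, S x -> bmon_ok x /\
  forall l, mlast x.2 = Some l -> exists u' t, [/\ S (x.1, u'),
    mlast u' <> Some l, im (Some l) t & mval x.2 = mval u' * t].

Definition reached S : Prop :=
  [/\ forall i, S (i, mone nf (ft i)), pclosed S & exists n, collapsible n (mtree S) b].

Lemma mtreeS S S' mu y : (forall x, S x -> S' x) -> mtree S mu y -> mtree S' mu y.
Proof.
by move=> SS'; apply: linS => z [x Sx ->]; exists x => //; apply: SS'.
Qed.

Lemma mtree_wf S : wf im (mtree S).
Proof.
split=> [mu|l y]; first exact: lin_im_submod bs _ _.
exact: (lin_base bs).
Qed.

Lemma reached_roots : reached (fun x => exists i, x = (i, mone nf (ft i))).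
Proof.
split=> [i|x [i ->]|]; first by exists i.
  split; first by rewrite /bmon_ok /= msrc_one.
  by move=> l /=; rewrite mlast_one.
exists #|fI b|; apply: (collapsible_iff (collapsible_span_tree bs bb lb)) => mu y.
have [b1 _ _] := bb.
split; apply: linS => z.
  case=> i ->; exists (i, mone nf (ft i)); first by exists i.
  by rewrite /bmon mval_one b1.
by case=> _ [i ->] ->; exists i; rewrite /bmon mval_one b1.
Qed.

(** The new monomial x is a free generator over every factor but that of its last
    letter, and over that factor it is a multiple of its prefix. So the larger
    tree collapses to the smaller one with pivot x. *)
Lemma reached_add S x nu u1 t : reached S -> bmon_ok x ->
  mlast x.2 = Some nu -> S (x.1, u1) -> mlast u1 <> Some nu ->
  im (Some nu) t -> mval x.2 = mval u1 * t ->
  reached (fun x' => S x' \/ x' = x).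
Proof.
move=> [S0 pS [n fS]] ok lx Su1 lu1 it vE.
have pS' : pclosed (fun x' => S x' \/ x' = x).
  move=> x' [/pS [ok' h]|->]; split=> // l.
    by move/h => [u' [t' [? ? ? ?]]]; exists u', t'; split=> //; left.
  by rewrite lx => -[<-]; exists u1, t; split=> //; left.
split=> //; first by move=> i; left.
have [Sx|nSx] := EM (S x).
  exists n; apply: (collapsible_iff fS) => mu y.
  by split; apply: mtreeS => x'; [left | case=> [|->]].
have [D [lD Db]] := basis_dual bb.
exists n.+1; apply: collapsibleS fS; first exact: mtree_wf.
instantiate (1 := bmon x); instantiate (1 := mtgt x.2); instantiate (1 := nu).
split.
- exact: mtree_wf.
- exact: bmon_e.
- by apply: lin_gen; [exact: (im1 bs) | exists x => //; right].
- by move=> mu y; apply: mtreeS => x'; left.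
- move=> y; apply: lin_min; first exact: lin_im_submod bs _ _.
  move=> z [x' [Sx'|->] ->].
    by apply: lin_gen; [exact: (im1 bs) | exists x'].
  have -> : bmon x = bmon (x.1, u1) ** t by rewrite /bmon vE ractM.
  by apply: linZ => //; exists (x.1, u1).
- move=> mu h y.
  apply: (lin_min (submod_add_line bs (bmon x) ((mtree_wf S).1 mu))).
  move=> z [x' [Sx'|->] ->].
    exists (bmon x'), 0; rewrite ractr0 addr0; split=> //; last exact: im0 bs _.
    by apply: lin_gen; [exact: (im1 bs) | exists x'].
  exists 0, 1; rewrite add0r ract1; split=> //; first exact: lin0.
  exact: (im1 bs).
- move=> mu h r ir Hr.
  have gx : good mu x.2 by right; rewrite lx => /esym.
  have c0 y : mtree S mu y -> bcoef D mu x y = 0.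
    elim=> [|y1 z1 _ IHy _ IHz|_ s [x' Sx' ->] is_].
    - exact: (bcoef0 bs lD).
    - by rewrite (bcoefD lD) // IHy IHz addr0.
    - rewrite (bcoefM lD) //.
      have xx' : x' <> x by move=> xE; apply: nSx; rewrite -xE.
      have [ok' h'] := pS _ Sx'.
      have [g'|ng'] := EM (good mu x'.2).
        have [_ ->] := bcoef_bmon bs lD Db ok ok' gx g'; rewrite ?mul0r //.
      case: mu => [l|] in h ir Hr gx ng' is_ *; last by case: ng'; left.
      have /contrapT/h' : ~ mlast x'.2 <> Some l by move=> k; apply: ng'; right.
      move=> [u' [t' [Su' lu' it' vE']]].
      have -> : bmon x' = bmon (x'.1, u') ** t' by rewrite /bmon vE' ractM.
      rewrite (bcoefM lD) //; have [oku _] := pS _ Su'.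
      have gu : good (Some l) u' by right.
      have [_ ->] := bcoef_bmon bs lD Db ok oku gx gu; first by rewrite !mul0r.
      by move=> xE; apply: nSx; rewrite -xE.
  have := c0 _ Hr; rewrite (bcoefM lD) //.
  by have [-> //] := bcoef_bmon bs lD Db ok ok gx gx.
Qed.

Lemma reached_mon i u S : reached S -> msrc u = ft i ->
  exists S', [/\ reached S', forall x, S x -> S' x & S' (i, u)].
Proof.
elim: {u}_.+1 {-2}u (ltnSn (mdeg u)) S => // m IH u le S rS src_u.
case lu: (mlast u) => [nu|]; last first.
  by exists S; split=> //; have [S0 _ _] := rS; rewrite (mone_last lu) src_u.
have [u' [t [src' lu' it vE dE]]] := mon_last lu.
have [||S' [rS' SS' S'u']] := IH u' _ _ rS.
- by rewrite -ltnS -dE.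
- by rewrite src'.
exists (fun x => S' x \/ x = (i, u)); split.
- exact: (reached_add (x := (i, u)) rS' src_u lu S'u' lu' it vE).
- by move=> x /SS'; left.
- by right.
Qed.

Lemma reached_elt y S : reached S ->
  exists S', [/\ reached S', forall x, S x -> S' x & mtree S' None y].
Proof.
elim: (bmon_span bs nf bb y) S => [|y1 y2 _ IH1 _ IH2|_ r [x ok ->] ir] S rS.
- by exists S; split=> //; apply: lin0.
- have [S1 [r1 s1 h1]] := IH1 S rS; have [S2 [r2 s2 h2]] := IH2 S1 r1.
  exists S2; split=> //; first by move=> x /s1/s2.
  by apply: linD => //; apply: mtreeS h1.
- case: x ok => i u ok; have [S' [r' s' h']] := reached_mon rS ok.
  by exists S'; split=> //; apply: linZ => //; exists (i, u).
Qed.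

Lemma collapsible_grow (J : finType) (c : J -> N) :
  exists n V, collapsible n V b /\ forall k, V None (c k).
Proof.
suff [S [[_ _ [n fS]] Sc]] : exists S, reached S /\
    forall k, k \in enum J -> mtree S None (c k).
  by exists n, (mtree S); split=> // k; apply: Sc; rewrite mem_enum.
elim: (enum J) => [|k sJ [S [rS IH]]].
  by exists (fun x => exists i, x = (i, mone nf (ft i))); split=> //; exact: reached_roots.
have [S' [rS' SS' S'c]] := reached_elt (c k) rS.
exists S'; split=> // k'; rewrite inE => /orP[/eqP->//|/IH].
exact: mtreeS.
Qed.

End Grow.

Section Transitive.
Variables (R : pzRingType) (p : nat) (L : Type) (e : 'I_p -> R).
Variables (im : option L -> R -> Prop) (N : lmodType R^c).
Hypothesis bs : based_subrings e im.
Hypothesis canP : cancellation e im N.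

(** A tree that collapses to b and contains b' in its common part also collapses
    to b'. *)
Lemma bases_equiv (nf : normal_forms e im) (nu0 : L) (b b' : fam p L N) :
  is_basis e b -> is_basis e b' -> (forall i : fI b, fl i = nu0) ->
  (forall i : fI b', fl i = nu0) -> bequiv e im b b'.
Proof.
move=> bb bb' lb lb'; have [n [V [fV Vb']]] := collapsible_grow bs nf bb lb (fb (f := b')).
exact: (collapsible_shrink bs canP nf bb' lb' fV Vb').
Qed.

End Transitive.

(** * Bases of algebras over a product of skew fields *)

Section Bases.
Variables (p : nat) (K : 'I_p -> unitRingType).
Hypothesis skewK : forall j, GRing.field_axiom (K j).
Local Notation R0 := (prod_ring K).
Local Notation eps := (prod_idem K).

Lemma prod_idem_sum : \sum_j eps j = 1 :> R0.
Proof.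
apply/ffunP=> i; rewrite (big_morph (fun x : R0 => x i) (id1 := 0) (op1 := +%R));
  [|by move=> x y; rewrite ffunE|by rewrite ffunE].
rewrite [RHS]ffunE (bigD1 i) //= big1 ?addr0 => [|j ji].
  by rewrite ffunE eqxx.
by rewrite ffunE eq_sym (negbTE ji).
Qed.

Lemma prod_idem_comm j (k : R0) : eps j * k = k * eps j.
Proof.
apply/ffunP=> i; rewrite !ffunE; case: eqP => _; rewrite ?mul1r ?mulr1 //.
by rewrite mul0r mulr0.
Qed.

Lemma prod_idem_inv j (k : R0) : eps j * k != 0 ->
  exists k', eps j * k * k' = eps j /\ k' * (eps j * k) = eps j.
Proof.
move=> nk; have kj : k j != 0.
  apply: contraNneq nk => kj; apply/eqP/ffunP=> i; rewrite !ffunE.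
  by case: eqP => [->|_]; rewrite ?kj ?mulr0 ?mul0r.
have uk := skewK kj; exists [ffun i => if i == j then (k i)^-1 else 0 : K i].
split; apply/ffunP=> i; rewrite !ffunE; case: eqP => [->|_];
  by rewrite ?mul0r ?mulr0 ?mul1r ?mulrV ?mulVr.
Qed.

Section OneRing.
Variable A : ringUnder R0.
Hypothesis faithA : faithful A.
Local Notation inA := (under_map A).
Local Notation e := (idem A).

Lemma idem_nz j : e j != 0.
Proof.
rewrite /idem -(rmorph0 (under_map A)); apply/eqP => /faithA.
move/ffunP/(_ j); rewrite !ffunE eqxx => /eqP; apply/negP; exact: oner_neq0.
Qed.

Lemma idemA_sum : \sum_j e j = 1.
Proof. by rewrite -rmorph_sum prod_idem_sum rmorph1. Qed.

(** Only homogeneous elements, those lying in some e i * A * e j, are used as basis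
    vectors. *)
Definition homog (t : A) (i j : 'I_p) : Prop := e i * t = t /\ t * e j = t.

Lemma homog_inj t i j i' j' : t != 0 -> homog t i j -> homog t i' j' ->
  i = i' /\ j = j'.
Proof.
move=> t0 [h1 h2] [h1' h2']; split; apply/eqP; apply: contraNT t0 => ne.
  by rewrite -h1' -h1 mulrA idemM [i' == _]eq_sym (negbTE ne) mul0r.
by rewrite -h2' -h2 -mulrA idemM (negbTE ne) mulr0.
Qed.

(** A basis of A over the base that consists of homogeneous elements and contains
    the idempotents. Independence is stated as the extension property for
    additive maps: prescribed values on the basis define functions on A without
    any choice of coordinates. *)
Record right_basis := RightBasis {
  bS : A -> Prop;
  bsrc : A -> 'I_p;
  btgt : A -> 'I_p;
  bS_homog : forall t, bS t -> homog t (bsrc t) (btgt t);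
  bS_idem : forall j, bS (e j);
  bsrc_idem : forall j, bsrc (e j) = j;
  btgt_idem : forall j, btgt (e j) = j;
  bS_ext : forall (E : zmodType) (g : A -> R0 -> E),
    (forall t, bS t -> (forall k k', g t (k + k') = g t k + g t k') /\
                       (forall k, g t (eps (btgt t) * k) = g t k)) ->
    exists G : A -> E, (forall a a', G (a + a') = G a + G a') /\
      forall t k, bS t -> G (t * inA k) = g t k;
  bS_span : forall P : A -> Prop, P 0 -> (forall a a', P a -> P a' -> P (a + a')) ->
    (forall t k, bS t -> P (t * inA k)) -> forall a, P a
}.

(** Independence is inherited by unions of chains, as it speaks of finite sums; this is
    why Zorn's lemma is applied to it and not to the extension property. *)
Definition indep (S : A -> Prop) : Prop :=
  forall (s : seq A) (k : A -> R0), uniq s -> {in s, forall t, S t} ->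
    \sum_(t <- s) t * inA (k t) = 0 -> {in s, forall t, t * inA (k t) = 0}.

Definition withE (S : A -> Prop) : A -> Prop := fun t => S t \/ exists j, t = e j.

Definition good_set (S : A -> Prop) : Prop :=
  (forall t, S t -> t != 0 /\ exists i j, homog t i j) /\ indep (withE S).

Lemma homog_idem j : homog (e j) j j.
Proof. by rewrite /homog idemM eqxx. Qed.

Lemma withE_homog S t : good_set S -> withE S t ->
  t != 0 /\ exists i j, homog t i j.
Proof.
by move=> [hS _] [/hS //|[j ->]]; split; [exact: idem_nz | exists j, j; apply: homog_idem].
Qed.

Lemma good_set0 : good_set (fun _ => False).
Proof.
split=> // s k us sE s0 t ts; have [[]|[j tj]] := sE _ ts.
have := congr1 (fun a => e j * a) s0; rewrite mulr0 mulr_sumr.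
rewrite (bigD1_seq t) //= big_seq_cond big1 ?addr0.
  by rewrite tj mulrA idemM eqxx.
move=> t' /andP [t's]; have [[]|[j' ->]] := sE _ t's; rewrite tj => ne.
have [jj'|jj'] := eqVneq j j'; first by rewrite jj' eqxx in ne.
by rewrite mulrA idemM (negbTE jj') mul0r.
Qed.

Lemma good_union (C : (A -> Prop) -> Prop) : (forall X, C X -> good_set X) ->
  (forall X Y, C X -> C Y ->
     (forall t, X t -> Y t) \/ (forall t, Y t -> X t)) ->
  good_set (fun t => exists2 X, C X & X t).
Proof.
move=> gC tC; split=> [t [X /gC [hX _] /hX //]|s k us sE].
have [X [CX sX]] : exists X : A -> Prop, (C X \/ X = fun=> False) /\
    {in s, forall t, withE X t}.
  elim: s sE {us} => [|t s IH] sE; first by exists (fun=> False); split; [right|].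
  have [X [CX sX]] : exists X : A -> Prop, (C X \/ X = fun=> False) /\
      {in s, forall t, withE X t}.
    by apply: IH => t' ts'; apply: sE; rewrite inE ts' orbT.
  have [[Y CY Yt]|[j tj]] := sE _ (mem_head t s); last first.
    by exists X; split=> // t'; rewrite inE => /orP[/eqP->|/sX//]; right; exists j.
  have [XY|YX] : (forall t, X t -> Y t) \/ (forall t, Y t -> X t).
    by case: CX => [CX|->]; [exact: tC | left].
    exists Y; split; [by left|] => t'; rewrite inE => /orP[/eqP->|/sX].
      by left.
    by case=> [/XY|]; [left | right].
  exists X; split=> // t'; rewrite inE => /orP[/eqP->|/sX//].
  by left; apply: YX.
have [_ iX] : good_set X by case: CX => [/gC //|->]; exact: good_set0.
exact: iX.
Qed.

Inductive span (S : A -> Prop) : A -> Prop :=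
| span0 : span S 0
| spanD a a' : span S a -> span S a' -> span S (a + a')
| spanZ t k : S t -> span S (t * inA k).

Lemma spanM S a k : span S a -> span S (a * inA k).
Proof.
elim=> [|a1 a2 _ h1 _ h2|t k' St]; first by rewrite mul0r; apply: span0.
  by rewrite mulrDl; apply: spanD.
by rewrite -mulrA -rmorphM; apply: spanZ.
Qed.

Lemma homog_unit t i j k : t != 0 -> homog t i j -> t * inA k = 0 -> eps j * k = 0.
Proof.
move=> t0 [_ tj] tk; apply/eqP; apply: contraNT t0 => /prod_idem_inv [k' [kk' _]].
rewrite -tj /idem -kk' !rmorphM !mulrA -/(idem A j) tj tk mul0r.
by [].
Qed.

(** If a had a nonzero coefficient in a relation, the coefficient could be
    inverted, and a would lie in the span. *)
Lemma good_extend S a i j : good_set S -> homog a i j -> ~ span (withE S) a ->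
  good_set (fun t => S t \/ t = a).
Proof.
move=> gS ha nSa; have [hS iS] := gS; split.
  move=> t [/hS //|->]; split; last by exists i, j.
  by apply: contra_not_neq nSa => ->; apply: span0.
move=> s k us sE s0.
have sE' t : t \in s -> t != a -> withE S t.
  by move=> ts ta; case: (sE _ ts) => [[|/eqP]|]; [left | rewrite (negbTE ta) | right].
have [as_|nas] := boolP (a \in s); last first.
  apply: iS => // t ts; apply: sE' => //.
  by apply: contraNneq nas => <-.
have eS t : t \in rem a s -> withE S t.
  by rewrite mem_rem_uniq // inE => /andP[ta ts]; apply: sE'.
have s0' : a * inA (k a) + \sum_(t <- rem a s) t * inA (k t) = 0.
  by rewrite -[RHS]s0 [RHS](perm_big _ (perm_to_rem as_)) /= big_cons.
have k0 : eps j * k a = 0.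
  apply/eqP/negPn/negP => /prod_idem_inv [k' [kk' _]]; apply: nSa.
  have -> : a = - (\sum_(t <- rem a s) t * inA (k t)) * inA k'.
    have /eqP := s0'; rewrite addr_eq0 => /eqP <-.
    rewrite -{1}(ha.2) -[X in _ = X * _ * _](ha.2) /idem -!mulrA -!rmorphM.
    by rewrite (mulrA (eps j)) kk'.
  apply: spanM; rewrite -sumrN big_seq.
  apply: (big_ind (span (withE S))) => [||t /eS ts]; [exact: span0|exact: spanD|].
  by rewrite -mulrN -rmorphN; apply: spanZ.
have a0 : a * inA (k a) = 0.
  by rewrite -[X in X * _](ha.2) /idem -mulrA -rmorphM k0 rmorph0 mulr0.
move=> t ts; have [->//|ta] := eqVneq t a.
apply: (iS (rem a s)) => //; first exact: rem_uniq.
  by rewrite -[RHS]s0' a0 add0r.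
by rewrite mem_rem_uniq // inE ta.
Qed.

Lemma maximal_good_set : exists S, good_set S /\ forall a, span (withE S) a.
Proof.
have [S [gS maxS]] := classical_sets.Zorn_bigcup good_union; exists S; split=> // a.
have sh a' i j : homog a' i j -> span (withE S) a'.
  move=> ha; apply: contrapT => na.
  apply: (maxS _ _ (good_extend gS ha na)); split; first by move=> t; left.
  move=> sub; apply: na; rewrite -[a']mulr1 -(rmorph1 (under_map A)).
  by apply: spanZ; left; apply: sub; right.
have -> : a = \sum_i \sum_j e i * a * e j.
  under eq_bigr do rewrite -mulr_sumr idemA_sum mulr1.
  by rewrite -mulr_suml idemA_sum mul1r.
apply: (big_ind (span (withE S))) => [||i _]; [exact: span0|exact: spanD|].
apply: (big_ind (span (withE S))) => [||j _]; [exact: span0|exact: spanD|].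
apply: (sh _ i j); split; first by rewrite !mulrA idemM eqxx.
by rewrite -!mulrA idemM eqxx.
Qed.

Lemma sum_supp (E : zmodType) (s s' : seq A) (f : A -> E) : uniq s -> uniq s' ->
  {subset s <= s'} -> (forall t, t \notin s -> f t = 0) ->
  \sum_(t <- s') f t = \sum_(t <- s) f t.
Proof.
move=> us us' ss' f0; rewrite (bigID (fun t => t \in s)) /= [X in _ + X]big1 //.
rewrite addr0 -big_filter; apply: perm_big; apply: uniq_perm => //.
  exact: filter_uniq.
by move=> t; rewrite mem_filter andb_idr // => /ss'.
Qed.

Section Extension.
Variables (S : A -> Prop) (E : zmodType) (g : A -> R0 -> E).
Hypothesis gD : forall t, S t -> forall k k', g t (k + k') = g t k + g t k'.

Definition represents (a : A) (v : E) : Prop := exists (s : seq A) (k : A -> R0),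
  [/\ uniq s, {in s, forall t, S t}, a = \sum_(t <- s) t * inA (k t)
    & v = \sum_(t <- s) g t (k t)].

Lemma representsD a a' v v' : represents a v -> represents a' v' ->
  represents (a + a') (v + v').
Proof.
have g0 t : S t -> g t 0 = 0.
  by move=> St; apply: (addrI (g t 0)); rewrite -gD // !addr0.
move=> [s [k [us sS -> ->]]] [s' [k' [us' sS' -> ->]]].
pose c (s : seq A) (k : A -> R0) t := if t \in s then k t else 0.
exists (undup (s ++ s')), (fun t => c s k t + c s' k' t).
have uu : uniq (undup (s ++ s')) by apply: undup_uniq.
have uS t : t \in undup (s ++ s') -> S t.
  by rewrite mem_undup mem_cat => /orP[/sS|/sS'].
have main (E' : zmodType) (f : A -> R0 -> E') s1 k1 : uniq s1 ->
    {subset s1 <= s ++ s'} -> (forall t, S t -> f t 0 = 0) ->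
    \sum_(t <- s1) f t (k1 t) = \sum_(t <- undup (s ++ s')) f t (c s1 k1 t).
  move=> us1 sub f0.
  have -> : \sum_(t <- undup (s ++ s')) f t (c s1 k1 t) =
      \sum_(t <- undup (s ++ s')) if t \in s1 then f t (k1 t) else 0.
    rewrite !big_seq; apply: eq_bigr => t st; rewrite /c; case: ifP => // _.
    by apply: f0; apply: uS.
  have sub' : {subset s1 <= undup (s ++ s')}.
    by move=> t /sub; rewrite mem_undup.
  have h0 t : t \notin s1 -> (if t \in s1 then f t (k1 t) else 0) = 0.
    by move=> /negbTE->.
  rewrite (sum_supp us1 uu sub' h0) !big_seq.
  by apply: eq_bigr => t ->.
have ls : {subset s <= s ++ s'} by move=> t; rewrite mem_cat => ->.
have ls' : {subset s' <= s ++ s'} by move=> t; rewrite mem_cat orbC => ->.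
split=> //.
- rewrite (main A (fun t k => t * inA k) s) // => [|t _]; last by rewrite rmorph0 mulr0.
  rewrite (main A (fun t k => t * inA k) s') // => [|t _]; last by rewrite rmorph0 mulr0.
  by rewrite -big_split; apply: eq_bigr => t _; rewrite /= rmorphD mulrDr.
- rewrite (main E g s) // (main E g s') // -big_split !big_seq.
  by apply: eq_bigr => t /uS St; rewrite /= gD.
Qed.

Lemma representsN a v : represents a v -> represents (- a) (- v).
Proof.
have g0 t : S t -> g t 0 = 0.
  by move=> St; apply: (addrI (g t 0)); rewrite -gD // !addr0.
move=> [s [k [us sS -> ->]]]; exists s, (fun t => - k t); split=> //.
  by rewrite -sumrN; apply: eq_bigr => t _; rewrite rmorphN mulrN.
rewrite -sumrN !big_seq; apply: eq_bigr => t /sS St.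
by apply/eqP; rewrite eq_sym -addr_eq0 -gD // addNr g0.
Qed.

End Extension.

(** The extension of g sends a combination of basis vectors to the corresponding
    combination of values, which is well defined by independence. *)
Lemma right_basis_exists (j0 : 'I_p) : inhabited right_basis.
Proof.
have [S [gS spS]] := maximal_good_set.
have hom t : withE S t -> t != 0 /\ exists i j, homog t i j.
  exact: withE_homog gS.
have /choice [ty Pty] : forall t, exists ij : 'I_p * 'I_p,
    withE S t -> homog t ij.1 ij.2.
  move=> t; have [/hom [_ [i [j h]]]|nS] := EM (withE S t); first by exists (i, j).
  by exists (j0, j0).
have SE j : withE S (e j) by right; exists j.
have tyE j : (ty (e j)).1 = j /\ (ty (e j)).2 = j.
  have [_ h] := hom _ (SE j); case: (homog_inj (idem_nz j) (Pty _ (SE j)) (homog_idem j)).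
  by [].
constructor; apply: (@RightBasis (withE S) (fun t => (ty t).1) (fun t => (ty t).2)) => //.
- by move=> j; case: (tyE j).
- by move=> j; case: (tyE j).
- move=> E g Pg; have gD t St := (Pg t St).1.
  have tot a : exists v, represents (withE S) g a v.
    elim: (spS a) => [|a1 a2 _ [v1 h1] _ [v2 h2]|t k St].
    - by exists 0, [::], (fun=> 0); rewrite !big_nil.
    - by exists (v1 + v2); apply: representsD.
    - exists (g t k), [:: t], (fun=> k); rewrite !big_seq1; split=> // t'.
      by rewrite inE => /eqP->.
  have zero v : represents (withE S) g 0 v -> v = 0.
    move=> [s [k [us sS /esym s0 ->]]]; rewrite big_seq big1 // => t ts.
    have St := sS _ ts; have [t0 _] := hom _ St.
    rewrite -(Pg t St).2 (homog_unit t0 (Pty _ St)); last first.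
      by have [_ iS] := gS; apply: (iS s).
    by apply: (addrI (g t 0)); rewrite -gD // !addr0.
  have uni a v v' : represents (withE S) g a v -> represents (withE S) g a v' ->
      v = v'.
    move=> h h'; apply/eqP; rewrite -subr_eq0; apply/eqP; apply: zero.
    by rewrite -(subrr a); apply: representsD => //; apply: representsN.
  have /choice [G PG] := tot; exists G; split=> [a a'|t k St].
    by apply: uni (PG _) _; apply: representsD.
  apply: uni (PG _) _; exists [:: t], (fun=> k); rewrite !big_seq1; split=> // t'.
  by rewrite inE => /eqP->.
- move=> P P0 PD PZ a; elim: (spS a) => [//|a1 a2 _ h1 _ h2|t k St].
    exact: PD.
  exact: PZ.
Qed.

End OneRing.
End Bases.

(** * Endomorphism rings, and generators of a coproduct *)

Definition mk_rmorphism (A B : pzRingType) (f : A -> B)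
    (fB : {morph f : x y / x - y})
    (fM : GRing.monoid_morphism f) : {rmorphism A -> B} :=
  HB.pack f (GRing.isZmodMorphism.Build A B f fB)
            (GRing.isMonoidMorphism.Build A B f fM).

Section Endo.
Variable X : zmodType.

Record endo := Endo {
  endo_fun :> X -> X;
  endoD : forall x y, endo_fun (x + y) = endo_fun x + endo_fun y
}.

Lemma endoP (f g : endo) : (forall x, f x = g x) -> f = g.
Proof.
case: f g => [f fD] [g gD] /= /funext fg; subst g; congr Endo; exact: Prop_irrelevance.
Qed.

HB.instance Definition _ := gen_eqMixin endo.
HB.instance Definition _ := gen_choiceMixin endo.

Definition endo0 : endo := @Endo (fun=> 0) (fun _ _ => esym (addr0 0)).
Definition endo1 : endo := @Endo id (fun _ _ => erefl).
Definition endo_add (f g : endo) : endo.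
Proof.
exists (fun x => f x + g x) => x y; rewrite !endoD.
by rewrite !addrA; congr (_ + _); rewrite -!addrA; congr (_ + _); rewrite addrC.
Defined.
Definition endo_opp (f : endo) : endo.
Proof. by exists (fun x => - f x) => x y; rewrite endoD opprD. Defined.
Definition endo_mul (f g : endo) : endo.
Proof. by exists (fun x => f (g x)) => x y; rewrite !endoD. Defined.

Fact endo_addA : associative endo_add.
Proof. by move=> f g h; apply: endoP => x /=; rewrite addrA. Qed.
Fact endo_addC : commutative endo_add.
Proof. by move=> f g; apply: endoP => x /=; rewrite addrC. Qed.
Fact endo_add0 : left_id endo0 endo_add.
Proof. by move=> f; apply: endoP => x /=; rewrite add0r. Qed.
Fact endo_addN : left_inverse endo0 endo_opp endo_add.
Proof. by move=> f; apply: endoP => x /=; rewrite addNr. Qed.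
HB.instance Definition _ := GRing.isZmodule.Build endo
  endo_addA endo_addC endo_add0 endo_addN.

Fact endo_mulA : associative endo_mul.
Proof. by move=> f g h; apply: endoP. Qed.
Fact endo_mul1 : left_id endo1 endo_mul.
Proof. by move=> f; apply: endoP. Qed.
Fact endo_mulr1 : right_id endo1 endo_mul.
Proof. by move=> f; apply: endoP. Qed.
Fact endo_mulDl : left_distributive endo_mul +%R.
Proof. by move=> f g h; apply: endoP. Qed.
Fact endo_mulDr : right_distributive endo_mul +%R.
Proof. by move=> f g h; apply: endoP => x /=; rewrite endoD. Qed.
HB.instance Definition _ := GRing.Zmodule_isPzRing.Build endo
  endo_mulA endo_mul1 endo_mulr1 endo_mulDl endo_mulDr.

Lemma endo_mulE (f g : endo) x : (f * g) x = f (g x). Proof. by []. Qed.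
Lemma endo_subE (f g : endo) x : (f - g) x = f x - g x. Proof. by []. Qed.

End Endo.

Section Subring.
Variables (R : pzRingType) (S : R -> Prop).
Hypotheses (S1 : S 1) (SB : forall r s, S r -> S s -> S (r - s)).
Hypothesis SM : forall r s, S r -> S s -> S (r * s).

Record subring_of := SubringOf { srval : R; srvalP : S srval }.

Lemma srval_inj : injective srval.
Proof. by move=> [x Sx] [y Sy] /= xy; subst y; congr SubringOf; exact: Prop_irrelevance. Qed.

HB.instance Definition _ := gen_eqMixin subring_of.
HB.instance Definition _ := gen_choiceMixin subring_of.

Let S0 : S 0. Proof. by rewrite -(subrr 1); apply: SB. Qed.
Let SN r : S r -> S (- r). Proof. by move=> Sr; rewrite -[- r]add0r; apply: SB. Qed.
Let SD r s : S r -> S s -> S (r + s).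
Proof. by move=> Sr Ss; rewrite -[s]opprK; apply: SB => //; apply: SN. Qed.

Definition sr_add x y := SubringOf (SD (srvalP x) (srvalP y)).
Definition sr_opp x := SubringOf (SN (srvalP x)).
Definition sr_mul x y := SubringOf (SM (srvalP x) (srvalP y)).

Fact sr_addA : associative sr_add.
Proof. by move=> x y z; apply: srval_inj; apply: addrA. Qed.
Fact sr_addC : commutative sr_add.
Proof. by move=> x y; apply: srval_inj; apply: addrC. Qed.
Fact sr_add0 : left_id (SubringOf S0) sr_add.
Proof. by move=> x; apply: srval_inj; apply: add0r. Qed.
Fact sr_addN : left_inverse (SubringOf S0) sr_opp sr_add.
Proof. by move=> x; apply: srval_inj; apply: addNr. Qed.
HB.instance Definition _ := GRing.isZmodule.Build subring_of
  sr_addA sr_addC sr_add0 sr_addN.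

Fact sr_mulA : associative sr_mul.
Proof. by move=> x y z; apply: srval_inj; apply: mulrA. Qed.
Fact sr_mul1 : left_id (SubringOf S1) sr_mul.
Proof. by move=> x; apply: srval_inj; apply: mul1r. Qed.
Fact sr_mulr1 : right_id (SubringOf S1) sr_mul.
Proof. by move=> x; apply: srval_inj; apply: mulr1. Qed.
Fact sr_mulDl : left_distributive sr_mul +%R.
Proof. by move=> x y z; apply: srval_inj; apply: mulrDl. Qed.
Fact sr_mulDr : right_distributive sr_mul +%R.
Proof. by move=> x y z; apply: srval_inj; apply: mulrDr. Qed.
HB.instance Definition _ := GRing.Zmodule_isPzRing.Build subring_of
  sr_mulA sr_mul1 sr_mulr1 sr_mulDl sr_mulDr.

Definition sr_incl : {rmorphism subring_of -> R} :=
  @mk_rmorphism _ _ srval (fun _ _ => erefl) (erefl, fun _ _ => erefl).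

Definition sr_corestr (A : pzRingType) (f : {rmorphism A -> R})
    (Sf : forall a, S (f a)) : {rmorphism A -> subring_of}.
Proof.
apply: (@mk_rmorphism _ _ (fun a => SubringOf (Sf a))).
- by move=> a b; apply: srval_inj; rewrite /= rmorphB.
- by split=> [|a b]; apply: srval_inj; rewrite /= ?rmorph1 ?rmorphM.
Defined.

End Subring.

Section Generation.
Variables (R0 : pzRingType) (L : Type) (F : L -> ringUnder R0).
Variables (R : ringUnder R0) (iota : forall l : L, {rmorphism F l -> R}).
Hypothesis coprodR : is_coproduct iota.

(** The subring of the elements with property P receives maps from all factors,
    so the identity of the coproduct factors through it. *)
Lemma coproduct_ind (P : R -> Prop) : P 1 ->
  (forall r s, P r -> P s -> P (r - s)) -> (forall r s, P r -> P s -> P (r * s)) ->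
  (forall k, P (under_map R k)) -> (forall l a, P (iota l a)) -> forall r, P r.
Proof.
move=> P1 PB PM P0 Pi r; have [iotaU univ] := coprodR.
pose S := subring_of P.
have [//|h [hU hi _]] := univ (RingUnder (sr_corestr P1 PB PM P0))
  (fun l => sr_corestr P1 PB PM (Pi l)).
  by move=> l x; apply: srval_inj => /=; apply: iotaU.
have [//|h0 [_ _ uniq]] := univ R iota.
pose h1 : {rmorphism R -> R} := sr_incl P1 PB PM \o h.
have E1 : h1 =1 h0.
  by apply: uniq => [x|l a]; rewrite /h1 /= ?hU // [h _](hi l a).
have E2 : @idfun R =1 h0 by apply: uniq.
have := srvalP (h r); suff -> : srval (h r) = r by [].
by have := E1 r; rewrite -E2.
Qed.

End Generation.

(** * The module of functions on words *)

Section Words.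
Variables (p : nat) (K : 'I_p -> unitRingType) (L : Type).
Local Notation R0 := (prod_ring K).
Local Notation eps := (prod_idem K).
Variable F : L -> ringUnder R0.
Variable B : forall l, right_basis (F l).
Implicit Types (l : L) (k : R0).
Local Notation inF l := (under_map (F l)).
Local Notation e l := (idem (F l)).

Definition letter : Type := {l : L & F l}.
(** A word is a starting index and a sequence of letters, with the last letter
    first. *)
Definition rword : Type := ('I_p * seq letter)%type.
Implicit Types u v : rword.

Definition wtgt u : 'I_p :=
  if u.2 is a :: _ then btgt (B (tag a)) (tagged a) else u.1.
Definition wlast u : option L := if u.2 is a :: _ then Some (tag a) else None.

Definition proper_letter l (t : F l) : Prop := bS (B l) t /\ forall j, t <> e l j.

(** Letters are basis elements other than the idempotents, consecutive letters
    have matching indices, and neighbours have different labels. *)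
Fixpoint wvalid_seq i (w : seq letter) : Prop :=
  if w is a :: w' then
    [/\ wvalid_seq i w', proper_letter (tagged a),
        bsrc (B (tag a)) (tagged a) = wtgt (i, w')
      & wlast (i, w') <> Some (tag a)]
  else True.
Definition wvalid u : Prop := wvalid_seq u.1 u.2.

Definition app u l (t : F l) : rword := (u.1, existT _ l t :: u.2).

(** With respect to the label l, a valid word is a word off l followed by a basis
    element of F l, which is an idempotent if the word itself is off l. *)
Definition wsplit l u : rword * F l :=
  if u.2 is existT l' t :: w then
    match pselect (l' = l) with
    | left E => ((u.1, w), eq_rect l' (fun l => F l : Type) t l E)
    | right _ => (u, e l (wtgt u))
    end
  else (u, e l (wtgt u)).

Lemma wsplit_app l u (t : F l) : wsplit l (app u t) = (u, t).
Proof.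
rewrite /wsplit /=; case: pselect => // E.
by rewrite (Prop_irrelevance E erefl); case: u.
Qed.

Lemma wsplit_good l u : wlast u <> Some l -> wsplit l u = (u, e l (wtgt u)).
Proof.
case: u => i [|[l' t] w] //=; rewrite /wlast /wsplit /= => ne.
by case: pselect => // El; case: ne; rewrite El.
Qed.

Lemma wsplit_spec l u : wvalid u ->
  wlast u <> Some l \/ exists u' (t : F l), [/\ u = app u' t, wvalid u',
    wlast u' <> Some l, proper_letter t & bsrc (B l) t = wtgt u'].
Proof.
case: u => i [|[l' t] w] /=; first by left.
move=> [/= vw pt st lw]; have [El|ne] := EM (l' = l); last first.
  by left; rewrite /wlast /=; case.
subst l'; right; exists (i, w), t; split=> //.
Qed.

(** A word u off l, together with its extensions by one letter labelled l, stands
    for a copy of the part of F l that starts with the index of u. *)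
Lemma block_ind l u (P : F l -> Prop) : P 0 ->
  (forall y y', P y -> P y' -> P (y + y')) ->
  (forall k, P (e l (wtgt u) * inF l k)) ->
  (forall t k, proper_letter t -> bsrc (B l) t = wtgt u -> P (t * inF l k)) ->
  forall y, P (e l (wtgt u) * y).
Proof.
move=> P0 PD Pe Pt y; move: y; apply: (@bS_span _ _ _ (B l) (fun y => P (e l (wtgt u) * y)))
  => [|y y'|t k St].
- by rewrite mulr0.
- by rewrite mulrDr; apply: PD.
have [h1 h2] := bS_homog St; have [st|nst] := eqVneq (bsrc (B l) t) (wtgt u).
  rewrite mulrA -st h1; have [[j tE]|nt] := EM (exists j, t = e l j).
    by rewrite tE in st *; rewrite (bsrc_idem (B l)) in st; rewrite st.
  by apply: Pt => //; split=> // j tE; apply: nt; exists j.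
by rewrite -h1 !mulrA idemM eq_sym (negbTE nst) !mul0r.
Qed.

Lemma idem_val l u t : wvalid (app u t) -> bsrc (B l) t = wtgt u ->
  e l (wtgt u) * t = t /\ t * e l (wtgt (app u t)) = t.
Proof. by move=> [/= _ [St _] _ _] <-; apply: (bS_homog St). Qed.

Lemma app_valid l u t : wvalid u -> wlast u <> Some l -> proper_letter t ->
  bsrc (B l) t = wtgt u -> wvalid (app u t).
Proof. by case: u => i w vu lu pt st; split. Qed.

Lemma eF_idem l j : e l j * e l j = e l j.
Proof. by rewrite idemM eqxx. Qed.

Lemma wsplit_mul l u : wvalid u ->
  e l (wtgt (wsplit l u).1) * (wsplit l u).2 = (wsplit l u).2 /\
  (wsplit l u).2 * e l (wtgt u) = (wsplit l u).2.
Proof.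
move=> vu; have [lu|[u' [t [uE vu' lu' pt st]]]] := wsplit_spec l vu.
  by rewrite wsplit_good //= eF_idem.
by rewrite uE wsplit_app /=; apply: (idem_val (app_valid vu' lu' pt st) st).
Qed.

Lemma wsplit_valid l u : wvalid u ->
  wvalid (wsplit l u).1 /\ wlast (wsplit l u).1 <> Some l.
Proof.
move=> vu; have [lu|[u' [t [uE vu' lu' pt st]]]] := wsplit_spec l vu.
  by rewrite wsplit_good.
by rewrite uE wsplit_app.
Qed.

Section WordFunctions.
Variable E : zmodType.

(** The additive maps to E from the free right module on the words. *)
Record wfun := WFun {
  wf_fun :> rword -> R0 -> E;
  wfD : forall u k k', wf_fun u (k + k') = wf_fun u k + wf_fun u k';
  wfe : forall u k, wf_fun u (eps (wtgt u) * k) = wf_fun u k;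
  wf0 : forall u k, ~ wvalid u -> wf_fun u k = 0
}.

Lemma wfunP (f g : wfun) : (forall u k, f u k = g u k) -> f = g.
Proof.
case: f g => [f f1 f2 f3] [g g1 g2 g3] /= fg.
have {}fg : f = g by apply/funext=> u; apply/funext.
by subst g; congr WFun; apply: Prop_irrelevance.
Qed.

HB.instance Definition _ := gen_eqMixin wfun.
HB.instance Definition _ := gen_choiceMixin wfun.

Definition wfun0 : wfun.
Proof. by exists (fun _ _ => 0) => // *; rewrite addr0. Defined.
Definition wfun_add (f g : wfun) : wfun.
Proof.
exists (fun u k => f u k + g u k) => [u k k'|u k|u k nv].
- by rewrite !wfD addrACA.
- by rewrite !wfe.
- by rewrite !wf0 // addr0.
Defined.
Definition wfun_opp (f : wfun) : wfun.
Proof.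
exists (fun u k => - f u k) => [u k k'|u k|u k nv].
- by rewrite wfD opprD.
- by rewrite wfe.
- by rewrite wf0 // oppr0.
Defined.
Fact wfun_addA : associative wfun_add.
Proof. by move=> f g h; apply: wfunP => u k /=; rewrite addrA. Qed.
Fact wfun_addC : commutative wfun_add.
Proof. by move=> f g; apply: wfunP => u k /=; rewrite addrC. Qed.
Fact wfun_add0 : left_id wfun0 wfun_add.
Proof. by move=> f; apply: wfunP => u k /=; rewrite add0r. Qed.
Fact wfun_addN : left_inverse wfun0 wfun_opp wfun_add.
Proof. by move=> f; apply: wfunP => u k /=; rewrite addNr. Qed.
HB.instance Definition _ := GRing.isZmodule.Build wfun
  wfun_addA wfun_addC wfun_add0 wfun_addN.

Lemma wfun_k0 (f : wfun) u : f u 0 = 0.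
Proof. by apply: (addrI (f u 0)); rewrite -wfD !addr0. Qed.

Lemma ext_ex (f : wfun) l u : exists G : F l -> E,
  (forall y y', G (y + y') = G y + G y') /\
  forall t k, bS (B l) t -> G (t * inF l k) =
    if bsrc (B l) t == wtgt u then
      if `[< exists j, t = e l j >] then f u k else f (app u t) k
    else 0.
Proof.
apply: (bS_ext (r := B l) (g := fun t k => if bsrc (B l) t == wtgt u then
  if `[< exists j, t = e l j >] then f u k else f (app u t) k else 0)) => t St.
split=> [k k'|k]; case: eqP => [st|_]; rewrite ?addr0 //; case: asboolP => ht.
- exact: wfD.
- exact: wfD.
- case: ht => j tE; rewrite tE (btgt_idem (B l)).
  by move: st; rewrite tE (bsrc_idem (B l)) => ->; rewrite wfe.
- by rewrite -[RHS]wfe.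
Qed.

Definition ext (f : wfun) l u : F l -> E := sval (cid (ext_ex f l u)).

Lemma extD f l u y y' : ext f u (y + y') = ext f u y + ext (l := l) f u y'.
Proof. by rewrite /ext; case: cid => G /= [GD _]. Qed.

Lemma ext0 f l u : ext f u (0 : F l) = 0.
Proof. by apply: (addrI (ext f u (0 : F l))); rewrite -extD !addr0. Qed.

Lemma ext_idem f l u k : ext f u (e l (wtgt u) * inF l k) = f u k.
Proof.
rewrite /ext; case: cid => G /= [_ ->]; last exact: bS_idem.
by rewrite (bsrc_idem (B l)) eqxx asboolT //; exists (wtgt u).
Qed.

Lemma ext_proper f l u t k : proper_letter t -> bsrc (B l) t = wtgt u ->
  ext f u (t * inF l k) = f (app u t) k.
Proof.
move=> [St nt] st; rewrite /ext; case: cid => G /= [_ ->] //.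
by rewrite st eqxx asboolF // => -[j /nt].
Qed.

Lemma ext_split f l u k : wvalid u ->
  ext f (wsplit l u).1 ((wsplit l u).2 * inF l k) = f u k.
Proof.
move=> vu; have [lu|[u' [t [uE vu' lu' pt st]]]] := wsplit_spec l vu.
  by rewrite wsplit_good //= ext_idem.
by rewrite uE wsplit_app /= ext_proper.
Qed.

(** On each block, r in F l acts by right multiplication on the argument, as for
    maps defined on a right module; hence the functions form a left module. *)
Definition act_fun l (r : F l) (f : wfun) u k : E :=
  if pselect (wvalid u) then ext f (wsplit l u).1 ((wsplit l u).2 * inF l k * r)
  else 0.

Lemma act_funE l (r : F l) f u k : wvalid u ->
  act_fun r f u k = ext f (wsplit l u).1 ((wsplit l u).2 * inF l k * r).
Proof. by rewrite /act_fun; case: pselect. Qed.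

Definition act l (r : F l) (f : wfun) : wfun.
Proof.
exists (act_fun r f) => [u k k'|u k|u k nv]; rewrite /act_fun;
  case: pselect => vu //; rewrite ?addr0 //.
- by rewrite rmorphD mulrDr mulrDl extD.
- by rewrite rmorphM mulrA (wsplit_mul l vu).2.
Defined.

Lemma ext_act l (r : F l) f u y : wvalid u -> wlast u <> Some l ->
  ext (act r f) u (e l (wtgt u) * y) = ext f u (e l (wtgt u) * y * r).
Proof.
move=> vu lu; apply: (block_ind (P := fun y => ext (act r f) u y = ext f u (y * r))).
- by rewrite mul0r !ext0.
- by move=> y1 y2 h1 h2; rewrite mulrDl !extD h1 h2.
- by move=> k; rewrite ext_idem /= act_funE // wsplit_good.
- by move=> t k pt st; rewrite ext_proper //= act_funE ?wsplit_app.
Qed.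

Lemma act_mul l (r s : F l) f : act (s * r) f = act s (act r f).
Proof.
apply: wfunP => u k /=; have [vu|nu] := EM (wvalid u); last first.
  by rewrite /act_fun; case: pselect.
rewrite !act_funE //; have [v1 v2] := wsplit_valid l vu.
have [m1 m2] := wsplit_mul l vu.
by rewrite -m1 -!mulrA ext_act // !mulrA.
Qed.

Lemma act_base l k' f u k : act (inF l k') f u k = f u (k * k').
Proof.
have [vu|nu] := EM (wvalid u); last first.
  by rewrite wf0 // wf0.
by rewrite /= act_funE // -mulrA -rmorphM ext_split.
Qed.

Lemma act1 l f : act (1 : F l) f = f.
Proof. by apply: wfunP => u k; rewrite -(rmorph1 (inF l)) act_base mulr1. Qed.

Lemma act_addl l (r s : F l) f u k : act (r + s) f u k = act r f u k + act s f u k.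
Proof.
have [vu|nu] := EM (wvalid u); last by rewrite !wf0 // addr0.
by rewrite /= !act_funE // mulrDr extD.
Qed.

Lemma ext_addf l f g u (y : F l) : ext (f + g) u (e l (wtgt u) * y) =
  ext f u (e l (wtgt u) * y) + ext g u (e l (wtgt u) * y).
Proof.
apply: (block_ind (P := fun y => ext (f + g) u y = ext f u y + ext g u y)).
- by rewrite !ext0 addr0.
- by move=> y1 y2 h1 h2; rewrite !extD h1 h2 addrACA.
- by move=> k; rewrite !ext_idem.
- by move=> t k pt st; rewrite !ext_proper.
Qed.

Lemma act_addr l (r : F l) f g : act r (f + g) = act r f + act r g.
Proof.
apply: wfunP => u k; have [vu|nu] := EM (wvalid u); last by rewrite !wf0.
have [m1 m2] := wsplit_mul l vu.
rewrite /= !act_funE // -m1 -!mulrA; exact: ext_addf.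
Qed.

Definition rho_endo l (r : F l) : endo wfun := Endo (act_addr r).

Lemma rho_sub l (r s : F l) : rho_endo (r - s) = rho_endo r - rho_endo s.
Proof.
apply: endoP => f; apply: wfunP => u k; rewrite endo_subE.
apply: (@addIr _ (act s f u k)); rewrite -act_addl subrK.
by rewrite /= subrK.
Qed.

Lemma rho_monoid l : GRing.monoid_morphism (@rho_endo l).
Proof.
by split=> [|s r]; apply: endoP => f; [apply: act1 | apply: act_mul].
Qed.

Definition rho l : {rmorphism F l -> endo wfun} :=
  mk_rmorphism (@rho_sub l) (@rho_monoid l).

Definition base_act k' (f : wfun) : wfun.
Proof.
exists (fun u k => f u (k * k')) => [u k k1|u k|u k nv].
- by rewrite mulrDl wfD.
- by rewrite -mulrA wfe.
- by rewrite wf0.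
Defined.

Lemma base_actD k' f g : base_act k' (f + g) = base_act k' f + base_act k' g.
Proof. exact: wfunP. Qed.

Definition base_endo k' : endo wfun := Endo (base_actD k').

Lemma base_sub k k' : base_endo (k - k') = base_endo k - base_endo k'.
Proof.
apply: endoP => f; apply: wfunP => u k1; rewrite endo_subE /=.
by apply: (@addIr _ (f u (k1 * k'))); rewrite -wfD -mulrDr !subrK.
Qed.

Lemma base_monoid : GRing.monoid_morphism base_endo.
Proof.
split=> [|k k']; apply: endoP => f; apply: wfunP => u k1 /=.
  by rewrite mulr1.
by rewrite mulrA.
Qed.

(** The actions of all F l restrict to the same action of the base, so together
    they are a map from the coproduct to this ring. *)
Definition wordRing : ringUnder R0 :=
  RingUnder (mk_rmorphism base_sub base_monoid).

Lemma rho_under l : is_underMor (T := wordRing) (rho l).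
Proof.
by move=> k; apply: endoP => f; apply: wfunP => u k1; apply: act_base.
Qed.

End WordFunctions.
End Words.

(** * Normal forms in a coproduct *)

Section CoproductNF.
Variables (p : nat) (K : 'I_p -> unitRingType) (L : Type).
Local Notation R0 := (prod_ring K).
Local Notation eps := (prod_idem K).
Variables (F : L -> ringUnder R0) (R : ringUnder R0).
Variable iota : forall l : L, {rmorphism F l -> R}.
Hypothesis coprodR : is_coproduct iota.
Variable B : forall l, right_basis (F l).
Implicit Types (l : L) (k : R0).
Local Notation inF l := (under_map (F l)).
Local Notation inR := (under_map R).
Local Notation rword := (rword F).
Local Notation wtgt := (wtgt B).
Local Notation wvalid := (wvalid B).
Local Notation wsplit := (wsplit B).
Implicit Types u v : rword.

Definition factor_image mu (r : R) : Prop :=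
  exists a : ext_family F mu, r = ext_map iota mu a.

Lemma iota_under l k : iota l (inF l k) = inR k.
Proof. by case: coprodR => h _; apply: h. Qed.

Lemma iota_idem l j : iota l (idem (F l) j) = idem R j.
Proof. exact: iota_under. Qed.

Definition wval u : R :=
  foldr (fun a acc => acc * iota (tag a) (tagged a)) (idem R u.1) u.2.

Lemma wval_app l u (t : F l) : wval (app u t) = wval u * iota l t.
Proof. by []. Qed.

Lemma eR_idem j : idem R j * idem R j = idem R j.
Proof. by rewrite idemM eqxx. Qed.

Lemma wval_src u : idem R u.1 * wval u = wval u.
Proof.
case: u => i w; elim: w => [|a w IH]; first exact: eR_idem.
by rewrite /wval /= mulrA; congr (_ * _).
Qed.

Lemma wval_tgt u : wvalid u -> wval u * idem R (wtgt u) = wval u.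
Proof.
case: u => i [|[l t] w]; first by move=> _; apply: eR_idem.
move=> [_ [/= /bS_homog [_ te] _] _ _].
by rewrite /wval /= -mulrA -[idem R (btgt _ _)](iota_idem l) -rmorphM te.
Qed.

Lemma wval_split l u : wvalid u ->
  wval u = wval (wsplit l u).1 * iota l (wsplit l u).2.
Proof.
move=> vu; have [lu|[u' [t [uE vu' lu' pt st]]]] := wsplit_spec l vu.
  by rewrite wsplit_good //= iota_idem wval_tgt.
by rewrite uE wsplit_app.
Qed.

(** The values of the words are independent over the base. A function on words is
    a vector in the module over the coproduct constructed above; the value of a
    word moves its entry at that word to the empty word, where it is read off. *)
Lemma wval_ext (E : zmodType) (g : rword -> R0 -> E) :
  (forall u, wvalid u -> (forall k k', g u (k + k') = g u k + g u k') /\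
                         (forall k, g u (eps (wtgt u) * k) = g u k)) ->
  exists G : R -> E, (forall r s, G (r + s) = G r + G s) /\
    forall u k, wvalid u -> G (wval u * inR k) = g u k.
Proof.
move=> gP.
have [f fE] : exists f : wfun B E, forall u k, wvalid u -> f u k = g u k.
  pose f0 u k := if pselect (wvalid u) then g u k else 0.
  suff [f ff] : exists f : wfun B E, forall u k, f u k = f0 u k.
    by exists f => u k vu; rewrite ff /f0; case: pselect.
  unshelve eexists (@WFun _ _ _ _ _ _ f0 _ _ _); rewrite /f0 //.
  - move=> u k k'; case: pselect => vu; last by rewrite addr0.
    exact: (gP u vu).1.
  - by move=> u k; case: pselect => // vu; apply: (gP u vu).2.
  - by move=> u k nv; case: pselect.
have [h [hU hi _]] := coprodR.2 (wordRing B E) (rho B E) (@rho_under _ _ _ _ B E).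
have hval u (f' : wfun B E) i : wvalid u ->
    h (wval u) f' (i, [::]) (eps i) = if i == u.1 then f' u (eps (wtgt u)) else 0.
  case: u => i0 w; elim: w f' => [|[l t] w IH] f' vu.
    rewrite /wval /= /idem hU /= prod_idemM; case: eqP => [->|_]; first by [].
    by rewrite mulr0n wfun_k0.
  have [vw pt st lw] := vu.
  rewrite (@wval_app l (i0, w) t) rmorphM endo_mulE IH //.
  case: (i == i0) => //.
  have -> : h (iota l t) = rho B E l t by exact: hi.
  have [h1 h2] := bS_homog pt.1; rewrite -st.
  rewrite /= act_funE // wsplit_good //= -st -/(idem (F l) _) eF_idem h1.
  by rewrite -{1}h2 ext_proper.
exists (fun r => \sum_i h r f (i, [::]) (eps i)); split=> [r s|u k vu].
  by rewrite -big_split; apply: eq_bigr => i _; rewrite rmorphD.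
rewrite (bigD1 u.1) //= big1 ?addr0 => [|i iu]; rewrite rmorphM endo_mulE hval //.
  by rewrite eqxx hU /= fE // (gP u vu).2.
by rewrite (negbTE iu).
Qed.

Lemma wval_block_ind (P : R -> Prop) l u : wvalid u -> wlast u <> Some l ->
  P 0 -> (forall r s, P r -> P s -> P (r + s)) ->
  (forall u' k, wvalid u' -> P (wval u' * inR k)) ->
  forall y : F l, P (wval u * iota l y).
Proof.
move=> vu lu P0 PD Pv y; rewrite -(wval_tgt vu) -mulrA -(iota_idem l) -rmorphM.
apply: (block_ind (P := fun y => P (wval u * iota l y))) => [|y1 y2 h1 h2|k|t k pt st].
- by rewrite rmorph0 mulr0.
- by rewrite rmorphD mulrDr; apply: PD.
- by rewrite rmorphM iota_under iota_idem mulrA wval_tgt //; apply: Pv.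
- rewrite rmorphM iota_under mulrA -wval_app; apply: Pv.
  exact: app_valid.
Qed.

(** The span of the values of words contains 1 and is stable under right
    multiplication by every factor. *)
Lemma wval_span (P : R -> Prop) : P 0 -> (forall r s, P r -> P s -> P (r + s)) ->
  (forall u k, wvalid u -> P (wval u * inR k)) -> forall r, P r.
Proof.
move=> P0 PD Pv.
(* Q r says that r lies in the additive span of the values of words. *)
pose Q r := forall Z : R -> Prop, Z 0 -> (forall r s, Z r -> Z s -> Z (r + s)) ->
  (forall u k, wvalid u -> Z (wval u * inR k)) -> Z r.
suff H r : Q r by move=> r; apply: H.
have Q0 : Q 0 by [].
have QD r1 r2 : Q r1 -> Q r2 -> Q (r1 + r2).
  by move=> h1 h2 Z Z0 ZD Zv; apply: (ZD); [exact: (h1 Z) | exact: (h2 Z)].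
have Qv u k : wvalid u -> Q (wval u * inR k) by move=> vu Z _ _; apply.
have QN r1 : Q r1 -> Q (- r1).
  move=> h; apply: (h (fun r => Q (- r))) => [|r2 s h1 h2|u k vu].
  - by rewrite oppr0.
  - by rewrite opprD; apply: QD.
  - by rewrite -mulrN -rmorphN; apply: Qv.
have Q1 : Q 1.
  rewrite -(rmorph1 inR) -(prod_idem_sum K) rmorph_sum.
  apply: (big_ind Q) => // j _; have := Qv (j, [::]) 1 I.
  by rewrite rmorph1 mulr1.
pose S r := forall a, Q a -> Q (a * r).
suff Sr : S r by rewrite -[r]mul1r; apply: Sr.
apply: (coproduct_ind coprodR (P := S)) => [a Qa|r1 s h1 h2 a Qa|r1 s h1 h2 a Qa|k a Qa|l y a Qa].
- by rewrite mulr1.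
- by rewrite mulrBr; apply: QD; [apply: h1 | apply: QN; apply: h2].
- by rewrite mulrA; apply: h2; apply: h1.
- apply: (Qa (fun a => Q (a * inR k))) => [|r1 s h1 h2|u k' vu].
  + by rewrite mul0r.
  + by rewrite mulrDl; apply: QD.
  + by rewrite -mulrA -rmorphM; apply: Qv.
- apply: (Qa (fun a => Q (a * iota l y))) => [|r1 s h1 h2|u k' vu].
  + by rewrite mul0r.
  + by rewrite mulrDl; apply: QD.
  + rewrite (wval_split l vu) -(iota_under l) -!mulrA -!rmorphM.
    by have [v1 v2] := wsplit_valid l vu; apply: wval_block_ind.
Qed.

(** Over F l, the coefficient at a word off l collects its whole block. *)
Lemma factor_coef l u : exists c : R -> F l,
  (forall r s, c (r + s) = c r + c s) /\
  forall u' k, wvalid u' -> c (wval u' * inR k) =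
    if pselect ((wsplit l u').1 = u) then (wsplit l u').2 * inF l k else 0.
Proof.
apply: (wval_ext (g := fun u' k => if pselect ((wsplit l u').1 = u)
  then (wsplit l u').2 * inF l k else 0)) => u' vu'.
split=> [k k'|k]; case: pselect => //= uE; rewrite ?addr0 //.
  by rewrite rmorphD mulrDr.
by rewrite rmorphM mulrA (wsplit_mul l vu').2.
Qed.

Lemma base_coef u : exists c : R -> R0,
  (forall r s, c (r + s) = c r + c s) /\
  forall u' k, wvalid u' -> c (wval u' * inR k) =
    if pselect (u' = u) then eps (wtgt u) * k else 0.
Proof.
apply: (wval_ext (g := fun u' k => if pselect (u' = u)
  then eps (wtgt u) * k else 0)) => u' vu'.
split=> [k k'|k]; case: pselect => //= uE; rewrite ?addr0 //.
  by rewrite mulrDr.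
by rewrite uE mulrA prod_idemM eqxx.
Qed.

Definition fcoef l u : R -> F l := sval (cid (factor_coef l u)).
Definition kcoef u : R -> R0 := sval (cid (base_coef u)).

Lemma fcoefD l u r s : fcoef l u (r + s) = fcoef l u r + fcoef l u s.
Proof. by rewrite /fcoef; case: cid => c [cD _] /=. Qed.

Lemma fcoef0 l u : fcoef l u 0 = 0.
Proof. by apply: (addrI (fcoef l u 0)); rewrite -fcoefD !addr0. Qed.

Lemma fcoef_val l u u' k : wvalid u' -> fcoef l u (wval u' * inR k) =
  if pselect ((wsplit l u').1 = u) then (wsplit l u').2 * inF l k else 0.
Proof. by move=> vu'; rewrite /fcoef; case: cid => c /= [_ ->]. Qed.

Lemma fcoef_block l u u' (y : F l) : wvalid u' -> wlast u' <> Some l ->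
  fcoef l u (wval u' * iota l y) =
  if pselect (u' = u) then idem (F l) (wtgt u') * y else 0.
Proof.
move=> vu' lu'; rewrite -(wval_tgt vu') -mulrA -(iota_idem l) -rmorphM.
apply: (block_ind (P := fun y => fcoef l u (wval u' * iota l y) =
  if pselect (u' = u) then y else 0)) => [|y1 y2 h1 h2|k|t k pt st].
- by rewrite rmorph0 mulr0 fcoef0; case: pselect.
- by rewrite rmorphD mulrDr fcoefD h1 h2; case: pselect => //= ?; rewrite addr0.
- rewrite rmorphM iota_under iota_idem mulrA wval_tgt // fcoef_val //.
  by rewrite wsplit_good.
- by rewrite rmorphM iota_under mulrA -wval_app fcoef_val ?wsplit_app.
Qed.

Lemma fcoefM l u r (s : F l) : fcoef l u (r * iota l s) = fcoef l u r * s.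
Proof.
apply: (wval_span (P := fun r => fcoef l u (r * iota l s) = fcoef l u r * s)).
- by rewrite mul0r fcoef0 mul0r.
- by move=> r1 r2 h1 h2; rewrite mulrDl !fcoefD h1 h2 mulrDl.
- move=> u' k vu'; rewrite fcoef_val // (wval_split l vu').
  rewrite -(iota_under l) -!mulrA -!rmorphM.
  have [v1 v2] := wsplit_valid l vu'; rewrite fcoef_block //.
  case: pselect => /= ?; last by rewrite mul0r.
  by rewrite !mulrA (wsplit_mul l vu').1.
Qed.

Lemma fcoef_e l u r : idem (F l) (wtgt u) * fcoef l u r = fcoef l u r.
Proof.
apply: (wval_span (P := fun r => idem (F l) (wtgt u) * fcoef l u r = fcoef l u r)).
- by rewrite fcoef0 mulr0.
- by move=> r1 r2 h1 h2; rewrite !fcoefD mulrDr h1 h2.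
- move=> u' k vu'; rewrite fcoef_val //; case: pselect => /= [<-|?].
    by rewrite mulrA (wsplit_mul l vu').1.
  by rewrite mulr0.
Qed.

Lemma kcoefD u r s : kcoef u (r + s) = kcoef u r + kcoef u s.
Proof. by rewrite /kcoef; case: cid => c [cD _] /=. Qed.

Lemma kcoef0 u : kcoef u 0 = 0.
Proof. by apply: (addrI (kcoef u 0)); rewrite -kcoefD !addr0. Qed.

Lemma kcoef_val u u' k : wvalid u' -> kcoef u (wval u' * inR k) =
  if pselect (u' = u) then eps (wtgt u) * k else 0.
Proof. by move=> vu'; rewrite /kcoef; case: cid => c /= [_ ->]. Qed.

Lemma kcoefM u r k : kcoef u (r * inR k) = kcoef u r * k.
Proof.
apply: (wval_span (P := fun r => kcoef u (r * inR k) = kcoef u r * k)).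
- by rewrite mul0r kcoef0 mul0r.
- by move=> r1 r2 h1 h2; rewrite mulrDl !kcoefD h1 h2 mulrDl.
- move=> u' k' vu'; rewrite -mulrA -rmorphM !kcoef_val //.
  by case: pselect => /= ?; rewrite ?mul0r // mulrA.
Qed.

Lemma kcoef_e u r : eps (wtgt u) * kcoef u r = kcoef u r.
Proof.
apply: (wval_span (P := fun r => eps (wtgt u) * kcoef u r = kcoef u r)).
- by rewrite kcoef0 mulr0.
- by move=> r1 r2 h1 h2; rewrite !kcoefD mulrDr h1 h2.
- move=> u' k vu'; rewrite kcoef_val //; case: pselect => /= [?|?].
    by rewrite mulrA prod_idemM eqxx.
  by rewrite mulr0.
Qed.

(** The coefficient at an empty word recovers an element of a factor. *)
Lemma iota_inj l : injective (iota l).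
Proof.
move=> a b /eqP; rewrite -subr_eq0 -rmorphB => /eqP ab0.
apply/eqP; rewrite -subr_eq0; apply/eqP; set y := a - b in ab0 *.
rewrite -[y]mul1r -(idemA_sum (F l)) mulr_suml big1 // => i _.
have vi : wvalid (i, [::]) by [].
have := @fcoef_block l (i, [::]) (i, [::]) y vi (fun h => ltac:(discriminate h)).
by rewrite ab0 mulr0 fcoef0; case: pselect.
Qed.

Definition wmon : Type := {u : rword | wvalid u}.

Definition wcoef (mu : option L) (u : wmon) (r : R) : R :=
  match mu with
  | Some l => iota l (fcoef l (sval u) r)
  | None => inR (kcoef (sval u) r)
  end.

Lemma wgood l (u : wmon) : Some l = None \/ wlast (sval u) <> Some l ->
  wlast (sval u) <> Some l.
Proof. by case. Qed.

Definition coproduct_normal_forms :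
  normal_forms (fun j => idem R j) factor_image.
Proof.
pose src (u : wmon) := (sval u).1.
pose one j : wmon := exist wvalid (j, [::]) I.
apply: (@NormalForms R p L _ _ wmon src (fun u : wmon => wtgt (sval u))
  (fun u : wmon => wlast (sval u)) (fun u : wmon => size (sval u).2)
  (fun u : wmon => wval (sval u))
  one wcoef) => //.
- by move=> [[i [|a w]] vu] //= _; rewrite /one /src /=; congr exist;
    apply: Prop_irrelevance.
- by move=> [u vu]; apply: wval_src.
- by move=> [u vu]; apply: wval_tgt.
- move=> [[i [|[l' t] w]] vu] //= l [<-].
  have [vw pt st lw] := vu.
  exists (exist wvalid (i, w) vw), (iota l' t); split=> //.
  by exists t.
- move=> [l|] u r s g; first by rewrite /wcoef fcoefD rmorphD.
  by rewrite /wcoef kcoefD rmorphD.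
- move=> [l|] u r s g [a ->]; first by rewrite /wcoef /= fcoefM rmorphM.
  by rewrite /wcoef /= kcoefM rmorphM.
- by move=> [l|] u r g; [exists (fcoef l (sval u) r) | exists (kcoef (sval u) r)].
- move=> [l|] [u vu] r g; first by rewrite /wcoef -(iota_idem l) -rmorphM fcoef_e.
  by rewrite /wcoef /idem -rmorphM kcoef_e.
- move=> [l|] [u vu] g; rewrite /wcoef /= -[wval u]mulr1 -(rmorph1 inR).
    rewrite fcoef_val // wsplit_good; last exact: (wgood g).
    by case: pselect => //= ?; rewrite /= rmorph1 mulr1 iota_idem.
  by rewrite kcoef_val //; case: pselect => //= ?; rewrite mulr1.
- move=> [l|] [u vu] [u' vu'] g g' ne; rewrite /wcoef /= -[wval u']mulr1 -(rmorph1 inR).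
    rewrite fcoef_val // wsplit_good; last exact: (wgood g').
    case: pselect => /= [uu'|_]; last by rewrite rmorph0.
    by case: ne; subst u'; congr exist; apply: Prop_irrelevance.
  rewrite kcoef_val //; case: pselect => /= [uu'|_]; last by rewrite rmorph0.
  by case: ne; subst u'; congr exist; apply: Prop_irrelevance.
- move=> P P0 PD Pv; apply: wval_span => // u k vu.
  by apply: (Pv (exist wvalid u vu)); exists k.
Defined.

End CoproductNF.

(** * Cancellation of pseudo-free modules *)

Section Submodule.
Variables (A R : pzRingType) (f : {rmorphism A -> R}) (N : lmodType R^c).
Variable V : N -> Prop.
Hypotheses (V0 : V 0) (VD : forall x y, V x -> V y -> V (x + y)).
Hypothesis VZ : forall x a, V x -> V (x ** f a).

Record submodule := Submodule { smval : N; smvalP : V smval }.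

Lemma smval_inj : injective smval.
Proof.
by move=> [x Vx] [y Vy] /= xy; subst y; congr Submodule; exact: Prop_irrelevance.
Qed.

HB.instance Definition _ := gen_eqMixin submodule.
HB.instance Definition _ := gen_choiceMixin submodule.

Let VN x : V x -> V (- x).
Proof.
by move=> Vx; rewrite -[x]ract1 -ractNr -(rmorph1 f) -rmorphN; apply: VZ.
Qed.

Definition sm_add x y := Submodule (VD (smvalP x) (smvalP y)).
Definition sm_opp x := Submodule (VN (smvalP x)).

Fact sm_addA : associative sm_add.
Proof. by move=> x y z; apply: smval_inj; apply: addrA. Qed.
Fact sm_addC : commutative sm_add.
Proof. by move=> x y; apply: smval_inj; apply: addrC. Qed.
Fact sm_add0 : left_id (Submodule V0) sm_add.
Proof. by move=> x; apply: smval_inj; apply: add0r. Qed.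
Fact sm_addN : left_inverse (Submodule V0) sm_opp sm_add.
Proof. by move=> x; apply: smval_inj; apply: addNr. Qed.
HB.instance Definition _ := GRing.isZmodule.Build submodule
  sm_addA sm_addC sm_add0 sm_addN.

Definition sm_scale (a : A^c) x := Submodule (VZ a (smvalP x)).

Fact sm_scaleA a b x : sm_scale a (sm_scale b x) = sm_scale (a * b) x.
Proof. by apply: smval_inj; rewrite /= -ractM -rmorphM. Qed.
Fact sm_scale1 : left_id 1 sm_scale.
Proof. by move=> x; apply: smval_inj; rewrite /= rmorph1 ract1. Qed.
Fact sm_scaleDr : right_distributive sm_scale +%R.
Proof. by move=> a x y; apply: smval_inj; rewrite /= ractDl. Qed.
Fact sm_scaleDl x : {morph sm_scale^~ x : a b / a + b}.
Proof. by move=> a b; apply: smval_inj; rewrite /= rmorphD ractDr. Qed.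
HB.instance Definition _ := GRing.Zmodule_isLmodule.Build A^c submodule
  sm_scaleA sm_scale1 sm_scaleDr sm_scaleDl.

Definition submodule_lmod : lmodType A^c := submodule.

Lemma smval0 : smval (0 : submodule_lmod) = 0. Proof. by []. Qed.
Lemma smvalD (x y : submodule_lmod) : smval (x + y) = smval x + smval y.
Proof. by []. Qed.
Lemma smvalZ (x : submodule_lmod) a : smval (x ** a) = smval x ** f a.
Proof. by []. Qed.
Lemma smval_sum (I : Type) (s : seq I) (P : pred I) (g : I -> submodule_lmod) :
  smval (\sum_(i <- s | P i) g i) = \sum_(i <- s | P i) smval (g i).
Proof. exact: (big_morph smval smvalD smval0). Qed.

End Submodule.

Section Cancellation.
Variables (p : nat) (K : 'I_p -> unitRingType) (L : Type).
Hypothesis skewK : forall j, GRing.field_axiom (K j).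
Local Notation R0 := (prod_ring K).
Variables (F : L -> ringUnder R0) (R : ringUnder R0).
Hypothesis faithF : forall l, faithful (F l).
Variable iota : forall l : L, {rmorphism F l -> R}.
Hypothesis iotaU : forall l, is_underMor (iota l).
Hypothesis iotaI : forall l, injective (iota l).
Hypothesis condP : conditionP F.
Variable l0 : L.
Local Notation im := (factor_image iota).
Local Notation e := (fun j => idem R j).
Implicit Types (l : L).

Lemma under_inj : injective (under_map R).
Proof. by move=> k k'; rewrite -!(iotaU l0) => /iotaI /faithF. Qed.

Lemma factor_based : based_subrings e im.
Proof.
split.
- by move=> mu; exists 1; rewrite rmorph1.
- by move=> mu _ _ [a ->] [b ->]; exists (a - b); rewrite rmorphB.
- by move=> mu _ _ [a ->] [b ->]; exists (a * b); rewrite rmorphM.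
- move=> [l|] _ [k ->]; last by exists k.
  by exists (under_map (F l) k); rewrite [RHS]iotaU.
- by move=> j; exists (prod_idem K j).
- by move=> i j; rewrite idemM.
- by rewrite -rmorph_sum prod_idem_sum rmorph1.
- move=> j; rewrite /idem -(iotaU l0) -(rmorph0 (iota l0)).
  apply/eqP => /iotaI /eqP; apply/negP; exact: idem_nz.
- by move=> j _ [k ->] /=; rewrite /idem -!rmorphM prod_idem_comm.
- move=> j _ [k ->] /=; rewrite /idem -rmorphM => nk.
  have [|k' [h1 h2]] := prod_idem_inv skewK (j := j) (k := k).
    by apply: contraNneq nk => ->; rewrite rmorph0.
  by exists (under_map R k'); rewrite -!rmorphM h1 h2; split=> //; exists k'.
Qed.
Let bs := factor_based.

Variable N : lmodType R^c.

Section OneFactor.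
Variable l : L.

Section OneModule.
Variable V : N -> Prop.
Hypothesis sV : submod (im (Some l)) V.

Let V0 : V 0. Proof. by case: sV. Qed.
Let VD x y : V x -> V y -> V (x + y). Proof. by case: sV => _ h _; apply: h. Qed.
Let VZ x (a : F l) : V x -> V (x ** iota l a).
Proof. by case: sV => _ _ h; apply: h; exists a. Qed.

Definition fmod : lmodType (F l)^c := submodule_lmod V0 VD VZ.

(** Over a subring of R that is the faithful image of F l, coordinates in R and
    in F l are interchangeable. *)
Lemma factor_basis_pseudo_free (J : finType) (t : J -> 'I_p) (w : J -> N) :
  factor_basis e im l V t w -> pseudo_free fmod.
Proof.
move=> [we Vw ind].
have wV k : V (w k).
  by apply/Vw; apply: lin_gen; [exact: (im1 bs) | exists k].
pose m k : fmod := Submodule (wV k).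
have ef j : iota l (idem (F l) j) = e j by exact: iotaU.
have w_inj : injective w.
  move=> k k' wk; apply/eqP; apply: contraT => kk'.
  have := ind (fun i => if i == k then e (t k) else if i == k' then - e (t k) else 0).
  have sum0 : \sum_i w i ** (if i == k then e (t k) else
      if i == k' then - e (t k) else 0) = 0.
    have k'k : k' != k by rewrite eq_sym.
    rewrite (bigD1 k) //= eqxx (bigD1 k') //= eqxx.
    rewrite (negbTE k'k) big1 => [|i /andP[h1 h2]].
      by rewrite addr0 -wk ractNr addrN.
    by rewrite (negbTE h1) (negbTE h2) ractr0.
  move=> /(_ _ sum0 k); rewrite eqxx (ee bs).
  have imf i : im (Some l) (if i == k then e (t k) else
      if i == k' then - e (t k) else 0).
    case: eqP => _; first exact: im_e bs _ _.
    case: eqP => _; last exact: im0 bs _.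
    by apply: (imN bs); apply: im_e bs _ _.
  by move=> /(_ imf) /eqP; rewrite (negbTE (idem_neq0 bs _)).
have m_inj : injective m by move=> k k' /(congr1 (@smval _ _ _)) /w_inj.
exists [seq m k | k <- enum J]; split.
  by rewrite map_inj_uniq // enum_uniq.
exists (fun j b => `[< exists k, t k = j /\ b = m k >]); split.
- move=> j b /asboolP [k [<- ->]]; exists (m k); apply: smval_inj.
  by rewrite smvalZ ef /= we.
- move=> b; split=> [/mapP [k _ ->]|[j /asboolP [k [_ ->]]]].
    by exists (t k); apply/asboolP; exists k.
  by apply: map_f; rewrite mem_enum.
- by move=> i j b /asboolP [k [<- ->]] /asboolP [k' [<- /m_inj->]].
move=> admissible y; have [c [ic yc]] := lin_coord bs ((Vw _).1 (smvalP y)).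
have /choice [a ca] : forall k, exists a : F l, c k = iota l a.
  by move=> k; have [a ->] := ic k; exists a.
have /choice [r Pr] : forall b : fmod, exists r : F l,
    forall k, b = m k -> r = idem (F l) (t k) * a k.
  move=> b; have [[k bk]|nb] := EM (exists k, b = m k).
    by exists (idem (F l) (t k) * a k) => k' bk'; have -> : k' = k by apply: m_inj; rewrite -bk.
  by exists 0 => k bk; case: nb; exists k.
exists r; split.
- by move=> j b /asboolP [k [<- bk]]; rewrite (Pr _ _ bk); exists (a k).
- apply: smval_inj; rewrite big_map big_enum smval_sum yc.
  apply: eq_bigr => k _; rewrite smvalZ (Pr _ _ erefl) rmorphM ef /=.
  by rewrite ractM we ca.
- move=> r' adm yr' b /mapP [k _ bk].
  have [|s r'E] := adm (t k) b; first by apply/asboolP; exists k.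
  rewrite (Pr _ _ bk) r'E; apply: iotaI; apply/eqP; rewrite -subr_eq0.
  rewrite -rmorphB -mulrBr rmorphM ef.
  pose d i := r' (m i) - idem (F l) (t i) * a i.
  have -> : e (t k) * iota l (s - a k) = e (t k) * iota l (d k).
    by rewrite /d -bk r'E -mulrBr [in RHS]rmorphM ef (eeM bs).
  apply/eqP; apply: (ind (fun i => iota l (d i))); first by move=> i; exists (d i).
  under eq_bigr do rewrite rmorphB ractDr ractNr.
  rewrite sumrB; apply/eqP; rewrite subr_eq0; apply/eqP.
  have /(congr1 (@smval _ _ _)) := yr'.
  rewrite big_map big_enum smval_sum => yE.
  transitivity (smval y); first by rewrite yE; apply: eq_bigr => i _; rewrite smvalZ.
  by rewrite yc; apply: eq_bigr => i _; rewrite rmorphM ef ractM we ca.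
Qed.

Lemma pseudo_free_factor_basis : pseudo_free fmod ->
  exists (J : finType) (t : J -> 'I_p) (w : J -> N), factor_basis e im l V t w.
Proof.
move=> [B [uB [Bj [Bje BE Bju /= Bc]]]].
have ef j : iota l (idem (F l) j) = e j by exact: iotaU.
have Bnth (k : 'I_(size B)) : nth 0 B k \in B by apply: mem_nth.
have /choice [t Pt] : forall k : 'I_(size B), exists j, nth 0 B k \in Bj j.
  by move=> k; apply/BE.
have nthe (k : 'I_(size B)) : smval (nth 0 B k) ** e (t k) = smval (nth 0 B k).
  have [x xE] := Bje _ _ (Pt k).
  have : nth 0 B k ** idem (F l) (t k) = nth 0 B k.
    by rewrite xE -ractM idemM eqxx.
  by move/(congr1 (@smval _ _ _)); rewrite smvalZ ef.
exists 'I_(size B), t, (fun k : 'I_(size B) => smval (nth 0 B k)); split.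
- exact: nthe.
- move=> y; split; last first.
    by apply: lin_min => // _ [k ->]; apply: smvalP.
  move=> Vy; have [r [_ yE _]] := Bc (Submodule Vy).
  have := congr1 (@smval _ _ _) yE; rewrite /= => ->.
  rewrite big_seq; pose G (z : N) := exists k : 'I_(size B), z = smval (nth 0 B k).
  have [g0 gD gZ] := lin_im_submod bs (Some l) G.
  apply: (big_ind (fun z : fmod => lin (im (Some l)) G (smval z))) => [||b bB].
  + exact: lin0.
  + by move=> x z; apply: gD.
  + rewrite smvalZ; apply: linZ; last by exists (r b).
    by move: bB => /(nthP (0 : fmod)) [k kB <-]; exists (Ordinal kB).
- move=> c ic c0 k.
  have /choice [a ca] : forall i, exists a : F l, c i = iota l a.
    by move=> i; have [a ->] := ic i; exists a.
  have [r0 [_ _ r0u]] := Bc (0 : fmod).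
  have /choice [r Pr] : forall b : fmod, exists r : F l,
      forall i : 'I_(size B), b = nth 0 B i -> r = idem (F l) (t i) * a i.
    move=> b; have [[i bi]|nb] := EM (exists i : 'I_(size B), b = nth 0 B i).
      exists (idem (F l) (t i) * a i) => i' bi'.
      suff -> : i' = i by [].
      apply: val_inj; apply/eqP; rewrite -(nth_uniq (0 : fmod) (ltn_ord i') (ltn_ord i) uB).
      by apply/eqP; exact: (etrans (esym bi') bi).
    by exists 0 => i bi; case: nb; exists i.
  have h1 : {in B, r =1 r0}.
    apply: r0u => [j b bj|].
      have /(nthP (0 : fmod)) [i iB bi] : b \in B by apply/BE; exists j.
      rewrite (Pr _ (Ordinal iB) (esym bi)); exists (a (Ordinal iB)).
      by congr (idem _ _ * _); apply: (Bju _ _ b) => //; rewrite -bi; apply: (Pt (Ordinal iB)).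
    apply: smval_inj; rewrite (big_nth (0 : fmod)) big_mkord smval_sum smval0 -[LHS]c0.
    apply: eq_bigr => i _; rewrite smvalZ (Pr _ _ erefl) rmorphM ef ractM ca.
    by rewrite nthe.
  have h2 : {in B, (fun=> 0) =1 r0}.
    apply: r0u => [j b bj|]; first by exists 0; rewrite mulr0.
    by rewrite big1 // => b _; rewrite ractr0.
  have := h1 _ (Bnth k); rewrite -(h2 _ (Bnth k)) (Pr _ _ erefl) => ea.
  by rewrite ca -ef -rmorphM ea rmorph0.
Qed.

End OneModule.

End OneFactor.

(** The addition map from the product of W and x F l to U is an isomorphism, and the last two of
    these modules are pseudo-free. *)
Lemma conditionP_cancellation : cancellation e im N.
Proof.
move=> l U W j x J t w fU [sW WU [xe Ux] dec dir].
have sU : submod (im (Some l)) U.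
  have [_ Uw _] := fU.
  have [s0 sD sZ] := lin_im_submod bs (Some l) (fun z => exists k, z = w k).
  by split=> [|y z|y r]; rewrite !Uw //; [apply: sD | apply: sZ].
pose X y := exists u r, [/\ (fun z : N => z = 0) u, im (Some l) r & y = u + x ** r].
have s0 : submod (im (Some l)) (fun z : N => z = 0).
  by split=> [|y z -> ->|y r _ ->]; rewrite ?addr0 ?ract0r.
have sX : submod (im (Some l)) X := submod_add_line bs x s0.
have XE y : X y -> exists2 r, im (Some l) r & y = x ** r.
  by move=> [u [r [-> ir ->]]]; exists r; rewrite ?add0r.
have XI r : im (Some l) r -> X (x ** r) by move=> ir; exists 0, r; rewrite add0r.
have XU y : X y -> U y by move=> /XE [r ir ->]; have [_ _ h] := sU; apply: h.
have fX : factor_basis e im l X (fun _ : unit => j) (fun _ : unit => x).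
  split=> // [y|r ir].
    split=> [/XE [r ir ->]|]; first by apply: linZ => //; exists tt.
    apply: lin_min => // _ [_ ->]; rewrite -[x]ract1; apply: XI; exact: (im1 bs).
  rewrite (bigD1 tt) //= big1 ?addr0 => [xr [] |[] //].
  by apply: dir => //; rewrite xr; have [] := sW.
have pfX := factor_basis_pseudo_free sX fX.
have pfU := factor_basis_pseudo_free sU fU.
apply: (pseudo_free_factor_basis (sV := sW)).
apply: (condP (mu := Some l) pfX pfU).
have addU (v : fmod sW * fmod sX) : U (smval v.1 + smval v.2).
  have [_ h _] := sU; apply: h; first by apply: WU; apply: smvalP.
  by apply: XU; apply: smvalP.
pose f (v : fmod sW * fmod sX) : fmod sU := Submodule (addU v).
have fL : linear f.
  move=> a v v'; apply: smval_inj.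
  change (smval v.1 ** iota l a + smval v'.1 +
    (smval v.2 ** iota l a + smval v'.2) =
    (smval v.1 + smval v.2) ** iota l a + (smval v'.1 + smval v'.2)).
  by rewrite ractDl addrACA.
pose fl : {linear (fmod sW * fmod sX)%type -> fmod sU} :=
  HB.pack f (GRing.isLinear.Build _ _ _ _ f fL).
have fI : injective f.
  move=> [y z] [y' z'] /(congr1 (@smval _ _ _)) /= yz.
  have yy' : smval y - smval y' = smval z' - smval z.
    by apply/eqP; rewrite subr_eq addrAC eq_sym subr_eq addrC -yz addrC.
  have [r ir zr] : exists2 r, im (Some l) r & smval z' - smval z = x ** r.
    by apply: XE; apply: (submod_imB bs sX); apply: smvalP.
  have /(dir _ ir) er : W (x ** r).
    by rewrite -zr -yy'; apply: (submod_imB bs sW); apply: smvalP.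
  have z0 : smval z' - smval z = 0 by rewrite zr -xe -ractM er ractr0.
  congr (_, _); apply: smval_inj; apply/eqP; first by rewrite -subr_eq0 yy' z0.
  by rewrite eq_sym -subr_eq0 z0.
have /choice [g gK] : forall u : fmod sU, exists v, f v = u.
  move=> [u Uu]; have [y [r [Wy ir uE]]] := dec u Uu.
  exists (Submodule Wy, Submodule (XI r ir)); apply: smval_inj.
  exact: esym uE.
by exists fl; exists g => v; [apply: fI; rewrite gK | rewrite /= gK].
Qed.

End Cancellation.

(** * From moves of bases to morphisms of the groupoid *)

Section GroupoidFacts.
Variables (p : nat) (K : 'I_p -> unitRingType).
Local Notation R0 := (prod_ring K).
Variable R : ringUnder R0.
Implicit Types s t u : word p.

Lemma in_MxD m n (s : m.-tuple 'I_p) (t : n.-tuple 'I_p) (A B : 'M[R]_(m, n)) :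
  in_Mx s t A -> in_Mx s t B -> in_Mx s t (A + B).
Proof.
move=> MA MB i j; have [r Ar] := MA i j; have [r' Br] := MB i j.
by exists (r + r'); rewrite mxE Ar Br mulrDr mulrDl.
Qed.

Lemma in_MxN m n (s : m.-tuple 'I_p) (t : n.-tuple 'I_p) (A : 'M[R]_(m, n)) :
  in_Mx s t A -> in_Mx s t (- A).
Proof.
move=> MA i j; have [r Ar] := MA i j.
by exists (- r); rewrite mxE Ar mulrN mulNr.
Qed.

Section Generated.
Variable S : morset R.
Hypothesis soundS : forall s t (A : 'M_(wsize t, wsize s)), S A -> GLgroupoid A.

Lemma gen_mor_sound s t (A : 'M_(wsize t, wsize s)) :
  gen_mor S A -> GLgroupoid A.
Proof.
elim=> {s t A} [s _|s t u A B SA _ GB|s t u A A' B SA inv _ GB].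
- exact: in_GL_idmx.
- exact: in_GL_mul (soundS SA) GB.
- apply: in_GL_mul GB; have [MA _] := soundS SA; exact: in_GL_inv MA inv.
Qed.

Lemma gen_mor_comp s t u (A : 'M_(wsize u, wsize t)) (B : 'M_(wsize t, wsize s)) :
  gen_mor S A -> gen_mor S B -> gen_mor S (A *m B).
Proof.
move=> GA; elim: GA B => {t u A} [t ot|t u v A A2 SA _ IH|t u v A A' A2 SA inv _ IH] B GB.
- by have [MB _] := gen_mor_sound GB; rewrite (mul_idmx MB).
- by rewrite -mulmxA; apply: GenMul SA (IH _ GB).
- by rewrite -mulmxA; apply: GenInv SA inv (IH _ GB).
Qed.

Lemma gen_mor_gen s t (A : 'M_(wsize t, wsize s)) : S A -> gen_mor S A.
Proof.
move=> SA; have [MA _] := soundS SA.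
rewrite -(mulmx_idmx MA); apply: (GenMul SA); apply: GenId.
by exists t; left; exists A.
Qed.

End Generated.

Section Based.
Variables (Rmu : ringUnder R0) (j : {rmorphism Rmu -> R}).
Hypothesis jU : is_underMor j.

Lemma map_idem i : j (idem Rmu i) = idem R i.
Proof. exact: jU. Qed.

Lemma map_in_Mx m n (s : m.-tuple 'I_p) (t : n.-tuple 'I_p) (A : 'M[Rmu]_(m, n)) :
  in_Mx s t A -> in_Mx s t (map_mx j A).
Proof.
move=> MA i k; have [r Ar] := MA i k.
by exists (j r); rewrite mxE Ar !rmorphM !map_idem.
Qed.

Lemma map_idmx m (s : m.-tuple 'I_p) : map_mx j (idmx Rmu s) = idmx R s.
Proof.
apply/matrixP=> i k; rewrite !mxE; case: eqP => [->|_].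
  by rewrite !mulr1n map_idem.
by rewrite !mulr0n rmorph0.
Qed.

Lemma map_in_GL m n (s : m.-tuple 'I_p) (t : n.-tuple 'I_p) (A : 'M[Rmu]_(m, n)) :
  in_GL s t A -> in_GL s t (map_mx j A).
Proof.
move=> [MA [B [MB AB BA]]]; split; first exact: map_in_Mx.
exists (map_mx j B); split; first exact: map_in_Mx.
  by rewrite -map_mxM AB map_idmx.
by rewrite -map_mxM BA map_idmx.
Qed.

Lemma based_gens_sound s t (A : 'M_(wsize t, wsize s)) :
  based_gens j A -> GLgroupoid A.
Proof.
case=> {s t A} [s t A|s A GA]; first exact: map_in_GL.
elim: GA => [|D D' [GD _] _ GD'|D D1 D' [GD _] inv _ GD'].
- exact: in_GL_idmx.
- exact: in_GL_mul GD GD'.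
- apply: in_GL_mul GD'; have [MD _] := GD; exact: in_GL_inv MD inv.
Qed.

Lemma based_groupoid_sound s t (A : 'M_(wsize t, wsize s)) :
  based_groupoid j A -> GLgroupoid A.
Proof. exact: (gen_mor_sound based_gens_sound). Qed.

Lemma based_groupoid_gen s t (A : 'M_(wsize t, wsize s)) :
  based_gens j A -> based_groupoid j A.
Proof. exact: (gen_mor_gen based_gens_sound). Qed.

(** The inverse is obtained by changing the sign of B, since C A = 0. *)
Lemma transvection_in_GL s (A : 'M[Rmu]_(wsize s, p)) (B : 'M[R]_p)
    (C : 'M[Rmu]_(p, wsize s)) : in_Mx s (ord_tuple p) A ->
  in_Mx (ord_tuple p) (ord_tuple p) B -> in_Mx (ord_tuple p) s C ->
  C *m A = 0 -> in_GL s s (idmx R s + map_mx j A *m B *m map_mx j C).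
Proof.
move=> MA MB MC CA; set D := _ *m B *m _.
have MD : in_Mx s s D.
  by apply: in_Mx_mul (map_in_Mx MC); apply: in_Mx_mul MB; apply: map_in_Mx.
have DD : D *m D = 0.
  rewrite /D -[_ *m _ *m (_ *m _ *m _)]mulmxA.
  rewrite (mulmxA (map_mx j C)) (mulmxA (map_mx j C)) -map_mxM CA.
  by rewrite map_mx0 !mul0mx mulmx0.
have Ms := in_Mx_idmx R s; have II : idmx R s *m idmx R s = idmx R s := mul_idmx Ms.
split; first exact: in_MxD.
exists (idmx R s - D); split; first by apply: in_MxD => //; apply: in_MxN.
  rewrite mulmxDl !mulmxBr DD subr0 II (mul_idmx MD) (mulmx_idmx MD).
  by rewrite subrK.
rewrite mulmxBl !mulmxDr DD addr0 II (mul_idmx MD) (mulmx_idmx MD).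
by rewrite addrK.
Qed.

End Based.
End GroupoidFacts.

Section FamMatrix.
Variables (p : nat) (K : 'I_p -> unitRingType) (L : Type).
Local Notation R0 := (prod_ring K).
Variables (F : L -> ringUnder R0) (R : ringUnder R0).
Variable iota : forall l : L, {rmorphism F l -> R}.
Hypothesis iotaU : forall l, is_underMor (iota l).
Hypothesis extI : forall mu, injective (ext_map iota mu).
Local Notation im := (factor_image iota).
Local Notation e := (fun j => idem R j).
Variable N : lmodType R^c.
Hypothesis bs : based_subrings e im.
Implicit Types (b : fam p L N) (s t : word p) (mu : option L).

Definition factor_gens : morset R :=
  fun s t A => exists mu, based_groupoid (ext_map iota mu) A.

Lemma extU mu : is_underMor (ext_map iota mu).
Proof. by case: mu => [l|] //; apply: iotaU. Qed.

Lemma factor_gens_sound s t (A : 'M_(wsize t, wsize s)) :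
  factor_gens A -> GLgroupoid A.
Proof. by move=> [mu]; apply: based_groupoid_sound; apply: extU. Qed.

Definition enumerates b s (h : 'I_(wsize s) -> fI b) : Prop :=
  bijective h /\ forall k, tnth s k = ft (h k).

Lemma basis_coord b : is_basis e b -> forall c d : fI b -> R,
  \sum_i b i ** c i = \sum_i b i ** d i -> forall i, e (ft i) * c i = e (ft i) * d i.
Proof.
move=> [_ _ b3] c d cd i; have [D [lD Db]] := b3 i.
have sumD (c' : fI b -> R) : D (\sum_i b i ** c' i) = e (ft i) * c' i.
  rewrite rlin_sum // (bigD1 i) //= big1 ?addr0 => [|k ki]; rewrite lD.2 Db.
    by rewrite eqxx.
  by rewrite (negbTE ki) mul0r.
by rewrite -!sumD cd.
Qed.

Lemma enumerates_sum b s (h : 'I_(wsize s) -> fI b) (G : fI b -> N) :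
  enumerates h -> \sum_i G i = \sum_k G (h k).
Proof. by move=> [hb _]; rewrite (reindex h) //; apply: onW_bij. Qed.

Lemma enumerates_coord b s (h : 'I_(wsize s) -> fI b) : is_basis e b ->
  enumerates h -> forall c d : 'I_(wsize s) -> R,
  \sum_k b (h k) ** c k = \sum_k b (h k) ** d k ->
  forall k, e (tnth s k) * c k = e (tnth s k) * d k.
Proof.
move=> bb eh c d cd k; have [[g hK gK] hs] := eh.
have := basis_coord bb (c := c \o g) (d := d \o g) _ (h k).
rewrite /= hK hs; apply; rewrite !(enumerates_sum _ eh) /=.
by under eq_bigr do rewrite hK; under [RHS]eq_bigr do rewrite hK.
Qed.

Lemma span_matrix mu b s (h : 'I_(wsize s) -> fI b) (s' : word p)
    (f : 'I_(wsize s') -> N) : is_basis e b -> enumerates h ->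
  (forall k, f k ** e (tnth s' k) = f k) ->
  (forall k, lin (im mu) (gen b) (f k)) ->
  exists A : 'M[ext_family F mu]_(wsize s, wsize s'), in_Mx s s' A /\
    forall k', f k' = \sum_k b (h k) ** ext_map iota mu (A k k').
Proof.
move=> bb eh fe fl; have [b1 _ _] := bb; have [_ hs] := eh.
have /choice [a aP] : forall k', exists a : 'I_(wsize s) -> ext_family F mu,
    f k' = \sum_k b (h k) ** ext_map iota mu (a k).
  move=> k'; have [c [ic ->]] := lin_coord bs (fl k').
  have /choice [a ca] : forall i, exists a : ext_family F mu, c i = ext_map iota mu a.
    by move=> i; have [a ->] := ic i; exists a.
  exists (a \o h); rewrite (enumerates_sum _ eh).
  by apply: eq_bigr => k _; rewrite ca.
exists (\matrix_(k, k') (idem _ (tnth s k) * a k' k * idem _ (tnth s' k'))).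
split=> [k k'|k']; first by exists (a k' k); rewrite mxE.
rewrite -fe aP ract_suml; apply: eq_bigr => k _.
rewrite mxE !rmorphM !(map_idem (extU mu)) !ractM.
by rewrite hs b1.
Qed.

(** Each basis has coordinates over R_mu in terms of the other one. The two
    coordinate matrices are inverse to one another over R, hence over R_mu. *)
Lemma span_step_matrix mu b b' s s' (h : 'I_(wsize s) -> fI b)
    (h' : 'I_(wsize s') -> fI b') : is_basis e b -> is_basis e b' ->
  enumerates h -> enumerates h' ->
  (forall i, lin (im mu) (gen b) (b' i)) ->
  (forall i, lin (im mu) (gen b') (b i)) ->
  exists M, @gen_mor _ _ _ factor_gens s' s M /\
    forall k', b' (h' k') = \sum_k b (h k) ** M k k'.
Proof.
move=> bb bb' eh eh' bb'l b'bl; have [b1 _ _] := bb; have [b1' _ _] := bb'.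
have be k : b (h k) ** e (tnth s k) = b (h k) by rewrite eh.2 b1.
have be' k : b' (h' k) ** e (tnth s' k) = b' (h' k) by rewrite eh'.2 b1'.
have [A [MA bA]] := span_matrix bb eh be' (fun k => bb'l (h' k)).
have [A' [MA' bA']] := span_matrix bb' eh' be (fun k => b'bl (h k)).
have prod (c c2 : fam p L N) s1 s2 (h1 : 'I_(wsize s1) -> fI c) (h2 : 'I_(wsize s2) -> fI c2)
    (X : 'M[ext_family F mu]_(wsize s1, wsize s2)) (Y : 'M[ext_family F mu]_(wsize s2, wsize s1)) :
    is_basis e c -> enumerates h1 -> in_Mx s1 s2 X -> in_Mx s2 s1 Y ->
    (forall k', c2 (h2 k') = \sum_k c (h1 k) ** ext_map iota mu (X k k')) ->
    (forall k', c (h1 k') = \sum_k c2 (h2 k) ** ext_map iota mu (Y k k')) ->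
    X *m Y = idmx _ s1.
  move=> bc e1 MX MY hX hY; apply/matrixP => i k; have [c1 _ _] := bc.
  have [r XYr] := in_Mx_mul MX MY i k; apply: (extI (mu := mu)).
  have -> : ext_map iota mu ((X *m Y) i k) =
      e (tnth s1 i) * ext_map iota mu ((X *m Y) i k).
    by rewrite XYr !rmorphM !(map_idem (extU mu)) !mulrA idemM eqxx.
  have -> : ext_map iota mu (idmx _ s1 i k) =
      e (tnth s1 i) * (if i == k then e (tnth s1 k) else 0).
    rewrite !mxE; case: eqP => [->|_]; last by rewrite mulr0n rmorph0 mulr0.
    by rewrite mulr1n (map_idem (extU mu)) idemM eqxx.
  apply: (enumerates_coord bc e1 (c := fun i => ext_map iota mu ((X *m Y) i k))
    (d := fun i => if i == k then e (tnth s1 k) else 0)) => //.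
  rewrite [RHS](bigD1 k) //= eqxx [X in _ + X]big1 => [|i' /negbTE->]; last first.
    by rewrite ractr0.
  rewrite addr0 e1.2 c1 [RHS]hY.
  under [RHS]eq_bigr do rewrite hX ract_suml.
  rewrite exchange_big; apply: eq_bigr => i' _.
  rewrite mxE rmorph_sum ract_sumr; apply: eq_bigr => k' _.
  by rewrite rmorphM ractM.
exists (map_mx (ext_map iota mu) A); split; last first.
  by move=> k'; rewrite bA; apply: eq_bigr => k _; rewrite mxE.
apply: gen_mor_gen; first exact: factor_gens_sound.
exists mu; apply: based_groupoid_gen; first exact: extU.
apply: BasedGL; split=> //; exists A'; split=> //.
  exact: (prod _ _ _ _ h h' _ _ bb eh MA MA' bA bA').
exact: (prod _ _ _ _ h' h _ _ bb' eh' MA' MA bA' bA).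
Qed.

(** With respect to the basis, a is a column and D a row over R_mu. The word of all
    idempotents in the middle allows an arbitrary scalar beta between them: it is
    cut into its pieces e i * beta * e j. *)
Lemma transvect_step_matrix mu a beta D b s (h : 'I_(wsize s) -> fI b) : is_basis e b ->
  enumerates h -> lin (im mu) (gen b) a -> rlin D ->
  (forall k, im mu (D (b k))) -> D a = 0 ->
  exists M, @gen_mor _ _ _ factor_gens s s M /\
    forall k', transvect (a ** beta) D (b (h k')) = \sum_k b (h k) ** M k k'.
Proof.
move=> bb eh la lD iD Da; have [b1 _ _] := bb; have [_ hs] := eh.
set f := ext_map iota mu; have fe := map_idem (extU mu).
have be k : b (h k) ** e (tnth s k) = b (h k) by rewrite hs b1.
have [c [ic aE]] := lin_coord bs la.
have /choice [a' ca'] : forall k, exists a0 : ext_family F mu, c (h k) = f a0.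
  by move=> k; have [a0 ->] := ic (h k); exists a0.
have /choice [d dP] : forall k, exists d : ext_family F mu, D (b (h k)) = f d.
  by move=> k; have [d ->] := iD (h k); exists d.
have de k : f (d k) * e (tnth s k) = f (d k) by rewrite -dP -lD.2 be.
pose A : 'M[ext_family F mu]_(wsize s, p) :=
  \matrix_(k, j) (idem _ (tnth s k) * a' k * idem _ j).
pose B : 'M[R]_p := \matrix_(i, j) (e i * beta * e j).
pose C : 'M[ext_family F mu]_(p, wsize s) :=
  \matrix_(j, k) (idem _ j * d k * idem _ (tnth s k)).
have MA : in_Mx s (ord_tuple p) A.
  by move=> k j; exists (a' k); rewrite mxE tnth_ord_tuple.
have MB : in_Mx (ord_tuple p) (ord_tuple p) B.
  by move=> i j; exists beta; rewrite mxE !tnth_ord_tuple.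
have MC : in_Mx (ord_tuple p) s C.
  by move=> j k; exists (d k); rewrite mxE tnth_ord_tuple.
have aE' : a = \sum_k b (h k) ** f (a' k).
  by rewrite aE (enumerates_sum _ eh); apply: eq_bigr => k _; rewrite ca'.
have CA : C *m A = 0.
  apply/matrixP=> i j; rewrite !mxE; apply: (extI (mu := mu)); rewrite rmorph0.
  rewrite rmorph_sum (eq_bigr (fun k => e i * (D (b (h k)) * f (a' k)) * e j)).
    rewrite -mulr_suml -mulr_sumr.
    have -> : \sum_k D (b (h k)) * f (a' k) = D a.
      by rewrite aE' rlin_sum //; apply: eq_bigr => k _; rewrite lD.2.
    by rewrite Da mulr0 mul0r.
  move=> k _; rewrite !mxE !rmorphM !fe dP !mulrA.
  congr (_ * _ * _); rewrite -!mulrA; congr (_ * _).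
  by rewrite idemM eqxx de.
have ABC k k' : (map_mx f A *m B *m map_mx f C) k k' =
    e (tnth s k) * f (a' k) * beta * f (d k').
  have idsum : \sum_j idem R j = 1 := idem_sum bs.
  transitivity (\sum_j (\sum_i e (tnth s k) * f (a' k) * e i * beta) * e j * f (d k')).
    rewrite mxE; apply: eq_bigr => j _; rewrite !mxE !mulr_suml.
    apply: eq_bigr => i _; rewrite !mxE !rmorphM !fe !mulrA.
    rewrite -[_ * e i * e i]mulrA idemM eqxx -[_ * e j * e j]mulrA idemM eqxx.
    by rewrite -[RHS]mulrA -{2}de !mulrA.
  rewrite -mulr_suml -mulr_sumr idsum mulr1 -mulr_suml -mulr_sumr idsum.
  by rewrite mulr1.
exists (idmx R s + map_mx f A *m B *m map_mx f C); split.
  apply: gen_mor_gen; first exact: factor_gens_sound.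
  exists mu; apply: based_groupoid_gen; first exact: extU.
  apply: BasedT; have GD := transvection_in_GL (extU mu) MA MB MC CA.
  have [MD _] := GD; rewrite -(mulmx_idmx MD); apply: TransMul (TransId _ _).
  by split=> //; exists A, B, C.
move=> k'; under eq_bigr do rewrite mxE ractDr.
rewrite big_split /= (bigD1 k') //= !mxE eqxx mulr1n be [X in _ + X + _]big1; last first.
  by move=> i /negbTE ik; rewrite !mxE ik mulr0n ractr0.
rewrite addr0 /transvect dP; congr (_ + _); rewrite {1}aE' !ract_suml.
by apply: eq_bigr => k _; rewrite ABC !ractM be.
Qed.

Lemma enumerates_ex b : is_basis e b -> (exists x : N, x != 0) ->
  exists (s : word p) (h : 'I_(wsize s) -> fI b), enumerates h.
Proof.
move=> [b1 b2 b3] [x x0].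
have I0 : (0 < #|fI b|)%N.
  rewrite lt0n; apply: contra x0 => /eqP cI.
  elim: (b2 x) => [//|u v _ /eqP-> _ /eqP->|u r [i _] _]; first by rewrite addr0.
  by case: (fintype0 i cI).
have cE : #|fI b|.-1.+1 = #|fI b| by rewrite prednK.
pose h (k : 'I_(#|fI b|.-1.+1)) : fI b := enum_val (cast_ord cE k).
exists (Word [tuple ft (h k) | k < #|fI b|.-1.+1]), h; split.
  exists (fun i => cast_ord (esym cE) (enum_rank i)) => [k|i].
    by rewrite /h enum_valK cast_ordK.
  by rewrite /h cast_ordKV enum_rankK.
by move=> k; rewrite tnth_mktuple.
Qed.

Lemma bequiv_matrix b b' : bequiv e im b b' -> (exists x : N, x != 0) ->
  forall s s' (h : 'I_(wsize s) -> fI b) (h' : 'I_(wsize s') -> fI b'),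
  enumerates h -> enumerates h' ->
  exists M, @gen_mor _ _ _ factor_gens s' s M /\
    forall k', b' (h' k') = \sum_k b (h k) ** M k k'.
Proof.
move=> E nz; elim: E => {b b'} [b b' bb bb' st|b b' b'' E1 IH1 E2 IH2] s s' h h' eh eh'.
  case: st bb' h' eh' => {b'} [mu b' l1 l2|mu a beta D l' la lD iD Da] bb' h' eh'.
    exact: (span_step_matrix bb bb' eh eh' l1 l2).
  have [M [GM hM]] := transvect_step_matrix beta bb eh la lD iD Da.
  have lrefl i : lin (im None) (gen (Fam (@ft _ _ _ _ b) (transvect (a ** beta) D \o b) l'))
      ((transvect (a ** beta) D \o b) i).
    by apply: lin_gen; [exact: (im1 bs) | exists i].
  have eh1 : @enumerates (Fam (@ft _ _ _ _ b) (transvect (a ** beta) D \o b) l') s h by [].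
  have [M' [GM' hM']] := span_step_matrix bb' bb' eh1 eh' lrefl lrefl.
  exists (M *m M'); split; first exact: (gen_mor_comp factor_gens_sound GM GM').
  move=> k'; rewrite hM' /=; under eq_bigr do rewrite hM ract_suml.
  rewrite exchange_big; apply: eq_bigr => k _; rewrite mxE ract_sumr.
  by apply: eq_bigr => i _; rewrite ractM.
have [_ bb'] := bequiv_basis E1.
have [s1 [h1 eh1]] := enumerates_ex bb' nz.
have [M [GM hM]] := IH1 _ _ _ _ eh eh1.
have [M' [GM' hM']] := IH2 _ _ _ _ eh1 eh'.
exists (M *m M'); split; first exact: (gen_mor_comp factor_gens_sound GM GM').
move=> k'; rewrite hM'; under eq_bigr do rewrite hM ract_suml.
rewrite exchange_big; apply: eq_bigr => k _; rewrite mxE ract_sumr.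
by apply: eq_bigr => i _; rewrite ractM.
Qed.

End FamMatrix.

(** * Columns of a given type, and the theorem *)

Section Columns.
Variables (p : nat) (K : 'I_p -> unitRingType).
Local Notation R0 := (prod_ring K).
Variables (R : ringUnder R0) (L : Type) (im : option L -> R -> Prop).
Local Notation e := (fun j => idem R j).
Variable t : word p.

Definition column_ok (v : 'cV[R^c]_(wsize t)) : Prop :=
  forall i, idem R (tnth t i) * (v i 0 : R) = v i 0.

Lemma column_ok0 : column_ok 0.
Proof. by move=> i; rewrite mxE mulr0. Qed.
Lemma column_okD v w : column_ok v -> column_ok w -> column_ok (v + w).
Proof. by move=> hv hw i; rewrite mxE mulrDr hv hw. Qed.
Lemma column_entryZ (v : 'cV[R^c]_(wsize t)) (r : R) i :
  (v ** r) i 0 = (v i 0 : R) * r.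
Proof. by rewrite mxE. Qed.
Lemma column_okZ v (r : R) : column_ok v -> column_ok (v ** (idfun : {rmorphism R -> R}) r).
Proof. by move=> hv i; rewrite column_entryZ mulrA hv. Qed.

Definition columns : lmodType R^c :=
  submodule_lmod column_ok0 column_okD column_okZ.

Definition entry (v : columns) i : R := smval v i 0.

Lemma entryD v w i : entry (v + w) i = entry v i + entry w i.
Proof. by rewrite /entry smvalD mxE. Qed.
Lemma entryZ v r i : entry (v ** r) i = entry v i * r.
Proof. by rewrite /entry smvalZ column_entryZ. Qed.
Lemma entry_e v i : idem R (tnth t i) * entry v i = entry v i.
Proof. exact: (smvalP v i). Qed.
Lemma entryP v w : (forall i, entry v i = entry w i) -> v = w.
Proof.
move=> vw; apply: smval_inj; apply/matrixP => i j; rewrite (ord1 j).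
exact: vw.
Qed.
Lemma entry0 i : entry 0 i = 0. Proof. by rewrite /entry smval0 mxE. Qed.
Lemma entry_sum (I : Type) (s : seq I) (P : pred I) (f : I -> columns) i :
  entry (\sum_(k <- s | P k) f k) i = \sum_(k <- s | P k) entry (f k) i.
Proof.
exact: (big_morph (entry^~ i) (fun v w => entryD v w i) (entry0 i)).
Qed.

Section OneMatrix.
Variables (s : word p) (A : 'M[R]_(wsize t, wsize s)).

Lemma column_ofP (MA : in_Mx t s A) k :
  column_ok (\col_i (A i k : R^c)).
Proof.
move=> i; rewrite mxE; have [r ->] := MA i k.
by rewrite !mulrA idemM eqxx.
Qed.

Definition column_of (MA : in_Mx t s A) k : columns := Submodule (column_ofP MA k).

Lemma entry_column MA k i : entry (column_of MA k) i = A i k.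
Proof. by rewrite /entry /= mxE. Qed.

Definition column_fam (MA : in_Mx t s A) (l0 : L) : fam p L columns :=
  Fam (tnth s) (column_of MA) (fun=> l0).

Lemma column_basis (MA : in_Mx t s A) l0 :
  (exists B, inverse_Mx t s A B) -> is_basis e (column_fam MA l0).
Proof.
move=> [B [MB AB BA]].
pose D k (v : columns) := \sum_i B k i * entry v i.
have lD k : rlin (D k).
  split=> [v w|v r].
    by rewrite -big_split; apply: eq_bigr => i _; rewrite entryD mulrDr.
  by rewrite mulr_suml; apply: eq_bigr => i _; rewrite entryZ mulrA.
split=> [k|v|k] /=.
- apply: entryP => i; rewrite entryZ entry_column; have [r ->] := MA i k.
  by rewrite -!mulrA idemM eqxx.
- have -> : v = \sum_k column_of MA k ** D k v.
    apply: entryP => i; rewrite entry_sum.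
    under eq_bigr do rewrite entryZ entry_column mulr_sumr.
    rewrite exchange_big /=.
    transitivity (\sum_j idmx R t i j * entry v j).
      rewrite (bigD1 i) //= big1 => [|j ji]; rewrite !mxE.
        by rewrite eqxx mulr1n entry_e addr0.
      by rewrite eq_sym (negbTE ji) mulr0n mul0r.
    apply: eq_bigr => j _; rewrite -AB mxE mulr_suml.
    by apply: eq_bigr => k _; rewrite mulrA.
  apply: submod_sum; first exact: lin_any_submod.
  by move=> k _; apply: linZ => //; exists k.
- exists (D k); split=> // k'; rewrite /D.
  under eq_bigr do rewrite entry_column.
  have := congr1 (fun M : 'M_(_) => M k k') BA; rewrite !mxE => ->.
  by rewrite [k' == k]eq_sym; case: (k == k'); rewrite ?mulr1n ?mulr0n.
Qed.

End OneMatrix.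
End Columns.

Section BaseCase.
Variables (p : nat) (K : 'I_p -> unitRingType) (L : Type).
Local Notation R0 := (prod_ring K).
Variables (F : L -> ringUnder R0) (R : ringUnder R0).
Variable iota : forall l : L, {rmorphism F l -> R}.
Hypothesis coprodR : is_coproduct iota.

(** A coproduct without factors is the base itself. Trees need at least one
    label, so this case is treated separately. *)
Lemma empty_coproduct : ~ inhabited L ->
  injective (under_map R) /\ forall r : R, exists k, r = under_map R k.
Proof.
move=> nL; have g l : {rmorphism F l -> baseUnder R0} by case: nL; exists.
have [|h [hU _ _]] := coprodR.2 (baseUnder R0) g.
  by move=> l; case: nL; exists.
split; first by apply: (can_inj (g := h)) => k; rewrite hU.
apply: (coproduct_ind coprodR) => [|_ _ [k ->] [k' ->]|_ _ [k ->] [k' ->]|k|l].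
- by exists 1; rewrite rmorph1.
- by exists (k - k'); rewrite rmorphB.
- by exists (k * k'); rewrite rmorphM.
- by exists k.
- by case: nL; exists.
Qed.

End BaseCase.

Lemma lift_base_GL (p : nat) (K : 'I_p -> unitRingType)
    (R : ringUnder (prod_ring K)) : injective (under_map R) ->
  (forall r : R, exists k, r = under_map R k) ->
  forall (s t : word p) (A : 'M[R]_(wsize t, wsize s)), in_GL t s A ->
  exists A0 : 'M[baseUnder (prod_ring K)]_(wsize t, wsize s),
    in_GL t s A0 /\ A = map_mx (under_map R) A0.
Proof.
move=> uI uS s t A [MA [B [MB AB BA]]].
have jU : @is_underMor _ (baseUnder (prod_ring K)) R (under_map R) by [].
have lift m n (a : m.-tuple 'I_p) (c : n.-tuple 'I_p) (M : 'M[R]_(m, n)) :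
    in_Mx a c M -> exists M0 : 'M[baseUnder (prod_ring K)]_(m, n),
    in_Mx a c M0 /\ M = map_mx (under_map R) M0.
  move=> MM; have /choice [g gP] : forall ij : 'I_m * 'I_n,
      exists k : prod_ring K, M ij.1 ij.2 = under_map R
        (idem (baseUnder (prod_ring K)) (tnth a ij.1) * k *
         idem (baseUnder (prod_ring K)) (tnth c ij.2)).
    move=> [i j] /=; have [r ->] := MM i j; have [k ->] := uS r.
    by exists k; rewrite !rmorphM.
  exists (\matrix_(i, j) (idem (baseUnder (prod_ring K)) (tnth a i) * g (i, j) *
         idem (baseUnder (prod_ring K)) (tnth c j))).
  split=> [i j|]; first by exists (g (i, j)); rewrite mxE.
  by apply/matrixP=> i j; rewrite !mxE (gP (i, j)).
have [A0 [MA0 AE]] := lift _ _ _ _ _ MA; have [B0 [MB0 BE]] := lift _ _ _ _ _ MB.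
have mI m n (M M' : 'M[baseUnder (prod_ring K)]_(m, n)) :
    map_mx (under_map R) M = map_mx (under_map R) M' -> M = M'.
  move=> /matrixP h; apply/matrixP => i j; apply: uI.
  by have := h i j; rewrite !mxE.
exists A0; split=> //; split=> //; exists B0; split=> //; apply: mI.
  by rewrite map_mxM -AE -BE AB (map_idmx jU).
by rewrite map_mxM -AE -BE BA (map_idmx jU).
Qed.

Theorem theorem3p5 (p : nat) (K : 'I_p -> unitRingType)
    (skewK : forall j : 'I_p, GRing.field_axiom (K j))
    (L : Type) (F : L -> ringUnder (prod_ring K))
    (faithF : forall l : L, faithful (F l))
    (R : ringUnder (prod_ring K))
    (iota : forall l : L, {rmorphism F l -> R})
    (coprodR : is_coproduct iota)
    (condP : conditionP F) :
  generates (fun (s t : word p) (A : 'M[R]_(wsize t, wsize s)) =>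
    exists mu : option L, based_groupoid (ext_map iota mu) A).
Proof.
have iotaU : forall l, is_underMor (iota l) := coprodR.1.
rewrite -/(factor_gens iota).
split=> [s|s t A].
  exists s; left; exists (idmx R s), None; apply: GenId.
  exists s; left; exists (map_mx (under_map R) (idmx (baseUnder _) s)).
  apply: (@BasedGL _ _ _ _ _ s s); exact: in_GL_idmx.
split=> [|GA]; first exact: (gen_mor_sound (factor_gens_sound iotaU)).
have [MA [B invA]] := GA.
have [[l0]|nL] := EM (inhabited L); last first.
  have [uI uS] := empty_coproduct coprodR nL.
  have [A0 [GA0 ->]] := lift_base_GL uI uS GA.
  apply: gen_mor_gen; first exact: (factor_gens_sound iotaU).
  exists None; apply: based_groupoid_gen; first exact: (extU iotaU).
  exact: BasedGL GA0.
have j0 : 'I_p := tnth s ord0.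
have [Bl _] : exists Bl : forall l, right_basis (F l), True.
  have ex l : exists b : right_basis (F l), True.
    by have [b] := right_basis_exists skewK (@faithF l) j0; exists b.
  by exists (fun l => sval (cid (ex l))).
have iotaI := iota_inj coprodR Bl.
have bs := factor_based skewK faithF iotaU iotaI l0.
have extI mu : injective (ext_map iota mu).
  by case: mu => [l|] /=; [exact: iotaI | exact: (under_inj faithF iotaU iotaI l0)].
have canP := conditionP_cancellation skewK faithF iotaU iotaI condP l0 (N := columns R t).
have MI := in_Mx_idmx R t.
have bI : is_basis (fun j => idem R j) (column_fam MI l0).
  by apply: column_basis; have [_ ?] := in_GL_idmx R t.
have bA : is_basis (fun j => idem R j) (column_fam MA l0).
  by apply: column_basis; exists B.
have E := bases_equiv bs canP (coproduct_normal_forms coprodR Bl) bI bA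
  (fun=> erefl) (fun=> erefl).
have nz : exists x : columns R t, x != 0.
  exists (column_of MI ord0); apply/eqP => /(congr1 (fun v => entry v ord0)).
  rewrite entry_column entry0 !mxE eqxx mulr1n => /eqP.
  by rewrite (negbTE (idem_neq0 bs _)).
have enumI : @enumerates _ _ _ _ _ (column_fam MI l0) t id by split=> //; exists id.
have enumA : @enumerates _ _ _ _ _ (column_fam MA l0) s id by split=> //; exists id.
have [M [GM AM]] := bequiv_matrix iotaU extI bs E nz enumI enumA.
have [MM _] := gen_mor_sound (factor_gens_sound iotaU) GM.
suff -> : A = M by [].
apply/matrixP => i k; rewrite -(mul_idmx MM) mxE.
have := congr1 (fun v => entry v i) (AM k); rewrite entry_sum entry_column => ->.
by apply: eq_bigr => k' _; rewrite entryZ entry_column.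
Qed.
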